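(* Let $n\ge1$. As $\lambda$ runs over the shifted Young diagrams with $n$ boxes (i.e. strict partitions $\lambda\Vdash n$), the elements $$\zeta^{\beta}_{\mathcal T\mathcal U}=\phi_{d(\mathcal T)}\,e_{\mathcal R^{\lambda,\beta}}\,\phi^*_{d(\mathcal U)},$$ associated with pairs of standard unbarred tableaux $\mathcal T,\mathcal U$ of shape $\lambda$ and subsets $\beta$ of the set of non-diagonal boxes of $\lambda$, form a basis of the Sergeev superalgebra $\mathcal S_n$ as a (left) module over the Clifford superalgebra $\mathcal{C}l_n$.
   Context: All algebras are over $\mathbb C$. The Sergeev superalgebra $\mathcal S_n=\mathbb C\mathfrak S_n^-\otimes \mathcal{C}l_n$ is the graded tensor product of: the spin symmetric group algebra $\mathbb C\mathfrak S_n^-$, generated by odd $t_1,\dots,t_{n-1}$ with $t_a^2=1$, $t_at_{a+1}t_a=t_{a+1}t_at_{a+1}$, $t_at_b=-t_bt_a$ for $|a-b|>1$; and the Clifford superalgebra $\mathcal{C}l_n$, generated by odd $c_1,\dots,c_n$ with $c_a^2=-1$, $c_ac_b=-c_bc_a$ for $a\neq b$. In particular $t_ac_b=-c_bt_a$ for all $a,b$. For $k<n$, $\mathcal S_k\subset\mathcal S_n$ is generated by $t_1,\dots,t_{k-1},c_1,\dots,c_k$. Put $s_a=\frac1{\sqrt2}t_a(c_{a+1}-c_a)$; these elements satisfy the relations of the adjacent transpositions of $\mathfrak S_n$. For $a<b$ put $t_{ab}=(-1)^{b-a-1}t_{b-1}\cdots t_{a+1}t_at_{a+1}\cdots t_{b-1}$.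 Jucys--Murphy elements: $m_1=0$, $m_a=t_{1a}+\dots+t_{a-1,a}$ for $a\ge2$, and $x_a=\sqrt2\,m_ac_a$ for $a=1,\dots,n$. The $x_a$ commute pairwise. A strict partition $\lambda\Vdash n$ is $\lambda=(\lambda_1>\dots>\lambda_\ell>0)$ with sum $n$. Its shifted Young diagram has boxes $(i,j)$ with $1\le i\le\ell$, $i\le j\le i+\lambda_i-1$; boxes $(i,i)$ are diagonal. A standard (unbarred) tableau of shape $\lambda$ is a bijective filling of the boxes by $1,\dots,n$ with entries increasing along rows and down columns. A standard barred tableau is obtained from a standard tableau by putting bars on an arbitrary subset of the non-diagonal entries. The signed content of the entry $a$ (unbarred) or $\bar a$ (barred) in box $(i,j)$, with $\sigma=j-i$, is $\sqrt{\sigma(\sigma+1)}$, respectively $-\sqrt{\sigma(\sigma+1)}$. The elements $e_{\mathcal U}\in\mathcal S_n$, for standard barred tableaux $\mathcal U$, are defined inductively: $e_{\mathcal U}=1$ for the one-box tableau, and for $n\ge2$ $$e_{\mathcal U}=e_{\mathcal V}\,\frac{(x_n-b_1)\cdots(x_n-b_p)}{(\kappa-b_1)\cdots(\kappa-b_p)},$$ where $\mathcal V$ is obtained from $\mathcal U$ by removing the box containing $n$ or $\bar n$, $\kappa$ is the signed content of that entry, and $b_1,\dots,b_p$ are the signed contents of all possible entries $n$ or $\bar n$ (bars being allowed only in non-diagonal boxes) in all addable boxes of the shape $\mu$ of $\mathcal V$ (boxes whose addition to $\mu$ gives the shifted diagram of a strict partition), except for the actual entry of $\mathcal U$. Intertwiners: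 for $a=1,\dots,n-1$, $$\phi_a=s_a(x_a^2-x_{a+1}^2)+x_a+x_{a+1}-c_ac_{a+1}(x_a-x_{a+1}).$$ They satisfy $\phi_a\phi_{a+1}\phi_a=\phi_{a+1}\phi_a\phi_{a+1}$ and $\phi_a\phi_b=\phi_b\phi_a$ for $|a-b|>1$, so for $w\in\mathfrak S_n$ with a reduced decomposition $w=s_{a_1}\cdots s_{a_r}$ the elements $\phi_w=\phi_{a_1}\cdots\phi_{a_r}$ and $\phi^*_w=\phi_{w^{-1}}=\phi_{a_r}\cdots\phi_{a_1}$ are well defined. $\mathcal R^\lambda$ is the row-tableau, with $1,\dots,n$ written consecutively by rows from left to right, starting from the top row. $\mathfrak S_n$ acts on tableaux by permuting entries, and $d(\mathcal T)\in\mathfrak S_n$ is the unique permutation with $\mathcal T=d(\mathcal T)\mathcal R^\lambda$. $\mathcal R^{\lambda,\beta}$ is obtained from $\mathcal R^\lambda$ by adding bars to all entries in the boxes of $\beta$. *)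

(* Defs.v *)
From HB Require Import structures.
From mathcomp Require Import all_boot all_order all_algebra all_fingroup.
From mathcomp Require Import boolp classical_sets reals.
From mathcomp Require Import complex.

Set Implicit Arguments.
Unset Strict Implicit.
Unset Printing Implicit Defensive.

Import GRing.Theory.
Local Open Scope quotient_scope.
Local Open Scope ring_scope.

(* Associative unital K-algebras given by generators and relations: terms in
   the generators modulo the least congruence that contains the axioms of
   unital K-algebras and the given relations. Since nothing excludes that the
   relations collapse the quotient, it is a pzRingType and an lmodType rather
   than an algType; scalerAl and scalerAr are palg_scalerAl, palg_scalerAr. *)

Inductive term (K G : Type) : Type :=
| Gen of G
| Scal of K
| Add of term K G & term K G
| Mul of term K G & term K G.
Arguments Gen {K G}.
Arguments Scal {K G}.

HB.instance Definition _ (K G : Type) := gen_eqMixin (term K G).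
HB.instance Definition _ (K G : Type) := gen_choiceMixin (term K G).

Fixpoint map_term (K G H : Type) (f : G -> H) (s : term K G) : term K H :=
  match s with
  | Gen g => Gen (f g)
  | Scal a => Scal a
  | Add s1 s2 => Add (map_term f s1) (map_term f s2)
  | Mul s1 s2 => Mul (map_term f s1) (map_term f s2)
  end.

Record presentation (K : Type) := Presentation {
  gens : Type;
  rels : term K gens -> term K gens -> Prop
}.

Section PresentedAlgebra.
Variables (K : pzRingType) (P : presentation K).
Local Notation tm := (term K (gens P)).

Inductive cong : tm -> tm -> Prop :=
| cong_rel s t : rels s t -> cong s t
| cong_refl s : cong s s
| cong_sym s t : cong s t -> cong t s
| cong_trans s t u : cong s t -> cong t u -> cong s u
| cong_add s s' t t' : cong s s' -> cong t t' -> cong (Add s t) (Add s' t')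
| cong_mul s s' t t' : cong s s' -> cong t t' -> cong (Mul s t) (Mul s' t')
| cong_addA s t u : cong (Add s (Add t u)) (Add (Add s t) u)
| cong_addC s t : cong (Add s t) (Add t s)
| cong_add0 s : cong (Add (Scal 0) s) s
| cong_addN s : cong (Add (Mul (Scal (-1)) s) s) (Scal 0)
| cong_mulA s t u : cong (Mul s (Mul t u)) (Mul (Mul s t) u)
| cong_mul1 s : cong (Mul (Scal 1) s) s
| cong_mulDl s t u : cong (Mul (Add s t) u) (Add (Mul s u) (Mul t u))
| cong_mulDr s t u : cong (Mul s (Add t u)) (Add (Mul s t) (Mul s u))
| cong_scalD a b : cong (Scal (a + b)) (Add (Scal a) (Scal b))
| cong_scalM a b : cong (Scal (a * b)) (Mul (Scal a) (Scal b))
| cong_scalC a s : cong (Mul (Scal a) s) (Mul s (Scal a)).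

Definition congb : rel tm := fun s t => `[< cong s t >].

Lemma congb_refl : reflexive congb.
Proof. by move=> s; apply/asboolP/cong_refl. Qed.

Lemma congb_sym : symmetric congb.
Proof. by move=> s t; apply/asboolP/asboolP => /cong_sym. Qed.

Lemma congb_trans : transitive congb.
Proof.
by move=> t s u /asboolP st /asboolP tu; apply/asboolP/(cong_trans st tu).
Qed.

Canonical congb_equiv := EquivRel congb congb_refl congb_sym congb_trans.

Definition palg := {eq_quot congb}.
HB.instance Definition _ := Choice.on palg.
HB.instance Definition _ := EqQuotient.on palg.

Definition pcls (s : tm) : palg := \pi_palg s.
Definition prepr (x : palg) : tm := generic_quotient.repr x.
Definition pgen (g : gens P) : palg := pcls (Gen g).

Definition palg_zero : palg := pcls (Scal 0).
Definition palg_one : palg := pcls (Scal 1).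
Definition palg_add (x y : palg) : palg := pcls (Add (prepr x) (prepr y)).
Definition palg_opp (x : palg) : palg := pcls (Mul (Scal (-1)) (prepr x)).
Definition palg_mul (x y : palg) : palg := pcls (Mul (prepr x) (prepr y)).
Definition palg_scale (a : K) (x : palg) : palg := pcls (Mul (Scal a) (prepr x)).

Lemma pclsP s t : pcls s = pcls t <-> cong s t.
Proof.
split=> [/eqmodP /asboolP //|st]; by apply/eqmodP/asboolP.
Qed.

Lemma pcls_reprK x : pcls (prepr x) = x.
Proof. exact: reprK. Qed.

Lemma repr_pcls s : cong (prepr (pcls s)) s.
Proof. by apply/pclsP; rewrite pcls_reprK. Qed.

Lemma pcls_ind (Q : palg -> Prop) : (forall s, Q (pcls s)) -> forall x, Q x.
Proof. by move=> Qs x; rewrite -[x]pcls_reprK. Qed.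

Lemma pclsA s t : palg_add (pcls s) (pcls t) = pcls (Add s t).
Proof. by apply/pclsP/cong_add; exact: repr_pcls. Qed.

Lemma pclsM s t : palg_mul (pcls s) (pcls t) = pcls (Mul s t).
Proof. by apply/pclsP/cong_mul; exact: repr_pcls. Qed.

Lemma pclsN s : palg_opp (pcls s) = pcls (Mul (Scal (-1)) s).
Proof. by apply/pclsP/cong_mul; [exact: cong_refl|exact: repr_pcls]. Qed.

Lemma pclsZ a s : palg_scale a (pcls s) = pcls (Mul (Scal a) s).
Proof. by apply/pclsP/cong_mul; [exact: cong_refl|exact: repr_pcls]. Qed.

Let pclsE := (pclsA, pclsM, pclsN, pclsZ).

Lemma palg_addA : associative palg_add.
Proof.
elim/pcls_ind=> s; elim/pcls_ind=> t; elim/pcls_ind=> u; rewrite !pclsE.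
exact/pclsP/cong_addA.
Qed.

Lemma palg_addC : commutative palg_add.
Proof.
elim/pcls_ind=> s; elim/pcls_ind=> t; rewrite !pclsE; exact/pclsP/cong_addC.
Qed.

Lemma palg_add0 : left_id palg_zero palg_add.
Proof. by elim/pcls_ind=> s; rewrite !pclsE; exact/pclsP/cong_add0. Qed.

Lemma palg_addN : left_inverse palg_zero palg_opp palg_add.
Proof. by elim/pcls_ind=> s; rewrite !pclsE; exact/pclsP/cong_addN. Qed.

HB.instance Definition _ :=
  GRing.isZmodule.Build palg palg_addA palg_addC palg_add0 palg_addN.

Lemma palg_mulA : associative palg_mul.
Proof.
elim/pcls_ind=> s; elim/pcls_ind=> t; elim/pcls_ind=> u; rewrite !pclsE.
exact/pclsP/cong_mulA.
Qed.

Lemma palg_mul1 : left_id palg_one palg_mul.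
Proof. by elim/pcls_ind=> s; rewrite !pclsE; exact/pclsP/cong_mul1. Qed.

Lemma palg_mulr1 : right_id palg_one palg_mul.
Proof.
elim/pcls_ind=> s; rewrite !pclsE; apply/pclsP.
exact: cong_trans (cong_sym (cong_scalC _ _)) (cong_mul1 _).
Qed.

Lemma palg_mulDl : left_distributive palg_mul palg_add.
Proof.
elim/pcls_ind=> s; elim/pcls_ind=> t; elim/pcls_ind=> u; rewrite !pclsE.
exact/pclsP/cong_mulDl.
Qed.

Lemma palg_mulDr : right_distributive palg_mul palg_add.
Proof.
elim/pcls_ind=> s; elim/pcls_ind=> t; elim/pcls_ind=> u; rewrite !pclsE.
exact/pclsP/cong_mulDr.
Qed.

HB.instance Definition _ := GRing.Zmodule_isPzRing.Build palg
  palg_mulA palg_mul1 palg_mulr1 palg_mulDl palg_mulDr.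

Lemma palg_scaleA a b x : palg_scale a (palg_scale b x) = palg_scale (a * b) x.
Proof.
elim/pcls_ind: x => s; rewrite !pclsE; apply/pclsP.
apply: cong_trans (cong_mulA _ _ _) _.
by apply: cong_mul; [apply/cong_sym/cong_scalM | exact: cong_refl].
Qed.

Lemma palg_scale1 : left_id 1 palg_scale.
Proof. by elim/pcls_ind=> s; rewrite !pclsE; exact/pclsP/cong_mul1. Qed.

Lemma palg_scaleDr : right_distributive palg_scale +%R.
Proof.
move=> a; elim/pcls_ind=> s; elim/pcls_ind=> t.
rewrite -[_ + _]/(palg_add _ _) -[RHS]/(palg_add _ _) !pclsE.
exact/pclsP/cong_mulDr.
Qed.

Lemma palg_scaleDl x : {morph palg_scale^~ x : a b / a + b}.
Proof.
move=> a b; elim/pcls_ind: x => s.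
rewrite -[RHS]/(palg_add _ _) !pclsE; apply/pclsP.
apply: cong_trans (cong_mulDl _ _ _).
by apply: cong_mul; [exact: cong_scalD | exact: cong_refl].
Qed.

HB.instance Definition _ := GRing.Zmodule_isLmodule.Build K palg
  palg_scaleA palg_scale1 palg_scaleDr palg_scaleDl.

Lemma palg_scalerAl (a : K) (x y : palg) : a *: (x * y) = (a *: x) * y.
Proof.
elim/pcls_ind: x => s; elim/pcls_ind: y => t.
rewrite -[LHS]/(palg_scale a (palg_mul _ _)).
rewrite -[RHS]/(palg_mul (palg_scale a _) _) !pclsE.
exact/pclsP/cong_mulA.
Qed.

Lemma palg_scalerAr (a : K) (x y : palg) : a *: (x * y) = x * (a *: y).
Proof.
elim/pcls_ind: x => s; elim/pcls_ind: y => t.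
rewrite -[LHS]/(palg_scale a (palg_mul _ _)).
rewrite -[RHS]/(palg_mul _ (palg_scale a _)) !pclsE; apply/pclsP.
apply: cong_trans (cong_mulA _ _ _) _.
apply: cong_trans (cong_sym (cong_mulA _ _ _)).
by apply: cong_mul; [exact: cong_scalC | exact: cong_refl].
Qed.

End PresentedAlgebra.

Section GradedTensor.
Variables (K : pzRingType) (P Q : presentation K).

(* The graded tensor product of two superalgebras presented by odd generators
   and homogeneous relations. *)
Inductive gtensor_rel :
  term K (gens P + gens Q) -> term K (gens P + gens Q) -> Prop :=
| gtensor_left s t : rels s t -> gtensor_rel (map_term inl s) (map_term inl t)
| gtensor_right s t : rels s t -> gtensor_rel (map_term inr s) (map_term inr t)
| gtensor_anti g h : gtensor_rel
    (Mul (Gen (inl g)) (Gen (inr h)))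
    (Mul (Scal (-1)) (Mul (Gen (inr h)) (Gen (inl g)))).

Definition gtensor := Presentation gtensor_rel.

Lemma cong_map_inr (s t : term K (gens Q)) :
  cong s t -> cong (P := gtensor) (map_term inr s) (map_term inr t).
Proof.
elim=> {s t} /=.
- by move=> s t r; apply: cong_rel; exact: gtensor_right.
- by move=> s; exact: cong_refl.
- by move=> s t _; exact: cong_sym.
- by move=> s t u _ + _; exact: cong_trans.
- by move=> s s' t t' _ + _; exact: cong_add.
- by move=> s s' t t' _ + _; exact: cong_mul.
- by move=> s t u; exact: cong_addA.
- by move=> s t; exact: cong_addC.
- by move=> s; exact: cong_add0.
- by move=> s; exact: cong_addN.
- by move=> s t u; exact: cong_mulA.
- by move=> s; exact: cong_mul1.
- by move=> s t u; exact: cong_mulDl.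
- by move=> s t u; exact: cong_mulDr.
- by move=> a b; exact: cong_scalD.
- by move=> a b; exact: cong_scalM.
- by move=> a s; exact: cong_scalC.
Qed.

(* b |-> 1 (x) b *)
Definition gtensor_inr (b : palg Q) : palg gtensor :=
  pcls (P := gtensor) (map_term inr (prepr b)).

Lemma gtensor_inrE (s : term K (gens Q)) :
  gtensor_inr (pcls s) = pcls (P := gtensor) (map_term inr s).
Proof.
by apply/pclsP/cong_map_inr; exact: repr_pcls.
Qed.

Lemma gtensor_inrD : {morph gtensor_inr : x y / x + y}.
Proof.
elim/pcls_ind=> s; elim/pcls_ind=> t.
by rewrite [pcls s + _]pclsA !gtensor_inrE [RHS]pclsA.
Qed.

Lemma gtensor_inrM : {morph gtensor_inr : x y / x * y}.
Proof.
elim/pcls_ind=> s; elim/pcls_ind=> t.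
by rewrite [pcls s * _]pclsM !gtensor_inrE [RHS]pclsM.
Qed.

Lemma gtensor_inr1 : gtensor_inr 1 = 1.
Proof. exact: gtensor_inrE. Qed.

Lemma gtensor_inrZ a : {morph gtensor_inr : x / a *: x}.
Proof.
elim/pcls_ind=> s.
by rewrite [a *: pcls s]pclsZ !gtensor_inrE [RHS]pclsZ.
Qed.

End GradedTensor.

(* The A-module structure on S is the one given by left multiplication through
   the ring homomorphism f. *)
Definition left_module_basis (A S : pzRingType) (f : A -> S)
    (I : finType) (v : I -> S) : Prop :=
  forall x : S, exists! a : {ffun I -> A}, x = \sum_i f (a i) * v i.

(* From here on all indices are 0-based: t_a (0 <= a < n - 1), c_a and x_a
   (0 <= a < n) are the classical t_(a+1), c_(a+1), x_(a+1); boxes (i, j) and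
   tableau entries also start from 0. *)

Section SergeevPresentation.
Variables (K : pzRingType) (n : nat).

Inductive spin_rel : term K 'I_n.-1 -> term K 'I_n.-1 -> Prop :=
| spin_sq (a : 'I_n.-1) : spin_rel (Mul (Gen a) (Gen a)) (Scal 1)
| spin_braid (a b : 'I_n.-1) : b = a.+1 :> nat -> spin_rel
    (Mul (Mul (Gen a) (Gen b)) (Gen a)) (Mul (Mul (Gen b) (Gen a)) (Gen b))
| spin_anti (a b : 'I_n.-1) : (a.+1 < b)%N || (b.+1 < a)%N -> spin_rel
    (Mul (Gen a) (Gen b)) (Mul (Scal (-1)) (Mul (Gen b) (Gen a))).

Inductive cliff_rel : term K 'I_n -> term K 'I_n -> Prop :=
| cliff_sq (a : 'I_n) : cliff_rel (Mul (Gen a) (Gen a)) (Scal (-1))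
| cliff_anti (a b : 'I_n) : a != b -> cliff_rel
    (Mul (Gen a) (Gen b)) (Mul (Scal (-1)) (Mul (Gen b) (Gen a))).

Definition spin := Presentation spin_rel.
Definition cliff := Presentation cliff_rel.

End SergeevPresentation.

Section Sergeev.
Variables (R : realType) (n : nat).
Local Notation C := (R[i]).

Definition clifford : pzRingType := palg (cliff C n).
Definition sergeev := palg (gtensor (spin C n) (cliff C n)).
HB.instance Definition _ := GRing.PzRing.on sergeev.
HB.instance Definition _ := GRing.Lmodule.on sergeev.

Definition clifford_in : clifford -> sergeev :=
  @gtensor_inr _ (spin C n) (cliff C n).

(* Out-of-range indices are sent to 0; they are never used. *)
Definition tgen (a : nat) : sergeev :=
  if insub a is Some i then pgen (P := gtensor (spin C n) (cliff C n)) (inl i)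
  else 0.
Definition cgen (a : nat) : sergeev :=
  if insub a is Some i then pgen (P := gtensor (spin C n) (cliff C n)) (inr i)
  else 0.

Definition csqrt (k : nat) : C := (Num.sqrt (k%:R : R))%:C%C.

Definition selt (a : nat) : sergeev :=
  (csqrt 2)^-1 *: (tgen a * (cgen a.+1 - cgen a)).

Definition ttransp (a b : nat) : sergeev :=
  (-1) ^+ (b - a - 1) * (\prod_(i <- rev (index_iota a.+1 b)) tgen i)
    * tgen a * (\prod_(i <- index_iota a.+1 b) tgen i).

Definition melt (a : nat) : sergeev := \sum_(0 <= b < a) ttransp b a.

Definition jm (a : nat) : sergeev := csqrt 2 *: (melt a * cgen a).

Definition intertwiner (a : nat) : sergeev :=
  selt a * (jm a ^+ 2 - jm a.+1 ^+ 2) + jm a + jm a.+1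
    - cgen a * cgen a.+1 * (jm a - jm a.+1).

End Sergeev.

Section ReducedWords.
Variable n : nat.

Definition adj_lo (a : 'I_n.-1) : 'I_n := widen_ord (leq_pred n) a.

Lemma adj_hi_subproof (a : 'I_n.-1) : (a.+1 < n)%N.
Proof. by rewrite -ltn_predRL. Qed.

Definition adj_hi (a : 'I_n.-1) : 'I_n := Ordinal (adj_hi_subproof a).

(* w = s_{a1} o ... o s_{ar}, permutations being composed as functions,
   rightmost first; the product of 'S_n composes in the opposite order. *)
Definition word_for (w : 'S_n) (s : seq 'I_n.-1) : Prop :=
  forall k, w k = foldr (fun a l => tperm (adj_lo a) (adj_hi a) l) k s.

Definition reduced_for (w : 'S_n) (s : seq 'I_n.-1) : Prop :=
  word_for w s /\ forall s', word_for w s' -> (size s <= size s')%N.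

(* Every permutation has a reduced word, so the default [::] is never used. *)
Definition reduced_word (w : 'S_n) : seq 'I_n.-1 := xget [::] (reduced_for w).

Definition phi (R : realType) (w : 'S_n) : sergeev R n :=
  \prod_(a <- reduced_word w) intertwiner R n a.

Definition phi_star (R : realType) (w : 'S_n) : sergeev R n := phi R w^-1%g.

End ReducedWords.

Section Tableaux.
Variable n : nat.

(* (row, column) *)
Definition box := ('I_n * 'I_n)%type.

Definition on_diagonal (b : box) : bool := b.1 == b.2.

(* Sequences of at most n parts, each at most n: these bounds hold for every
   strict partition of a number <= n, and its shifted diagram then lies in the
   n x n grid. *)
Definition parts := {bseq n of 'I_n.+1}.

Definition rows (la : parts) : seq nat := [seq val k | k <- la].

Definition strict (la : seq nat) : bool := sorted gtn la && (0%N \notin la).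

Definition diagram (la : seq nat) : {set box} :=
  [set b : box | (b.1 < size la)%N && (b.1 <= b.2 < b.1 + nth 0%N la b.1)%N].

Definition is_shifted (D : {set box}) : bool :=
  [exists la : parts, strict (rows la) && (D == diagram (rows la))].

Definition addable (D : {set box}) (b : box) : bool :=
  (b \notin D) && is_shifted (b |: D).

Definition strict_part :=
  {la : parts | strict (rows la) && (sumn (rows la) == n)}.

Definition part_rows (la : strict_part) : seq nat := rows (val la).

Section Shape.
Variable la : strict_part.

Definition cell := {b : box | b \in diagram (part_rows la)}.

Definition filling := {ffun cell -> 'I_n}.

Definition is_standard (T : filling) : bool :=
  [&& injectiveb T,
      [forall k, exists b, T b == k],
      [forall b : cell, forall b' : cell,
        ((val b).1 == (val b').1) && ((val b).2 < (val b').2)%N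
          ==> (T b < T b')%N]
    & [forall b : cell, forall b' : cell,
        ((val b).2 == (val b').2) && ((val b).1 < (val b').1)%N
          ==> (T b < T b')%N]].

Definition stableau := {T : filling | is_standard T}.

Definition bars :=
  {beta : {set box} |
    beta \subset [set b in diagram (part_rows la) | ~~ on_diagonal b]}.

Lemma row_entry_lt (b : cell) :
  (\sum_(k < (val b).1) nth 0 (part_rows la) k + ((val b).2 - (val b).1) < n)%N.
Proof.
case: b => -[i j] /=; rewrite inE /= => /and3P[ilt ij jlt].
case/andP: (valP la) => _ /eqP sum_la.
rewrite -[ltnRHS]sum_la sumnE (big_nth 0%N) big_mkord.
rewrite -/(part_rows la) -(big_mkord xpredT (nth 0%N (part_rows la))).
rewrite -(big_mkord xpredT (nth 0%N (part_rows la))).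
rewrite [ltnRHS](big_cat_nat _ (n := i)) //=; last exact: ltnW.
rewrite ltn_add2l big_ltn // ltn_subLR //.
exact: leq_trans jlt (leq_add _ (leq_addr _ _)).
Qed.

Definition row_tableau : filling := [ffun b => Ordinal (row_entry_lt b)].

(* d(T), the unique permutation w with T = w o row_tableau. *)
Definition dperm (T : stableau) : 'S_n :=
  odflt 1%g [pick w : 'S_n | [forall b, val T b == w (row_tableau b)]].

Variable R : realType.
Local Notation C := (R[i]).

(* An entry of a barred tableau is recorded as (box, barred?). *)
Definition content (e : box * bool) : C :=
  let sigma := (e.1.2 - e.1.1)%N in (-1) ^+ e.2 * csqrt R (sigma * sigma.+1).

Definition possible_entry (D : {set box}) (e : box * bool) : bool :=
  addable D e.1 && (e.2 ==> ~~ on_diagonal e.1).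

Section Idempotent.
Variables (T : filling) (beta : {set box}).

Definition shape_below (m : nat) : {set box} :=
  [set val b | b : cell & (T b < m)%N].

Definition efactor (m : nat) (b : cell) : sergeev R n :=
  let e := (val b, val b \in beta) in
  (\prod_(e' | possible_entry (shape_below m) e' && (e' != e))
      (content e - content e'))^-1
  *: \prod_(e' | possible_entry (shape_below m) e' && (e' != e))
      (jm R n m - content e' *: (1 : sergeev R n)).

(* e_V for V the part of (T, beta) formed by the entries < m, inside the
   algebra of rank n. *)
Fixpoint eupto (m : nat) : sergeev R n :=
  match m with
  | 0 | 1 => 1
  | m'.+1 =>
      if [pick b : cell | T b == m' :> nat] is Some b
      then eupto m' * efactor m' b else eupto m'
  end.

Definition eelt : sergeev R n := eupto n.

End Idempotent.

Definition zeta (T U : stableau) (beta : bars) : sergeev R n :=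
  phi R (dperm T) * eelt row_tableau (val beta) * phi_star R (dperm U).

End Shape.

Definition zeta_index :=
  {la : strict_part & (stableau la * stableau la * bars la)%type}.

Definition zeta_family (R : realType) (k : zeta_index) : sergeev R n :=
  let: existT la (T, U, beta) := k in zeta R T U beta.

End Tableaux.

(* Main.v *)
(* For each shifted diagram la and each set beta of bars there is a seminormal
   module, free over the Clifford algebra on vectors v_T, T standard of shape
   la, on which the Jucys-Murphy element x_a acts on v_T by the signed content
   of the entry a, and phi_a maps v_T to a multiple of v_(s_a T), nonzero when
   s_a T is standard.  Hence e_(R^(la, beta)) fixes v_R in its own module and
   kills all other basis vectors of all these modules, so zeta^beta_(T U) maps
   v_U to a nonzero multiple of v_T in the module of (la, beta) and kills all
   other basis vectors: the zetas are linearly independent over the Clifford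
   algebra Cl_n.  On the other hand the Sergeev superalgebra is spanned over
   Cl_n by n! spin words, and there are at least n! zetas since the sum of
   2^(n - l(la)) g_la^2 over the strict partitions la of n is n!, by the
   commutation relation between adding and removing a box.  As Cl_n is
   finite-dimensional, an injective endomorphism of a free module of finite
   rank over it is surjective, so the zetas are also spanning. *)

(* A presented algebra may be smaller than expected: words give only upper bounds, and lower bounds
   come from the modules. Their coordinates lie in the presented Cl_n itself, so a relation between
   zetas, applied to one v_U, returns its coefficients. These stand on the left, hence only the
   action on the vectors v_T has to be known.

   The modules are forced. With x, y the contents of a, a + 1, phi_a v_T being a multiple of v_(s_a
   T) gives the coefficient of v_T in s_a v_T, and t_a^2 = 1 gives the product of the two
   coefficients exchanging v_T and v_(s_a T), chosen equal here. For x^2 = s(s+1), y^2 = k(k+1) this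
   product is (1 - 1/(k-s)^2)(1 - 1/(k+s+1)^2). It vanishes exactly on neighbouring diagonals, that
   is, when s_a T is not standard, so vectors of nonstandard fillings can be put to 0.

   The delicate relation is the braid relation: its coefficients have x^2 - z^2 in a denominator, z
   being the content of a + 2, and this is 0 when a and a + 2 share a diagonal. Then x = z = 0, y^2
   = 2, and the relation holds for another reason ([tdiag0]). *)
From HB Require Import structures.
Require Import Defs.
From mathcomp Require Import all_boot all_order all_algebra all_fingroup.
From mathcomp Require Import boolp classical_sets reals complex.
From mathcomp Require Import zify ring.

Set Implicit Arguments.
Unset Strict Implicit.
Unset Printing Implicit Defensive.

(** * Shifted diagrams as order ideals *)

Section Ideals.
Variable n : nat.
Implicit Types (b : box n) (D : {set box n}).

Definition box_le b b' : bool := (b.1 <= b'.1) && (b.2 <= b'.2).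

(** Shifted diagrams are the finite order ideals of the half-plane i <= j. In this form unions,
    intersections and changes by one box need no list of parts; [is_shiftedE] is the bridge. *)
Definition ideal D : bool :=
  [forall (b | b \in D), (b.1 <= b.2) &&
    [forall b' : box n, (b'.1 <= b'.2) && box_le b' b ==> (b' \in D)]].

Lemma idealP D : reflect (forall b, b \in D -> b.1 <= b.2 /\
    forall b', b'.1 <= b'.2 -> box_le b' b -> b' \in D) (ideal D).
Proof.
apply: (iffP forallP) => [idD b bD|idD b]; last first.
  apply/implyP => /idD[-> bP]; apply/forallP => b'.
  by apply/implyP => /andP[]; exact: bP.
have /implyP/(_ bD)/andP[-> /forallP bP] := idD b.
by split=> // b' b'_le b'b; apply: (implyP (bP b')); rewrite b'_le.
Qed.

Lemma ideal_diag D b : ideal D -> b \in D -> b.1 <= b.2.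
Proof. by move/idealP => idD /idD[]. Qed.

Lemma ideal_closed D b b' : ideal D -> b \in D -> b'.1 <= b'.2 ->
  b'.1 <= b.1 -> b'.2 <= b.2 -> b' \in D.
Proof.
move=> /idealP idD /idD[_ bP] b'_le le1 le2; apply: bP => //.
by rewrite /box_le le1.
Qed.

Lemma idealU D D' : ideal D -> ideal D' -> ideal (D :|: D').
Proof.
move=> /idealP idD /idealP idD'; apply/idealP => b; rewrite inE.
by case/orP=> [/idD|/idD'] [-> bP]; split=> // b' b'_le b'b;
  rewrite inE bP ?orbT.
Qed.

Lemma idealI D D' : ideal D -> ideal D' -> ideal (D :&: D').
Proof.
move=> /idealP idD /idealP idD'; apply/idealP => b; rewrite inE.
case/andP=> /idD[-> bP] /idD'[_ bP']; split=> // b' b'_le b'b.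
by rewrite inE bP ?bP'.
Qed.

Lemma ideal0 : ideal (finset.set0 : {set box n}).
Proof. by apply/idealP => b; rewrite inE. Qed.

Lemma in_diagram (la : seq nat) b : (b \in diagram n la) =
  (b.1 < size la) && (b.1 <= b.2 < b.1 + nth 0 la b.1).
Proof. by rewrite inE. Qed.

(** Strict parts drop by at least one per row, so the right ends i + la_i of the shifted rows weakly
    decrease. *)
Lemma strict_nth (la : seq nat) i j : strict la -> i <= j -> j < size la ->
  nth 0 la j + (j - i) <= nth 0 la i.
Proof.
case/andP=> la_sorted _ ij jlt.
suff nthD k : i + k < size la -> nth 0 la (i + k) + k <= nth 0 la i.
  by have := nthD (j - i); rewrite subnKC //; exact.
elim: k => [|k IHk] klt; first by rewrite !addn0.
have : nth 0 la (i + k) > nth 0 la (i + k.+1).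
  have gtn_trans : transitive gtn by move=> ? ? ? /[swap]; exact: ltn_trans.
  apply: (sorted_ltn_nth gtn_trans 0 la_sorted); rewrite ?inE; lia.
by have := IHk ltac:(lia); lia.
Qed.

Lemma strict_gt0 (la : seq nat) i : strict la -> i < size la -> 0 < nth 0 la i.
Proof.
case/andP=> _ la0 ilt; rewrite lt0n; apply: contraNneq la0 => <-.
exact: mem_nth.
Qed.

Lemma ideal_diagram (la : seq nat) : strict la -> ideal (diagram n la).
Proof.
move=> la_strict; apply/idealP => b; rewrite in_diagram.
case/and3P=> b1lt b12 b2lt; split=> // b' b'_le /andP[le1 le2].
rewrite in_diagram b'_le (leq_ltn_trans le1) //=.
by have := strict_nth la_strict le1 b1lt; lia.
Qed.

Definition row_len D i := #|[set b in D | b.1 == i :> nat]|.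

Lemma card_ord_interval i m : m <= n -> #|[set k : 'I_n | i <= k < m]| = m - i.
Proof.
move=> mn; rewrite -sum1dep_card -[RHS]muln1 -sum_nat_const_nat.
rewrite (big_nat_widen _ _ n) // (big_nat_widenl _ 0) // big_mkord.
by apply: eq_bigl => k; rewrite andbC.
Qed.

Lemma card_row i (s : {set 'I_n}) : #|[set b : box n | (b.1 == i) && (b.2 \in s)]| = #|s|.
Proof.
have <- : [set (i, j) | j in s] = [set b : box n | (b.1 == i) && (b.2 \in s)].
  apply/setP => -[i' j]; rewrite inE /=; apply/imsetP/andP => [[j' js [-> ->]]|].
    by rewrite eqxx.
  by case=> /eqP-> js; exists j.
by rewrite card_imset // => j j' [].
Qed.

(** With a box an ideal contains all boxes to its left down to the diagonal, so a row is an interval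
    determined by its cardinality. *)
Lemma ideal_row D b : ideal D -> b.1 <= b.2 ->
  (b \in D) = (b.2 < b.1 + row_len D b.1).
Proof.
move=> idD b12.
have rowE m : [set b' : box n | (b'.1 == b.1) && (b'.2 \in [set k : 'I_n | b.1 <= k < m])]
   = [set b' : box n | (b'.1 == b.1) && (b.1 <= b'.2 < m)].
  by apply/setP => b'; rewrite !inE.
apply/idP/idP => [bD|]; last apply: contraTT => bD; rewrite -?leqNgt.
  have := card_row b.1 [set k : 'I_n | b.1 <= k < b.2.+1].
  rewrite card_ord_interval // => row_card.
  suff : b.2.+1 - b.1 <= row_len D b.1 by lia.
  rewrite -row_card; apply: subset_leq_card; apply/fintype.subsetP => b'.
  rewrite !inE ltnS => /and3P[/eqP b'1 le1 le2]; rewrite b'1 eqxx andbT.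
  by apply: ideal_closed idD bD _ _ _; rewrite ?b'1.
have := card_row b.1 [set k : 'I_n | b.1 <= k < b.2].
rewrite card_ord_interval ?(ltnW (ltn_ord _)) // => row_card.
suff : row_len D b.1 <= b.2 - b.1 by lia.
rewrite -row_card; apply: subset_leq_card; apply/fintype.subsetP => b'.
rewrite !inE => /andP[b'D /eqP/val_inj b'1]; have b'12 := ideal_diag idD b'D.
rewrite b'1 eqxx -b'1 b'12 ltnNge /=.
apply: contra bD => le2; apply: ideal_closed idD b'D _ _ _ => //.
by rewrite b'1.
Qed.

Lemma row_len_le D i : ideal D -> row_len D i <= n - i.
Proof.
move=> idD; rewrite /row_len; have [ilt|ige] := ltnP i n; last first.
  rewrite leqNgt; apply/negP => /(leq_ltn_trans (leq0n _))/card_gt0P[b].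
  by rewrite inE => /andP[_ /eqP bi]; have := ltn_ord b.1; lia.
rewrite -(card_ord_interval i (leqnn n)) -(card_row (Ordinal ilt)).
apply: subset_leq_card; apply/fintype.subsetP => b; rewrite !inE.
case/andP=> bD /eqP bi; have -> : b.1 = Ordinal ilt by exact: val_inj.
by rewrite eqxx ltn_ord -bi (ideal_diag idD bD).
Qed.

Lemma sum_row_len D : \sum_(i < n) row_len D i = #|D|.
Proof.
rewrite -sum1_card (partition_big (fun b : box n => b.1) xpredT) //=.
apply: eq_bigr => i _; rewrite sum1dep_card; apply: eq_card => b.
by rewrite !inE.
Qed.

(** The last box of row i + 1 lies in column i + r_(i+1). The box above it is in the ideal and has
    offset r_(i+1) from the diagonal, so row i is longer. *)
Lemma row_len_step D i : ideal D -> 0 < row_len D i.+1 ->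
  row_len D i.+1 < row_len D i.
Proof.
move=> idD r_gt0; have r_le := row_len_le i.+1 idD.
have ilt : i.+1 < n by lia.
have jlt : i + row_len D i.+1 < n by lia.
have bD : (Ordinal ilt, Ordinal jlt) \in D by rewrite ideal_row //=; lia.
have : (Ordinal (ltnW ilt), Ordinal jlt) \in D.
  by apply: ideal_closed idD bD _ _ _ => /=; lia.
by rewrite ideal_row //= ?ltn_add2l; lia.
Qed.

(** The parts are the row lengths before the first empty row [l]; by [row_len_step] a nonempty row
    after it would make row [l] nonempty. *)
Lemma ideal_shape D : ideal D -> exists la : parts n,
  [/\ strict (rows la), diagram n (rows la) = D & sumn (rows la) = #|D|].
Proof.
move=> idD.
have ex0 : exists l, row_len D l == 0.
  by exists n; rewrite -leqn0; have := row_len_le n idD; rewrite subnn.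
have [l /eqP rl0 lmin] := ex_minnP ex0.
have r_gt0 i : i < l -> 0 < row_len D i.
  by rewrite lt0n; apply: contraTneq => ri0; rewrite -leqNgt lmin ?ri0.
have r0 i : l <= i -> row_len D i = 0.
  move=> li; rewrite -(subnKC li); elim: (i - l) => [|k IHk]; first by rewrite addn0.
  apply/eqP; rewrite addnS -leqn0 leqNgt; apply/negP => r_gt.
  by have := row_len_step idD r_gt; rewrite IHk.
have ln : l <= n by apply: lmin; rewrite -leqn0; have := row_len_le n idD; rewrite subnn.
pose s := mkseq (row_len D) l.
have szs : size [seq inord k : 'I_n.+1 | k <- s] <= n by rewrite size_map size_mkseq.
have rowsE : rows (Bseq szs) = s.
  rewrite /rows /= -map_comp -[RHS]map_id; apply/eq_in_map => k /=.
  case/mapP=> i _ ->; rewrite inordK // ltnS.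
  by apply: leq_trans (row_len_le i idD) (leq_subr _ _).
exists (Bseq szs); rewrite rowsE; split.
- apply/andP; split.
    apply/(sortedP 0) => i; rewrite size_mkseq => ilt.
    by rewrite !nth_mkseq ?(ltnW ilt) //=; apply/row_len_step/r_gt0.
  by apply/mapP => -[k]; rewrite mem_iota /= => /r_gt0 rk rk0; rewrite -rk0 in rk.
- apply/setP => b; rewrite in_diagram size_mkseq.
  have [blt|bge] := ltnP b.1 l.
    have [b12|b12] /= := leqP b.1 b.2; first by rewrite (ideal_row idD b12) nth_mkseq.
    by apply/esym/negbTE; apply: contraTN b12 => /(ideal_diag idD); rewrite leqNgt.
  apply/esym/negbTE/negP => bD; have := bD.
  by rewrite (ideal_row idD (ideal_diag idD bD)) r0 //; have := ideal_diag idD bD; lia.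
- rewrite -sum_row_len sumnE big_map -/(index_iota 0 l).
  rewrite -(big_mkord xpredT (row_len D)) (big_cat_nat (n := l)) //=.
  rewrite [X in _ = _ + X]big1_seq ?addn0 /index_iota ?subn0 // => i /andP[_].
  by rewrite mem_iota => /andP[/r0].
Qed.

Lemma is_shiftedE D : is_shifted D = ideal D.
Proof.
apply/existsP/idP => [[la /andP[la_strict /eqP->]]|/ideal_shape[la [? <- _]]].
  exact: ideal_diagram.
by exists la; apply/andP.
Qed.

Lemma strict_nth_bound (la : seq nat) i : strict la -> i < size la ->
  i + nth 0 la i <= sumn la.
Proof.
move=> la_strict ilt; have := strict_nth la_strict (leq0n i) ilt.
suff : nth 0 la 0 <= sumn la by lia.
by case: la {la_strict ilt} => //= k la; exact: leq_addr.
Qed.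

(** The bound on the sum guarantees that the n x n grid cuts off no row, so the parts can be read
    back from the diagram. *)
Lemma row_len_diagram (la : seq nat) i : strict la -> sumn la <= n ->
  row_len (diagram n la) i = nth 0 la i.
Proof.
move=> la_strict la_sum.
have [ilt|ige] := ltnP i (size la); last first.
  rewrite nth_default //; apply/eqP; rewrite -leqn0 leqNgt; apply/negP.
  by case/card_gt0P=> b; rewrite !inE => /andP[/andP[blt _] /eqP bi]; rewrite bi ltnNge ige in blt.
have := strict_nth_bound la_strict ilt; have := strict_gt0 la_strict ilt => r_gt0 bnd.
have iltn : i < n by lia.
have -> : nth 0 la i = (i + nth 0 la i) - i by lia.
rewrite -(card_ord_interval i (leq_trans bnd la_sum)) -(card_row (Ordinal iltn)).
apply: eq_card => b; rewrite !inE; apply/andP/andP => -[].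
  case/and3P=> _ b12 b2 /eqP bi; have -> : b.1 = Ordinal iltn by exact: val_inj.
  by rewrite eqxx -bi b12.
by move=> /eqP-> /= /andP[-> ->]; rewrite ilt.
Qed.

Lemma diagram_inj (la mu : strict_part n) :
  diagram n (part_rows la) = diagram n (part_rows mu) -> la = mu.
Proof.
move=> eqD; apply/val_inj/val_inj/(inj_map val_inj).
case/andP: (valP la) => la_strict /eqP la_sum.
case/andP: (valP mu) => mu_strict /eqP mu_sum.
have nthE i : nth 0 (part_rows la) i = nth 0 (part_rows mu) i.
  by rewrite -!(row_len_diagram i) ?eqD // ?la_sum ?mu_sum.
have size_le (l m : seq nat) : strict l -> (forall i, nth 0 l i = nth 0 m i) -> size l <= size m.
  move=> l_strict lm; rewrite leqNgt; apply/negP => lt.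
  by have := strict_gt0 l_strict lt; rewrite lm nth_default.
have size_eq : size (part_rows la) = size (part_rows mu).
  by apply/eqP; rewrite eqn_leq !size_le.
have E := eq_from_nth size_eq (fun i _ => nthE i).
exact E.
Qed.

End Ideals.

(** * Standard tableaux *)

Lemma tpermE_adj (n : nat) (a : 'I_n.-1) (k : 'I_n) :
  tperm (adj_lo a) (adj_hi a) k =
    (if k == a :> nat then a.+1 else if k == a.+1 :> nat then (a : nat) else k) :> nat.
Proof.
case: tpermP => [->|->|/eqP + /eqP] /=; rewrite -?val_eqE /= ?eqxx //.
  by case: eqVneq => // /eqP; rewrite eqn_leq ltnn.
by move=> /negbTE-> /negbTE->.
Qed.

Section Standard.
Variables (n : nat) (la : strict_part n).
Local Notation D := (diagram n (part_rows la)).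
Local Notation cell := (cell la).
Implicit Types (T F : filling la) (b : cell) (a : 'I_n.-1).

Definition cell_row b : nat := (val b).1.
Definition cell_col b : nat := (val b).2.

Lemma cell_eq b b' : cell_row b = cell_row b' -> cell_col b = cell_col b' -> b = b'.
Proof.
move=> rowE colE; apply: val_inj; move: rowE colE; rewrite /cell_row /cell_col.
by case: (val b) (val b') => [i j] [i' j'] /= /val_inj-> /val_inj->.
Qed.

Lemma ideal_part : ideal D.
Proof. by apply: ideal_diagram; case/andP: (valP la). Qed.

Lemma row_le_col b : cell_row b <= cell_col b.
Proof. exact: ideal_diag ideal_part (valP b). Qed.

Lemma cell_below b i j : i <= j -> i <= cell_row b -> j <= cell_col b ->
  exists b', cell_row b' = i /\ cell_col b' = j.
Proof.
move=> ij ib jb.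
have ilt : i < n by apply: leq_ltn_trans ib (ltn_ord _).
have jlt : j < n by apply: leq_ltn_trans jb (ltn_ord _).
have mD : (Ordinal ilt, Ordinal jlt) \in D.
  exact: ideal_closed ideal_part (valP b) _ _ _.
by exists (exist (fun x : box n => x \in D) _ mD).
Qed.

Definition cell_le b b' := (cell_row b <= cell_row b') && (cell_col b <= cell_col b').

Lemma std_inj T : is_standard T -> injective T.
Proof. by case/and4P=> /injectiveP. Qed.

Lemma std_surj T : is_standard T -> forall k, exists b, T b = k.
Proof.
by case/and4P=> _ /forallP Ts _ _ k; have /existsP[b /eqP] := Ts k; exists b.
Qed.

(** Standardness compares entries within a row or a column. The step from [b] to [b'] goes through
    the cell [m] in the row of [b] and the column of [b'], which is not below the diagonal because
    [b] is not. *)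
Lemma std_lt T b b' : is_standard T -> cell_le b b' -> b != b' -> T b < T b'.
Proof.
case/and4P=> _ _ /forallP rowT /forallP colT /andP[le1 le2] bb'.
have rowP b1 b2 : cell_row b1 = cell_row b2 -> cell_col b1 < cell_col b2 -> T b1 < T b2.
  move=> /val_inj e lt.
  by move/forallP/(_ b2)/implyP: (rowT b1); apply; rewrite e eqxx.
have colP b1 b2 : cell_col b1 = cell_col b2 -> cell_row b1 < cell_row b2 -> T b1 < T b2.
  move=> /val_inj e lt.
  by move/forallP/(_ b2)/implyP: (colT b1); apply; rewrite e eqxx.
have [m [m1 m2]] : exists m, cell_row m = cell_row b /\ cell_col m = cell_col b'.
  by apply: (@cell_below b'); rewrite ?le1 // (leq_trans (row_le_col b)).
have row_le : T b <= T m.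
  have [lt|ge] := ltnP (cell_col b) (cell_col b'); first by apply/ltnW/rowP; rewrite ?m2.
  by rewrite (_ : b = m) //; apply: cell_eq; lia.
have [lt|ge] := ltnP (cell_row b) (cell_row b').
  by apply: leq_ltn_trans row_le _; apply: colP; rewrite ?m1.
apply: rowP; first by lia.
by rewrite ltn_neqAle le2 andbT; apply: contraNneq bb' => e2; apply/eqP/cell_eq; lia.
Qed.

Lemma std_of_lt F : injective F -> (forall k, exists b, F b = k) ->
  (forall b b', cell_le b b' -> b != b' -> F b < F b') -> is_standard F.
Proof.
move=> F_inj F_surj F_lt; apply/and4P; split.
- exact/injectiveP.
- by apply/forallP => k; apply/existsP; have [b <-] := F_surj k; exists b.
- apply/forallP => b; apply/forallP => b'; apply/implyP => /andP[/eqP e lt].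
  apply: F_lt; first by rewrite /cell_le /cell_row e leqnn ltnW.
  by apply: contraTneq lt => ->; rewrite ltnn.
- apply/forallP => b; apply/forallP => b'; apply/implyP => /andP[/eqP e lt].
  apply: F_lt; first by rewrite /cell_le /cell_col e leqnn ltnW.
  by apply: contraTneq lt => ->; rewrite ltnn.
Qed.

(** Defined on all fillings, since s_a T may fail to be standard: swapping thus stays an involution
    satisfying the braid relations. *)
Definition tab_swap a F : filling la := [ffun b => tperm (adj_lo a) (adj_hi a) (F b)].

Lemma tab_swapK a : involutive (tab_swap a).
Proof. by move=> F; apply/ffunP => b; rewrite !ffunE tpermK. Qed.

Lemma tab_swapE a F b : tab_swap a F b =
  (if F b == a :> nat then a.+1 else if F b == a.+1 :> nat then (a : nat) else F b) :> nat.
Proof. by rewrite ffunE tpermE_adj. Qed.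

Lemma tab_swap_comm a a' F : (a.+1 < a') || (a'.+1 < a) ->
  tab_swap a (tab_swap a' F) = tab_swap a' (tab_swap a F).
Proof. by move=> aa'; apply/ffunP => b; apply: val_inj; rewrite /= !tab_swapE; repeat case: ifP; lia. Qed.

Lemma tab_swap_braid a a' F : a' = a.+1 :> nat ->
  tab_swap a (tab_swap a' (tab_swap a F)) = tab_swap a' (tab_swap a (tab_swap a' F)).
Proof. by move=> aa'; apply/ffunP => b; apply: val_inj; rewrite /= !tab_swapE; repeat case: ifP; lia. Qed.

Definition diagidx b : nat := cell_col b - cell_row b.

(** Of two incomparable boxes one lies strictly above and strictly to the right of the other, so
    their diagonals differ by at least 2. *)
Lemma diag_comparable b b' : diagidx b <= (diagidx b').+1 ->
  diagidx b' <= (diagidx b).+1 -> cell_le b b' || cell_le b' b.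
Proof.
have d := row_le_col b; have d' := row_le_col b'.
by rewrite /diagidx /cell_le; lia.
Qed.

Section Consecutive.
Variables (T : filling la) (b b' : cell).
Hypotheses (Tstd : is_standard T) (Tbb' : T b' = (T b).+1 :> nat).

Lemma consecutive_neq : b != b'.
Proof. by apply/eqP => e; have := Tbb'; rewrite e; lia. Qed.

Lemma consecutive_nle : ~~ cell_le b' b.
Proof.
apply/negP => le; have := std_lt Tstd le; rewrite eq_sym consecutive_neq.
by move/(_ isT); lia.
Qed.

(** No cell lies strictly between cells with consecutive entries ([nxt]). One step right or down
    from [b] towards [b'] stays in the diagram, hence reaches [b']. *)
Lemma consecutive_diag : cell_le b b' ->
  diagidx b' = (diagidx b).+1 \/ diagidx b = (diagidx b').+1.
Proof.
move=> le; have /andP[le1 le2] := le.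
have nxt m : cell_le b m -> m != b -> cell_le m b' -> m = b'.
  move=> le_m neq_m le_m'; apply/eqP; apply: contraT => neq_m'.
  have lt1 : T b < T m by apply: std_lt; rewrite // eq_sym.
  by have lt2 : T m < T b' by [exact: std_lt]; lia.
have d := row_le_col b; have d' := row_le_col b'.
have [lt2|ge2] := ltnP (cell_col b) (cell_col b').
  have [m [m1 m2]] := @cell_below b' (cell_row b) (cell_col b).+1 ltac:(lia) le1 lt2.
  have mb' : m = b'.
    apply: nxt; rewrite /cell_le ?m1 ?m2; try lia.
    by apply/eqP => e; rewrite e in m2; lia.
  by left; rewrite /diagidx -mb' m1 m2; lia.
have lt1 : cell_row b < cell_row b'.
  rewrite ltn_neqAle le1 andbT; apply: contraNneq consecutive_neq => e1.
  by apply/eqP/cell_eq; lia.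
have [m [m1 m2]] := @cell_below b' (cell_row b).+1 (cell_col b) ltac:(lia) lt1 le2.
have mb' : m = b'.
  apply: nxt; rewrite /cell_le ?m1 ?m2; try lia.
  by apply/eqP => e; rewrite e in m1; lia.
by right; rewrite /diagidx -mb' m1 m2; lia.
Qed.

Lemma consecutive_diag_neq : diagidx b != diagidx b'.
Proof.
apply/eqP => e; have := @diag_comparable b b'; rewrite e leqnSn => /(_ isT isT).
by rewrite (negbTE consecutive_nle) orbF => /consecutive_diag; lia.
Qed.

Lemma consecutive_nle_diag : ~~ cell_le b b' ->
  (diagidx b).+1 < diagidx b' \/ (diagidx b').+1 < diagidx b.
Proof.
move=> nle; have := @diag_comparable b b'.
by rewrite (negbTE nle) (negbTE consecutive_nle); lia.
Qed.

Lemma tab_swap_std a : T b = a :> nat -> is_standard (tab_swap a T) = ~~ cell_le b b'.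
Proof.
move=> Tb; apply/idP/idP => [swstd|nle].
  apply/negP => le; have := std_lt swstd le consecutive_neq.
  by rewrite !tab_swapE; repeat case: ifP; lia.
apply: std_of_lt => [d d'|k|d d' le neq].
- by rewrite !ffunE => /perm_inj/(std_inj Tstd).
- have [d dE] := std_surj Tstd (tperm (adj_lo a) (adj_hi a) k).
  by exists d; rewrite ffunE dE tpermK.
have lt := std_lt Tstd le neq.
(* Swapping a and a + 1 can reverse only the comparison of these two entries, and [nle] excludes
   that it is required. *)
have ne : ~ (T d = a :> nat /\ T d' = a.+1 :> nat).
  case=> Td Td'; have e : d = b by apply/(std_inj Tstd)/val_inj; rewrite /= Td.
  have e' : d' = b' by apply/(std_inj Tstd)/val_inj; rewrite /= Td' Tbb' Tb.
  by rewrite e e' (negbTE nle) in le.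
by rewrite !tab_swapE; repeat case: ifP; lia.
Qed.

End Consecutive.

(** The cell [b3] lies strictly below and to the right of [b1], and only [b2] can lie between them.
    The right neighbour of [b1] does; off the main diagonal the lower neighbour of [b1] would be a
    second such cell. *)
Lemma three_on_diag T b1 b2 b3 : is_standard T ->
  T b2 = (T b1).+1 :> nat -> T b3 = (T b2).+1 :> nat ->
  diagidx b1 = diagidx b3 -> diagidx b1 = 0 /\ diagidx b2 = 1.
Proof.
move=> Tstd T12 T23 e13.
have d1 := row_le_col b1; have d3 := row_le_col b3.
have neq13 : b1 != b3 by apply/eqP => e; rewrite -e in T23; lia.
have le13 : cell_le b1 b3.
  have := @diag_comparable b1 b3; rewrite e13 leqnSn => /(_ isT isT) /orP[//|le].
  by have := std_lt Tstd le; rewrite eq_sym => /(_ neq13); lia.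
have /andP[le1 le2] := le13.
have lt1 : cell_row b1 < cell_row b3.
  rewrite ltn_neqAle le1 andbT; apply: contraNneq neq13 => e1.
  by apply/eqP/cell_eq => //; move: e13; rewrite /diagidx; lia.
have lt2 : cell_col b1 < cell_col b3 by move: e13; rewrite /diagidx; lia.
have mid b : cell_le b1 b -> b != b1 -> cell_le b b3 -> b != b3 -> b = b2.
  move=> le neq le' neq'.
  have ltm : T b1 < T b by apply: std_lt; rewrite // eq_sym.
  have ltm' : T b < T b3 by exact: std_lt.
  by apply/(std_inj Tstd)/ord_inj; lia.
have [m [m1 m2]] := @cell_below b3 (cell_row b1) (cell_col b1).+1 ltac:(lia) le1 lt2.
have mb2 : m = b2.
  apply: mid; rewrite /cell_le ?m1 ?m2; try lia.
    by apply/eqP => e; rewrite e in m2; lia.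
  by apply/eqP => e; rewrite e in m1; lia.
have diag1 : cell_row b1 = cell_col b1.
  apply/eqP; rewrite eqn_leq d1 leqNgt; apply/negP => lt.
  have [m' [m1' m2']] := @cell_below b3 (cell_row b1).+1 (cell_col b1) lt lt1 le2.
  have m'b2 : m' = b2.
    apply: mid; rewrite /cell_le ?m1' ?m2'; try lia.
      by apply/eqP => e; rewrite e in m1'; lia.
    by apply/eqP => e; rewrite e in m2'; lia.
  by move: m1'; rewrite m'b2 -mb2 m1; lia.
by rewrite /diagidx -mb2 m1 m2 diag1; lia.
Qed.

End Standard.

(** * Counting *)

Lemma box_eq (n : nat) (b b' : box n) :
  b.1 = b'.1 :> nat -> b.2 = b'.2 :> nat -> b = b'.
Proof. by case: b b' => [i j] [k l] /= /ord_inj-> /ord_inj->. Qed.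

Section Count.
Variable n : nat.
Implicit Types (b : box n) (D : {set box n}).

Definition can_rem D b := (b \in D) && ideal (D :\ b).
Definition can_add D b := (b \notin D) && ideal (b |: D).
(** The number of ways to bar or not to bar the entry of the box. *)
Definition weight b := if on_diagonal b then 1 else 2.

Section AddRem.
Variable D : {set box n}.
Hypothesis idD : ideal D.
Local Notation r := (row_len D).

(** The new box continues its row, and the box above it must be present: it has offset r_i + 1 from
    the diagonal in row i - 1, whence a gap of at least two between the lengths. *)
Lemma addP b : b.1 <= b.2 -> can_add D b =
  (b.2 == b.1 + r b.1 :> nat) && ((b.1 == 0 :> nat) || ((r b.1).+1 < r b.1.-1)).
Proof.
move=> d; rewrite /can_add (ideal_row idD d).
have i_lt := ltn_ord b.1; have j_lt := ltn_ord b.2.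
apply/andP/andP => -[].
  rewrite -leqNgt => ge idbD.
  have below b' : b'.1 <= b'.2 -> b'.1 <= b.1 -> b'.2 <= b.2 -> b' != b -> b' \in D.
    move=> d' le1 le2 neq; have := ideal_closed idbD (setU11 _ _) d' le1 le2.
    by rewrite in_setU1 (negbTE neq).
  have e2 : b.2 = b.1 + r b.1 :> nat.
    apply/eqP; rewrite eqn_leq ge andbT leqNgt; apply/negP => gt.
    have jlt : b.2.-1 < n by lia.
    have : (b.1, Ordinal jlt) \in D.
      apply: below => //=; try lia.
      by apply/eqP => /(congr1 (fun b => val b.2)) /=; lia.
    by rewrite ideal_row //=; lia.
  split; first exact/eqP.
  have [//|i_gt0 /=] := posnP b.1.
  have ilt : b.1.-1 < n by lia.
  have : (Ordinal ilt, b.2) \in D.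
    apply: below => //=; try lia.
    by apply/eqP => /(congr1 (fun b => val b.1)) /=; lia.
  by rewrite ideal_row //=; lia.
move=> /eqP e2 up; split; first by lia.
apply/idealP => x; rewrite in_setU1 => /orP[/eqP->|xD]; last first.
  split=> [|y dy /andP[le1 le2]]; first exact: ideal_diag idD xD.
  by rewrite in_setU1 (ideal_closed idD xD) ?orbT.
split=> // y dy /andP[le1 le2]; rewrite in_setU1.
have [e1|lt1] := eqVneq (y.1 : nat) b.1.
  have [e|ne] := eqVneq (y.2 : nat) b.2; first by rewrite (box_eq e1 e) eqxx.
  by rewrite ideal_row // (ord_inj e1); lia.
have ilt : b.1.-1 < n by lia.
have bD : (Ordinal ilt, b.2) \in D by rewrite ideal_row //=; lia.
by rewrite (ideal_closed idD bD) ?orbT //=; lia.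
Qed.

(** The box below the last box of row i has offset r_i - 2 in row i + 1 and must be absent. A row of
    length 1 ends on the diagonal, with nothing below; hence the separate case. *)
Lemma remP b : b.1 <= b.2 -> can_rem D b =
  (b.2.+1 == b.1 + r b.1 :> nat) && ((r b.1 == 1) || ((r b.1.+1).+1 < r b.1)).
Proof.
move=> d; rewrite /can_rem (ideal_row idD d).
have i_lt := ltn_ord b.1; have j_lt := ltn_ord b.2.
have r_le := row_len_le b.1 idD.
apply/andP/andP => -[].
  move=> lt idDb.
  have above (x : box n) : x.1 <= x.2 -> b.1 <= x.1 -> b.2 <= x.2 -> x != b -> x \notin D.
    move=> dx le1 le2 neq; apply/negP => xD.
    have xDb : x \in D :\ b by rewrite !inE neq.
    by have := ideal_closed idDb xDb d le1 le2; rewrite !inE eqxx.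
  have e2 : b.2.+1 = b.1 + r b.1 :> nat.
    apply/eqP; rewrite eqn_leq lt leqNgt; apply/negP => gt.
    have jlt : b.2.+1 < n by lia.
    have : (b.1, Ordinal jlt) \notin D.
      apply: above => //=; try lia.
      by apply/eqP => /(congr1 (fun b => val b.2)) /=; lia.
    by rewrite ideal_row //=; lia.
  split; first exact/eqP.
  have [//|r1 /=] := eqVneq (r b.1) 1.
  have ilt : b.1.+1 < n by lia.
  have : (Ordinal ilt, b.2) \notin D.
    apply: above => //=; try lia.
    by apply/eqP => /(congr1 (fun b => val b.1)) /=; lia.
  by rewrite ideal_row //=; lia.
move=> /eqP e2 up; split; first by lia.
apply/idealP => x; rewrite !inE => /andP[xb xD].
have dx := ideal_diag idD xD.
split=> // y dy /andP[le1 le2]; rewrite !inE (ideal_closed idD xD) // andbT.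
apply/eqP => e; rewrite {y}e in dy le1 le2.
have [e1|ne1] := eqVneq (x.1 : nat) b.1.
  have : x.2 != b.2 :> nat by apply: contraNneq xb => e; rewrite (box_eq e1 e).
  have := xD; rewrite ideal_row // (ord_inj e1); lia.
have ilt : b.1.+1 < n by have := ltn_ord x.1; lia.
have : (Ordinal ilt, x.2) \in D by apply: ideal_closed idD xD _ _ _ => //=; lia.
rewrite ideal_row //=; last by lia.
move=> lt; have r_gt0 : 0 < r b.1.+1 by lia.
by have := row_len_step idD r_gt0; lia.
Qed.

Lemma weightE b : b.1 <= b.2 -> weight b = if b.1 == b.2 :> nat then 1 else 2.
Proof. by []. Qed.

(** A row has at most one addable and one removable box. The first is diagonal if the row is empty,
    the second if the row has length 1. The test i + r_i < n makes the new box fit into the grid. *)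
Definition add_row i := if (i + r i < n) && ((i == 0) || ((r i).+1 < r i.-1))
  then (if r i == 0 then 1 else 2) else 0.
Definition rem_row i := if (0 < r i) && ((r i == 1) || ((r i.+1).+1 < r i))
  then (if r i == 1 then 1 else 2) else 0.

Lemma sum_add_row (i : 'I_n) : \sum_(b | can_add D b && (b.1 == i)) weight b = add_row i.
Proof.
have diag b : can_add D b -> b.1 <= b.2.
  by case/andP=> _ idbD; apply: ideal_diag idbD (setU11 _ _).
rewrite /add_row; case: ifP => [/andP[jlt up]|no].
  pose b : box n := (i, Ordinal jlt).
  have d : b.1 <= b.2 by rewrite /= leq_addr.
  rewrite (big_pred1 b) => [|b'].
    rewrite weightE //= -[X in X == _]addn0 eqn_add2l eq_sym.
    by case: (r i).
  apply/andP/eqP => [[adb /eqP bi]|->]; last by rewrite addP //= eqxx up.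
  have := adb; rewrite addP ?diag // => /andP[/eqP e _].
  by apply: box_eq; rewrite ?e bi.
rewrite big_pred0 // => b; apply/negP => /andP[adb /eqP bi].
have := adb; rewrite addP ?diag // bi => /andP[/eqP e up].
by have := ltn_ord b.2; rewrite e => lt; rewrite lt up in no.
Qed.

Lemma sum_rem_row (i : 'I_n) : \sum_(b | can_rem D b && (b.1 == i)) weight b = rem_row i.
Proof.
have diag b : can_rem D b -> b.1 <= b.2 by case/andP=> /(ideal_diag idD).
have r_le := row_len_le i idD; have ilt := ltn_ord i.
rewrite /rem_row; case: ifP => [/andP[r_gt0 up]|no].
  have jlt : i + (r i).-1 < n by lia.
  pose b : box n := (i, Ordinal jlt).
  have d : b.1 <= b.2 by rewrite /= leq_addr.
  rewrite (big_pred1 b) => [|b'].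
    rewrite weightE //=; case: (r i) r_gt0 => // k _ /=.
    by rewrite -[X in X == _]addn0 eqn_add2l eq_sym.
  apply/andP/eqP => [[adb /eqP bi]|->].
    have := adb; rewrite remP ?diag // => /andP[/eqP e _].
    by rewrite bi in e; apply: box_eq; rewrite ?bi //=; lia.
  by rewrite remP //= eqxx up andbT; split=> //; apply/eqP; lia.
rewrite big_pred0 // => b; apply/negP => /andP[adb /eqP bi].
have := adb; rewrite remP ?diag // bi => /andP[/eqP e up].
have d := diag _ adb; rewrite bi in d.
by move: no; rewrite up andbT; lia.
Qed.

(* The weights of the addable boxes exceed those of the removable ones by 1:
   the sums over the rows telescope. *)
Lemma add_rem_weight : 0 < n -> #|D| < n ->
  \sum_(b | can_add D b) weight b = 1 + \sum_(b | can_rem D b) weight b.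
Proof.
move=> n_gt0 Dn.
rewrite (partition_big (fun b : box n => b.1) xpredT) //=.
rewrite [in RHS](partition_big (fun b : box n => b.1) xpredT) //=.
under eq_bigr do rewrite sum_add_row; under [in RHS]eq_bigr do rewrite sum_rem_row.
(* Row i can lose a box just when row i + 1 can gain one, up to boundary cases with rows of length 0
   or 1; in all cases [rem_row i] minus [add_row i.+1] is f i - f (i + 1). *)
pose f i : nat := 0 < r i.
have tel i : i < n -> rem_row i + f i.+1 = add_row i.+1 + f i.
  move=> ilt; have r_le := row_len_le i idD; have r_le' := row_len_le i.+1 idD.
  have step : 0 < r i.+1 -> r i.+1 < r i by exact: row_len_step.
  rewrite /rem_row /add_row /f /=.
  case: (r i) (r i.+1) r_le r_le' step => [|[|k]] [|l] r_le r_le' step //=; rewrite ?andbF //=.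
  - by have := step isT.
  - by have := step isT.
  - by rewrite (_ : _ < n = true) //; lia.
  rewrite !ltnS; have := step isT; rewrite ltnS leq_eqVlt => /orP[/eqP[e]|lt].
    by rewrite e !ltnn !andbF.
  rewrite ltnS in lt; rewrite lt andbT (_ : _ < n = true) //; lia.
have rn : r n = 0 by apply/eqP; rewrite -leqn0; have := row_len_le n idD; rewrite subnn.
(* With fewer than n boxes the first row can be extended within the grid. The weight 1 + f 0 of that
   box provides the surplus 1. *)
have r0 : r 0 < n.
  apply: leq_ltn_trans Dn; apply: subset_leq_card.
  by apply/fintype.subsetP => b; rewrite inE => /andP[].
rewrite -(big_mkord xpredT add_row) -(big_mkord xpredT rem_row).
have : \sum_(0 <= i < n) (rem_row i + f i.+1) = \sum_(0 <= i < n) (add_row i.+1 + f i).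
  by apply: eq_big_nat => i /andP[_ /tel].
rewrite !big_split /=.
have e1 : \sum_(0 <= i < n) f i.+1 + f 0 = \sum_(0 <= i < n) f i.
  have := @big_nat_recl nat 0 addn n 0 f (leq0n n).
  rewrite big_nat_recr //= {2}/f rn /= addn0 => ->; exact: addnC.
have e2 : \sum_(0 <= i < n) add_row i.+1 + add_row 0 = \sum_(0 <= i < n) add_row i.
  have := @big_nat_recl nat 0 addn n 0 add_row (leq0n n).
  rewrite big_nat_recr //= {2}/add_row ltnNge leq_addr /= addn0 => ->; exact: addnC.
have : add_row 0 = 1 + f 0 by rewrite /add_row /f add0n r0 /=; case: (r 0).
lia.
Qed.

End AddRem.
End Count.

(** * Weighted chains of diagrams and the number of zetas *)

Section Chains.
Variable n : nat.
Implicit Types (b : box n) (D : {set box n}).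

(** For an ideal with k boxes this is the number g of standard tableaux: each step removes the box
    of the largest entry. *)
Fixpoint nchains (k : nat) D : nat :=
  if k is k'.+1 then \sum_(b | can_rem D b) nchains k' (D :\ b) else 1.

Definition off_diag D : {set box n} := [set b in D | ~~ on_diagonal b].

Definition wchains k D := 2 ^ #|off_diag D| * nchains k D.

Lemma off_diag_rem D b : b \in D ->
  2 ^ #|off_diag D| = weight b * 2 ^ #|off_diag (D :\ b)|.
Proof.
move=> bD; rewrite /weight; have [diag|ndiag] := boolP (on_diagonal b).
  rewrite mul1n; congr (2 ^ #|pred_of_set _|); apply/setP => x; rewrite !inE.
  by case: eqVneq => // ->; rewrite diag andbF.
rewrite -expnS; congr (2 ^ _); rewrite (cardsD1 b) inE bD ndiag add1n.
by congr _.+1; apply: eq_card => x; rewrite !inE andbA.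
Qed.

Lemma wchainsS k D :
  wchains k.+1 D = \sum_(b | can_rem D b) weight b * wchains k (D :\ b).
Proof.
rewrite /wchains /= big_distrr; apply: eq_bigr => b /andP[bD _] /=.
by rewrite (off_diag_rem bD) mulnA.
Qed.

Lemma can_rem_card D b : can_rem D b -> #|D| = #|D :\ b|.+1.
Proof. by case/andP=> bD _; rewrite (cardsD1 b) bD. Qed.

Lemma set1U_comm D b b' : b' != b -> (b |: D) :\ b' = b |: (D :\ b').
Proof.
move=> neq; apply/setP => x; rewrite !inE; case: (eqVneq x b) => // ->.
by rewrite eq_sym neq.
Qed.

(** Adding [b] and removing another box commute. In each direction the one diagram still to be shown
    an ideal is an intersection or a union of known ideals. *)
Lemma rem_add D b b' : ideal D ->
  [&& can_add D b, can_rem (b |: D) b' & b' != b] =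
  [&& can_rem D b', can_add (D :\ b') b & b' != b].
Proof.
move=> idD; have [->|neq] /= := eqVneq b' b; first by rewrite !andbF.
rewrite !andbT /can_add /can_rem (set1U_comm D neq) !inE (negbTE neq) eq_sym (negbTE neq) /=.
apply/idP/idP.
  case/andP=> /andP[bD idbD] /andP[b'D id']; rewrite b'D bD id' /= andbT.
  have -> : D :\ b' = D :&: (b |: (D :\ b')).
    apply/setP => x; rewrite !inE; case xD: (x \in D); rewrite ?andbF //= andbT.
    by case: (eqVneq x b) xD => // ->; rewrite (negbTE bD).
  exact: idealI.
case/andP=> /andP[b'D id'] /andP[bD idbD]; rewrite b'D idbD /= andbT.
rewrite bD /=; have -> : b |: D = D :|: (b |: (D :\ b')).
  by apply/setP => x; rewrite !inE; case: (x \in D); rewrite ?orbT ?andbF ?orbF.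
exact: idealU.
Qed.

Lemma can_add_self D b : ideal D -> can_add D b ->
  can_rem (b |: D) b /\ (b |: D) :\ b = D.
Proof.
move=> idD /andP[bD _]; have e : (b |: D) :\ b = D by rewrite setU1K.
by split=> //; rewrite /can_rem setU11 e.
Qed.

Lemma can_rem_self D b : ideal D -> can_rem D b ->
  can_add (D :\ b) b /\ b |: (D :\ b) = D.
Proof.
move=> idD /andP[bD _]; have e : b |: (D :\ b) = D by rewrite finset.setD1K.
by split=> //; rewrite /can_add setD11 e.
Qed.

(** After adding [b], a removal either takes [b] back, which gives the sum of weights, or takes
    another box and commutes with the addition by [rem_add]. *)
Lemma sum_add_wchains_step D k : ideal D ->
  \sum_(b | can_add D b) wchains k.+1 (b |: D) =
  (\sum_(b | can_add D b) weight b) * wchains k D +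
  \sum_(b' | can_rem D b') weight b' *
     \sum_(b | can_add (D :\ b') b && (b != b')) wchains k (b |: (D :\ b')).
Proof.
move=> idD; rewrite big_distrl /=.
transitivity (\sum_(b | can_add D b) (weight b * wchains k D +
    \sum_(b' | can_rem (b |: D) b' && (b' != b))
       weight b' * wchains k ((b |: D) :\ b'))).
  apply: eq_bigr => b ab; have [rb e] := can_add_self idD ab.
  by rewrite wchainsS (bigD1 b) //= e.
rewrite big_split; congr (_ + _); rewrite (exchange_big_dep (can_rem D)) /=.
  apply: eq_bigr => b' rb'; rewrite big_distrr; apply: eq_big => b.
    by rewrite rem_add // rb' eq_sym.
  by case/and3P=> _ _ neq; rewrite set1U_comm.
by move=> b b' ab rb; have := rem_add b b' idD; rewrite ab rb => /esym/and3P[].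
Qed.

(* The commutation relation between adding and removing a box, applied to the
   weighted number of chains. *)
Lemma sum_add_wchains D : ideal D -> #|D| < n ->
  \sum_(b | can_add D b) wchains #|D|.+1 (b |: D) = #|D|.+1 * wchains #|D| D.
Proof.
move mE: #|D| => m idD mn; have n_gt0 : 0 < n by lia.
rewrite sum_add_wchains_step // add_rem_weight // ?mE //.
elim: m => [|m IHm] in D mE idD mn *.
  have D0 b : can_rem D b = false.
    by apply/negP => /can_rem_card; rewrite mE.
  by rewrite !(eq_bigl _ _ D0) !big_pred0_eq !addn0.
rewrite mulnDl mul1n mulSn -addnA; congr (_ + _).
rewrite [in RHS]wchainsS big_distrr big_distrl -big_split; apply: eq_bigr => b' rb' /=.
have [ab' e] := can_rem_self idD rb'.
have [_ idD'] := andP rb'.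
have cardD' : #|D :\ b'| = m by have := can_rem_card rb'; rewrite mE => -[].
have := IHm _ cardD' idD' (ltnW mn).
(* The induction hypothesis for [D :\ b'] is folded back into the sum over all boxes addable to it.
   Its term at [b'] is [wchains] of [D]; the other terms form the inner sum of the goal. *)
rewrite -add_rem_weight // ?cardD' ?(ltnW mn) // -sum_add_wchains_step //.
rewrite (bigD1 b') //= e mulnCA => <-.
by rewrite mulnDr.
Qed.

(** The sum of 2^(m - l) g^2. Only the first factor loses its largest entry: a diagram with a
    removable box is a smaller diagram with an addable one, so [sum_add_wchains] applies to the
    second factor. *)
Lemma sum_nchains_wchains m : m <= n ->
  \sum_(D | ideal D && (#|D| == m)) nchains m D * wchains m D = m`!.
Proof.
elim: m => [|m IHm] mn.
  rewrite (big_pred1 (finset.set0 : {set box n})) => [|D].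
    rewrite /wchains /= mul1n muln1.
    rewrite (_ : off_diag _ = finset.set0) ?cards0 //.
    by apply/setP => b; rewrite !inE.
  by rewrite cards_eq0; apply/andP/eqP => [[_ /eqP]|->//]; rewrite ?ideal0 ?eqxx.
transitivity (\sum_(D | ideal D && (#|D| == m)) nchains m D *
    \sum_(b | can_add D b) wchains m.+1 (b |: D)).
  under eq_bigr do rewrite /= big_distrl.
  under [in RHS]eq_bigr do rewrite big_distrr.
  rewrite (exchange_big_dep xpredT) //= [in RHS](exchange_big_dep xpredT) //=.
  apply: eq_bigr => b _.
  rewrite (reindex_onto (fun D => b |: D) (fun D => D :\ b)) /=; last first.
    by move=> D /and3P[_ bD _]; rewrite finset.setD1K.
  apply: eq_big => [D|D]; last by case/andP=> _ /eqP->.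
  have [bD|bD] := boolP (b \in D).
    rewrite /can_add bD andbF; apply/negP => /andP[_ /eqP e].
    by rewrite -e !inE eqxx in bD.
  rewrite /can_rem /can_add setU11 bD setU1K // eqxx cardsU1 bD eqSS /=.
  by case: (ideal D) (ideal (b |: D)) (_ == _) => [] [] [].
under eq_bigr => D /andP[idD /eqP mD].
  by rewrite -mD sum_add_wchains ?mD // mulnCA; over.
rewrite -big_distrr IHm ?(ltnW mn) // factS.
Qed.

Fixpoint chains (k : nat) D : seq (seq (box n)) :=
  if k is k'.+1 then
    [seq rcons p b | b <- enum (can_rem D), p <- chains k' (D :\ b)]
  else [:: [::]].

Lemma chainsP k D p : reflect
  (exists b p', [/\ can_rem D b, p' \in chains k (D :\ b) & p = rcons p' b])
  (p \in chains k.+1 D).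
Proof.
apply: (iffP allpairsPdep) => [[b [p' [bD pD ->]]]|[b [p' [bD pD ->]]]].
  by exists b, p'; split=> //; move: bD; rewrite mem_enum.
by exists b, p'; split=> //; rewrite mem_enum.
Qed.

Lemma size_chains k D : size (chains k D) = nchains k D.
Proof.
elim: k D => //= k IHk D.
rewrite size_allpairs_dep sumnE big_map big_enum_cond /=.
by apply: eq_big => b; rewrite ?andbT // => _; exact: IHk.
Qed.

Lemma uniq_chains k D : uniq (chains k D).
Proof.
elim: k D => //= k IHk D; apply: allpairs_uniq_dep => [|b _|]; rewrite ?enum_uniq //.
by move=> [b p] [b' p'] _ _ /= /rcons_inj[-> ->].
Qed.

Lemma chains_spec k D p : #|D| = k -> p \in chains k D ->
  [/\ size p = k, p =i D &
    ideal D -> forall x y, x \in D -> y \in D -> box_le x y -> x != y ->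
      index x p < index y p].
Proof.
elim: k D p => [|k IHk] D p Dk.
  rewrite mem_seq1 => /eqP->; have D0 := cards0_eq Dk.
  by split=> // [x|_ x y]; rewrite D0 !inE.
move=> /chainsP[b [p' [bD p'D ->]]].
have Dk' : #|D :\ b| = k by have := can_rem_card bD; rewrite Dk => -[].
have [sz mem lt] := IHk _ _ Dk' p'D; have [bD' idD'] := andP bD.
have bp' : b \notin p' by rewrite mem !inE eqxx.
split; first by rewrite size_rcons sz.
  move=> x; rewrite mem_rcons in_cons mem !inE.
  by case: eqVneq => // ->.
move=> idD x y xD yD le neq.
rewrite -!cats1 !index_cat !mem !inE xD yD !andbT /=.
have [xb|xb] /= := eqVneq x b.
  have [yb|yb] /= := eqVneq y b; first by rewrite xb yb eqxx in neq.
  exfalso; have yD' : y \in D :\ b by rewrite !inE yb.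
  have /andP[le1 le2] := le.
  have := ideal_closed idD' yD' (ideal_diag idD xD) le1 le2.
  by rewrite !inE xb eqxx.
have [yb|yb] /= := eqVneq y b; last by apply: lt; rewrite // !inE ?xb ?yb.
by rewrite addn0 index_mem mem !inE xb.
Qed.

(** A chain lists the boxes in the order of their entries; sending each box to its position gives
    distinct standard tableaux for distinct chains. *)
Lemma nchains_le_std (la : strict_part n) :
  #|diagram n (part_rows la)| = n ->
  nchains n (diagram n (part_rows la)) <= #|{: stableau la}|.
Proof.
set D := diagram n (part_rows la) => Dn.
have idD : ideal D by exact: ideal_part.
(* [insubd] requires a default entry; [tabE] shows that chains of the diagram never produce it. *)
pose tab (p : seq (box n)) : filling la :=
  [ffun b => insubd (row_tableau la b) (index (val b) p)].
have tabE p (b : cell la) : p \in chains n D -> tab p b = index (val b) p :> nat.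
  move=> pD; have [sz mem _] := chains_spec Dn pD.
  rewrite ffunE val_insubd ifT //; apply: leq_trans (_ : size p <= n); last by rewrite sz.
  by rewrite index_mem mem; exact: valP b.
have chain_uniq p : p \in chains n D -> uniq p.
  move=> pD; have [sp mp _] := chains_spec Dn pD.
  by apply/card_uniqP; rewrite (eq_card mp) Dn sp.
have tab_inj : {in chains n D &, injective tab}.
  move=> p q pD qD e; have [sp mp _] := chains_spec Dn pD.
  have [sq mq _] := chains_spec Dn qD.
  have [n0|n_gt0] := posnP n.
    by rewrite (size0nil (etrans sp n0)) (size0nil (etrans sq n0)).
  pose b0 : box n := (Ordinal n_gt0, Ordinal n_gt0).
  apply: (@eq_from_nth _ b0) => [|k kp]; first by rewrite sp sq.
  have xD : nth b0 p k \in D by rewrite -mp mem_nth.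
  have := congr1 (fun F : filling la => F (exist (fun x : box n => x \in D) _ xD) : nat) e.
  rewrite !tabE //= index_uniq ?chain_uniq // => ke.
  by rewrite [X in _ = nth _ _ X]ke nth_index // mq.
have tab_std p : p \in chains n D -> is_standard (tab p).
  move=> pD; have [sp mp lt] := chains_spec Dn pD.
  apply: std_of_lt => [b b' /(congr1 val) /=|k|b b' le neq].
  - rewrite !tabE // => e; apply: val_inj.
    have bp : val b \in p by rewrite mp; exact: valP b.
    by rewrite -(nth_index (val b) bp) e nth_index // mp; exact: valP b'.
  - have klt : k < size p by rewrite sp.
    have b0 : box n by case: p klt {pD sp mp lt} => // b *; exact: b.
    have bD : nth b0 p k \in D by rewrite -mp mem_nth.
    exists (exist (fun x : box n => x \in D) _ bD); apply: ord_inj.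
    by rewrite tabE //= index_uniq ?chain_uniq.
  rewrite !tabE //; apply: lt => //; [exact: valP b|exact: valP b'].
rewrite -size_chains -(size_map tab) card_sub cardE; apply: uniq_leq_size.
  by rewrite map_inj_in_uniq ?uniq_chains.
by move=> _ /mapP[p pD ->]; rewrite mem_enum; exact: tab_std.
Qed.

Lemma card_bars (la : strict_part n) :
  #|{: bars la}| = 2 ^ #|off_diag (diagram n (part_rows la))|.
Proof.
by rewrite card_sub -card_powerset; apply: eq_card => beta; rewrite !inE.
Qed.

(** In [sum_nchains_wchains] the two factors [nchains] account for [T] and [U], the power of 2 for
    the bars. *)
Lemma fact_le_card_zeta_index : n`! <= #|{: zeta_index n}|.
Proof.
rewrite -(sum_nchains_wchains (leqnn n)) card_tagged sumnE big_map big_enum /=.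
rewrite [leqRHS](partition_big (fun la => diagram n (part_rows la)) xpredT) //=.
rewrite big_mkcond; apply: leq_sum => D _; case: ifP => // /andP[idD /eqP Dn].
have [la [la_strict laD la_sum]] := ideal_shape idD.
have laP : strict (rows la) && (sumn (rows la) == n) by rewrite la_strict la_sum Dn /=.
pose sla : strict_part n := exist _ la laP.
rewrite (bigD1 sla) /=; last by rewrite /part_rows /= laD.
rewrite -[leqLHS]addn0; apply: leq_add => //.
have slaD : diagram n (part_rows sla) = D := laD.
have barsE : #|{: bars sla}| = 2 ^ #|off_diag D| by rewrite card_bars slaD.
have le : nchains n D <= #|{: stableau sla}|.
  by rewrite -slaD; apply: nchains_le_std; rewrite slaD.
rewrite !card_prod barsE /wchains mulnCA mulnC; apply: leq_mul => //.
exact: leq_mul.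
Qed.

End Chains.

(** * Reduced words and the row tableau *)

Section Inversions.
Variable n : nat.
Implicit Types (w : 'S_n) (a : 'I_n.-1) (s : seq 'I_n.-1).

Definition adj_perm a : 'S_n := tperm (adj_lo a) (adj_hi a).

Definition inversions w : {set 'I_n * 'I_n} :=
  [set p : 'I_n * 'I_n | (p.1 < p.2) && (w p.2 < w p.1)].

Lemma adj_perm_mulE w a k : (w * adj_perm a)%g k =
  (if w k == a :> nat then a.+1 else if w k == a.+1 :> nat then (a : nat) else w k) :> nat.
Proof. by rewrite permM tpermE_adj. Qed.

Lemma adj_permK w a : (w * adj_perm a * adj_perm a = w)%g.
Proof. by rewrite -mulgA tperm2 mulg1. Qed.

(** The product [w * adj_perm a] is s_a after w, so it exchanges the values a and a + 1; only the
    pair of their positions changes its order. *)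
Lemma inversions_ascent w a : (w^-1)%g (adj_lo a) < (w^-1)%g (adj_hi a) ->
  #|inversions (w * adj_perm a)%g| = #|inversions w|.+1.
Proof.
set i := (w^-1)%g _; set j := (w^-1)%g _ => ij.
have wi : w i = a :> nat by rewrite permKV.
have wj : w j = a.+1 :> nat by rewrite permKV.
have ij_ninv : (i, j) \notin inversions w by rewrite inE /= wi wj ij /=; lia.
have -> : inversions (w * adj_perm a)%g = (i, j) |: inversions w.
  apply/setP => -[p q]; rewrite in_setU1 !inE /= !adj_perm_mulE xpair_eqE.
  have eqi : (p == i) = (w p == a :> nat).
    by rewrite -(inj_eq (@perm_inj _ w)) -val_eqE /= wi.
  have eqj : (q == j) = (w q == a.+1 :> nat).
    by rewrite -(inj_eq (@perm_inj _ w)) -val_eqE /= wj.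
  have eqi' : (q == i) = (w q == a :> nat).
    by rewrite -(inj_eq (@perm_inj _ w)) -val_eqE /= wi.
  have eqj' : (p == j) = (w p == a.+1 :> nat).
    by rewrite -(inj_eq (@perm_inj _ w)) -val_eqE /= wj.
  rewrite eqi eqj.
  case: (boolP (p < q)) => [pq|npq] /=; last first.
    apply/esym/negP => /orP[/andP[]|//]; rewrite -eqi -eqj => /eqP pi /eqP qj.
    by rewrite pi qj ij in npq.
  have nswap : ~ (w p = a.+1 :> nat /\ w q = a :> nat).
    case=> /eqP; rewrite -eqj' => /eqP pj /eqP; rewrite -eqi' => /eqP qi.
    by rewrite pj qi in pq; lia.
  have neq : (w p : nat) <> w q.
    by move=> /ord_inj/perm_inj e; rewrite e ltnn in pq.
  by repeat case: ifP; lia.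
by rewrite cardsU1 ij_ninv.
Qed.

Lemma inversions_descent w a : (w^-1)%g (adj_hi a) < (w^-1)%g (adj_lo a) ->
  #|inversions w| = #|inversions (w * adj_perm a)%g|.+1.
Proof.
move=> des; rewrite -{1}(adj_permK w a); apply: inversions_ascent.
by rewrite invMg tpermV !permM tpermL tpermR.
Qed.

Lemma word_for_nil w : word_for w [::] <-> w = 1%g.
Proof.
by split=> [ws|-> k]; [apply/permP => k; rewrite perm1 ws|rewrite perm1].
Qed.

Lemma word_for_cons w a s : word_for w (a :: s) <-> word_for (w * adj_perm a)%g s.
Proof.
split=> ws k; first by rewrite permM ws /= tpermK.
by rewrite -{1}(adj_permK w a) permM ws.
Qed.

Lemma inversions1 : inversions 1 = finset.set0.
Proof. by apply/setP => p; rewrite !inE !perm1; lia. Qed.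

Lemma inversions_le_word w s : word_for w s -> #|inversions w| <= size s.
Proof.
elim: s w => [|a s IHs] w.
  by move/word_for_nil->; rewrite inversions1 cards0.
move/word_for_cons/IHs => le; rewrite [size _]/=.
have [lt|gt|/ord_inj/perm_inj/(congr1 val) /=] :=
  ltngtP ((w^-1)%g (adj_lo a)) ((w^-1)%g (adj_hi a)); last by lia.
  by rewrite inversions_ascent // in le; exact/leqW/ltnW.
by rewrite (inversions_descent gt) ltnS.
Qed.

Lemma mono_perm_ge (w : 'S_n) : (forall p q : 'I_n, p < q -> w p < w q) ->
  forall k : 'I_n, k <= w k.
Proof.
move=> w_mono [k klt]; elim: k klt => // k IHk klt.
apply: leq_ltn_trans (IHk (ltnW klt)) _.
exact: (w_mono (Ordinal (ltnW klt)) (Ordinal klt)).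
Qed.

Lemma adj_mono (f : 'I_n -> 'I_n) : (forall a, f (adj_lo a) < f (adj_hi a)) ->
  forall p q : 'I_n, p < q -> f p < f q.
Proof.
move=> f_adj p [q qlt] /=; elim: q qlt => // q IHq qlt; rewrite ltnS => pq.
have alt : q < n.-1 by lia.
have := f_adj (Ordinal alt).
have -> : adj_hi (Ordinal alt) = Ordinal qlt by exact: ord_inj.
have -> : adj_lo (Ordinal alt) = Ordinal (ltnW qlt) by exact: ord_inj.
apply: leq_ltn_trans; move: pq; rewrite leq_eqVlt => /orP[/eqP e|lt].
  by rewrite (_ : p = Ordinal (ltnW qlt)) //; exact: ord_inj.
exact/ltnW/IHq.
Qed.

(** At a descent one letter removes exactly one inversion. Without descents w^-1 is increasing and
    no inversion is left. *)
Lemma word_inversions w : exists2 s, word_for w s & size s = #|inversions w|.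
Proof.
move kE: #|inversions w| => k; elim: k w kE => [|k IHk] w wk.
  exists [::] => //; apply/word_for_nil; apply/permP => i; rewrite perm1.
  have mono (p q : 'I_n) : p < q -> w p < w q.
    move=> pq; have [//|gt|/ord_inj/perm_inj e] := ltngtP (w p) (w q); last first.
      by rewrite e ltnn in pq.
    by have := cards0_eq wk => /setP/(_ (p, q)); rewrite !inE /= pq gt.
  have mono' (p q : 'I_n) : p < q -> (w^-1)%g p < (w^-1)%g q.
    move=> pq; have [//|gt|/ord_inj/perm_inj e] := ltngtP ((w^-1)%g p) ((w^-1)%g q); last first.
      by rewrite e ltnn in pq.
    by have := mono _ _ gt; rewrite !permKV; lia.
  apply/ord_inj/eqP; rewrite eqn_leq mono_perm_ge // andbT.
  by have := mono_perm_ge mono' (w i); rewrite permK.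
have [[a des]|asc] := pselect (exists a, (w^-1)%g (adj_hi a) < (w^-1)%g (adj_lo a)).
  have [|s ws sz] := IHk (w * adj_perm a)%g.
    by have := inversions_descent des; rewrite wk => -[].
  by exists (a :: s); rewrite /= ?sz //; exact/word_for_cons.
have mono : forall p q : 'I_n, p < q -> (w^-1)%g p < (w^-1)%g q.
  apply: adj_mono => a.
  have [//|gt|/ord_inj/perm_inj/(congr1 val) /=] :=
    ltngtP ((w^-1)%g (adj_lo a)) ((w^-1)%g (adj_hi a)); last by lia.
  by case: asc; exists a.
suff : inversions w = finset.set0 by move=> w0; rewrite w0 cards0 in wk.
apply/setP => -[p q]; rewrite !inE /=; apply/negP => /andP[pq /mono].
by rewrite !permK; lia.
Qed.

Lemma reduced_wordP w : reduced_for w (reduced_word w).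
Proof.
apply: (xgetPex [::]); have [s ws sz] := word_inversions w.
by exists s; split=> // s' /inversions_le_word; rewrite sz.
Qed.

(** Were a an ascent, [s] would have to be at least one letter longer than the number of inversions
    of w, against the minimality of [a :: s]. *)
Lemma reduced_descent w a s : reduced_for w (a :: s) ->
  reduced_for (w * adj_perm a)%g s /\ (w^-1)%g (adj_hi a) < (w^-1)%g (adj_lo a).
Proof.
move=> [/word_for_cons ws wmin]; split.
  split=> // s' ws'; have := wmin (a :: s'); rewrite /= ltnS; apply.
  exact/word_for_cons.
have [lt|//|/ord_inj/perm_inj/(congr1 val) /=] :=
  ltngtP ((w^-1)%g (adj_lo a)) ((w^-1)%g (adj_hi a)); last by lia.
have [s' ws' sz'] := word_inversions w.
have := wmin s' ws'; have := inversions_le_word ws.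
by rewrite (inversions_ascent lt) sz' /=; lia.
Qed.

Lemma word_for_rev w s : word_for w s -> word_for (w^-1)%g (rev s).
Proof.
elim: s w => [|a s IHs] w; first by move/word_for_nil->; rewrite invg1; apply/word_for_nil.
move/word_for_cons/IHs => ws k; rewrite rev_cons foldr_rcons -ws.
by rewrite invMg tpermV permM tpermK.
Qed.

Lemma reduced_for_rev w s : reduced_for w s -> reduced_for (w^-1)%g (rev s).
Proof.
move=> [ws wmin]; split=> [|s' ws']; first exact: word_for_rev.
by rewrite size_rev -(size_rev s'); apply: wmin; rewrite -[w]invgK; exact: word_for_rev.
Qed.

End Inversions.

Section RowTableau.
Variables (n : nat) (la : strict_part n) (T : stableau la).
Implicit Types b : cell la.

Lemma row_tableau_lex b b' : cell_row b < cell_row b' ->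
  row_tableau la b < row_tableau la b'.
Proof.
move=> lt; rewrite !ffunE /=; apply: leq_trans (leq_addr _ _).
have [_ b2] : cell_row b < size (part_rows la) /\ cell_col b < cell_row b + nth 0 (part_rows la) (cell_row b).
  by have := valP b; rewrite inE => /and3P[? _ ?].
have d := row_le_col b.
rewrite -(big_mkord xpredT (nth 0 (part_rows la))).
rewrite -(big_mkord xpredT (nth 0 (part_rows la))).
rewrite [leqRHS](big_cat_nat (n := (cell_row b).+1)) //=.
rewrite big_nat_recr //= -/(cell_row b) -/(cell_col b).
rewrite -addnA ltn_add2l; apply: leq_trans (leq_addr _ _); lia.
Qed.

Lemma row_tableau_row b b' : cell_row b = cell_row b' ->
  cell_col b < cell_col b' -> row_tableau la b < row_tableau la b'.
Proof.
move=> e lt; rewrite !ffunE /= -/(cell_row b) -/(cell_col b) -/(cell_row b') -/(cell_col b').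
by rewrite e ltn_add2l; have := row_le_col b; rewrite e; lia.
Qed.

Lemma row_tableau_lt b b' : cell_le b b' -> b != b' ->
  row_tableau la b < row_tableau la b'.
Proof.
case/andP=> le1 le2 neq; have [lt|ge] := ltnP (cell_row b) (cell_row b').
  exact: row_tableau_lex.
have e : cell_row b = cell_row b' by lia.
apply: row_tableau_row => //; rewrite ltn_neqAle le2 andbT.
by apply: contraNneq neq => e2; apply/eqP/cell_eq.
Qed.

Lemma row_tableau_inj : injective (row_tableau la).
Proof.
move=> b b' e; apply/eqP; apply: contraT => neq.
have [lt|gt|er] := ltngtP (cell_row b) (cell_row b').
- by have := row_tableau_lex lt; rewrite e ltnn.
- by have := row_tableau_lex gt; rewrite e ltnn.
have [lt|gt|ec] := ltngtP (cell_col b) (cell_col b').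
- by have := row_tableau_row er lt; rewrite e ltnn.
- by have := row_tableau_row (esym er) gt; rewrite e ltnn.
by rewrite (cell_eq er ec) eqxx in neq.
Qed.

(** The standard tableau [T] of the section provides n distinct cells, so the injective row tableau
    is onto. *)
Lemma row_tableau_surj k : exists b, row_tableau la b = k.
Proof.
have Tstd : is_standard (val T) := valP T.
have cards : #|'I_n| <= #|{: cell la}|.
  have /fin_all_exists[g gK] i : exists b, val T b = i by exact: std_surj.
  by apply: (@leq_card _ _ g); exact: can_inj gK.
by have /codomP[b ->] := inj_card_onto row_tableau_inj cards k; exists b.
Qed.

Lemma row_tableau_std : is_standard (row_tableau la).
Proof.
exact: std_of_lt row_tableau_inj row_tableau_surj row_tableau_lt.
Qed.

Lemma dpermE b : val T b = dperm T (row_tableau la b).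
Proof.
have Tstd : is_standard (val T) := valP T.
rewrite /dperm; case: pickP => [w /forallP/(_ b)/eqP //|no].
have /fin_all_exists[g gK] i : exists b, row_tableau la b = i.
  exact: row_tableau_surj.
have Tg_inj : injective (val T \o g).
  by apply: inj_comp; [exact: std_inj|exact: can_inj gK].
have := no (perm Tg_inj); apply: contraFeq => _; apply/forallP => d; apply/eqP.
by rewrite permE /=; congr (val T _); apply: row_tableau_inj; rewrite gK.
Qed.

End RowTableau.

Section PermAction.
Variables (n : nat) (la : strict_part n).
Implicit Types (F : filling la) (w : 'S_n).

Definition pact w F : filling la := [ffun b => w (F b)].

Lemma pact1 F : pact 1 F = F.
Proof. by apply/ffunP => b; rewrite ffunE perm1. Qed.

Lemma pactM w w' F : pact (w * w')%g F = pact w' (pact w F).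
Proof. by apply/ffunP => b; rewrite !ffunE permM. Qed.

Lemma pact_adj a F : pact (adj_perm a) F = tab_swap a F.
Proof. by apply/ffunP => b; rewrite !ffunE. Qed.

Lemma pact_dperm (T : stableau la) : pact (dperm T) (row_tableau la) = val T.
Proof. by apply/ffunP => b; rewrite ffunE -dpermE. Qed.

End PermAction.

Import Order.TTheory GRing.Theory Num.Theory.
Local Open Scope ring_scope.

(** * Algebras given by generators and relations *)

(* Cayley-Hamilton: an injective endomorphism f satisfies a polynomial identity
   with nonzero constant term, which exhibits every v as a value of f. *)
Lemma inj_endo_surj (K : fieldType) (V : lmodType K) (D : nat)
    (g : 'I_D -> V) (f : {linear V -> V}) :
  (forall v, exists a : 'I_D -> K, v = \sum_i a i *: g i) ->
  injective f -> forall v, exists u, f u = v.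
Proof.
move=> g_span f_inj.
have /fin_all_exists[M fM] i : exists a : 'I_D -> K, f (g i) = \sum_j a j *: g j.
  exact: g_span.
case: D => [|D] in g g_span M fM *.
  by move=> v; exists 0; have [a ->] := g_span v; rewrite big_ord0 linear0.
(* The [g i] span but may be dependent, so [A] is one of possibly several matrices describing [f];
   its characteristic polynomial annihilates [f] all the same. *)
pose A := \matrix_(i, j) M i j.
have iterM k i : iter k f (g i) = \sum_j (A ^+ k) i j *: g j.
  elim: k i => [|k IHk] i.
    rewrite (bigD1 i) //= expr0 mxE eqxx scale1r big1 ?addr0 // => j.
    by rewrite mxE eq_sym => /negbTE->; rewrite scale0r.
  rewrite iterSr fM.
  have -> : iter k f (\sum_j M i j *: g j) = \sum_j M i j *: iter k f (g j).
    elim: k {IHk} => //= k ->; rewrite linear_sum.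
    by apply: eq_bigr => j _; rewrite linearZ.
  under eq_bigr do rewrite IHk scaler_sumr.
  rewrite exchange_big; apply: eq_bigr => j _ /=.
  rewrite exprS mxE scaler_suml; apply: eq_bigr => l _.
  by rewrite mxE scalerA.
have iter_lin k (a : 'I_D.+1 -> K) (u : 'I_D.+1 -> V) :
    iter k f (\sum_i a i *: u i) = \sum_i a i *: iter k f (u i).
  elim: k => //= k ->; rewrite linear_sum.
  by apply: eq_bigr => j _; rewrite linearZ.
pose p := char_poly A.
have p0 v : \sum_(k < size p) p`_k *: iter k f v = 0.
  have [a ->] := g_span v.
  under eq_bigr do rewrite iter_lin scaler_sumr.
  rewrite exchange_big big1 // => i _ /=.
  under eq_bigr do rewrite iterM scalerA mulrC -scalerA.
  rewrite -scaler_sumr.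
  under eq_bigr do rewrite scaler_sumr.
  rewrite exchange_big big1 ?scaler0 // => j _ /=.
  under eq_bigr do rewrite scalerA.
  rewrite -scaler_suml.
  have : horner_mx A p = \sum_(k < size p) p`_k *: A ^+ k.
    rewrite -[p in LHS]coefK poly_def raddf_sum; apply: eq_bigr => k _ /=.
    by rewrite linearZ /= rmorphXn /= horner_mx_X.
  rewrite Cayley_Hamilton => /matrixP/(_ i j)/esym; rewrite mxE summxE.
  by under eq_bigr do rewrite mxE; move=> ->; rewrite scale0r.
have p_neq0 : p != 0 by rewrite monic_neq0 ?char_poly_monic.
have exk : exists k, p`_k != 0 by exists (size p).-1; rewrite lead_coef_eq0.
(* Write p = X^k p' with p'(0) nonzero. As f^k is injective, p(f) = 0 gives p'(f) = 0, and solving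
   for the constant term exhibits v as a value of f. *)
have [k pk kmin] := ex_minnP exk.
have klt : (k < size p)%N.
  by rewrite ltnNge; apply: contra pk => ?; rewrite nth_default.
move=> v.
have iter_inj m : injective (iter m f) by elim: m => //= m IHm u w /f_inj/IHm.
have iter_scal m (a : K) u : iter m f (a *: u) = a *: iter m f u.
  by elim: m => //= m ->; rewrite linearZ.
have iter_sum m (n : nat) (u : 'I_n -> V) : iter m f (\sum_i u i) = \sum_i iter m f (u i).
  by elim: m => //= m ->; rewrite linear_sum.
pose q := \sum_(j < size p - k) p`_(k + j) *: iter j f v.
have q0 : q = 0.
  apply: (iter_inj k).
  have -> : iter k f 0 = 0 by elim: (k) => //= m ->; rewrite linear0.
  rewrite iter_sum -[RHS](p0 v).
  rewrite -(big_mkord xpredT (fun k => p`_k *: iter k f v)).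
  rewrite (big_cat_nat (n := k)) //=; last exact: ltnW.
  rewrite [X in _ = X + _]big1_seq ?add0r => [|j].
    rewrite -[X in bigop _ (index_iota X _)]add0n big_addn big_mkord; apply: eq_bigr => j _.
    by rewrite iter_scal [(j + k)%N]addnC iterD.
  rewrite mem_index_iota /= => jk; suff /eqP-> : p`_j == 0 by rewrite scale0r.
  by apply: contraLR jk => /kmin; rewrite -leqNgt.
move: q0; rewrite /q; case Dm: (size p - k)%N => [|m]; first by lia.
rewrite big_ord_recl /= addn0 => /eqP; rewrite addr_eq0 => /eqP pkv.
exists (- (p`_k)^-1 *: \sum_(i < m) p`_(k + i.+1) *: iter i f v).
rewrite linearZ /= linear_sum; under eq_bigr do rewrite linearZ.
by rewrite scaleNr -scalerN -pkv scalerA mulVf ?scale1r.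
Qed.

Section Palg.
Variables (K : pzRingType) (P : presentation K).

Lemma palg_addE (s t : term K (gens P)) : pcls s + pcls t = pcls (Add s t).
Proof. exact: pclsA. Qed.
Lemma palg_mulE (s t : term K (gens P)) : pcls s * pcls t = pcls (Mul s t).
Proof. exact: pclsM. Qed.
Lemma palg_scaleE a (s : term K (gens P)) :
  a *: pcls s = pcls (Mul (Scal a) s).
Proof. exact: pclsZ. Qed.
Lemma palg_scalE a : pcls (P := P) (Scal a) = a *: (1 : palg P).
Proof.
rewrite palg_scaleE; apply/pclsP.
exact: cong_trans (cong_sym (cong_mul1 _)) (cong_scalC _ _).
Qed.

Lemma palg_ind (Q : palg P -> Prop) :
    (forall g, Q (pgen g)) -> (forall a, Q (a *: (1 : palg P))) ->
    (forall x y, Q x -> Q y -> Q (x + y)) ->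
    (forall x y, Q x -> Q y -> Q (x * y)) ->
  forall x, Q x.
Proof.
move=> Qg Qs Qa Qm; elim/pcls_ind; elim=> [g|a|s Qs1 t Qt|s Qs1 t Qt].
- exact: Qg.
- by rewrite palg_scalE.
- by rewrite -palg_addE; exact: Qa.
- by rewrite -palg_mulE; exact: Qm.
Qed.

End Palg.

(** * Modules and homomorphisms defined on generators *)

Section Action.
Variables (K : pzRingType) (P : presentation K) (M : lmodType K).
Variable op : gens P -> M -> M.

Fixpoint term_act (s : term K (gens P)) (m : M) : M :=
  match s with
  | Gen g => op g m
  | Scal a => a *: m
  | Add s t => term_act s m + term_act t m
  | Mul s t => term_act s (term_act t m)
  end.

Definition palg_act (x : palg P) : M -> M := term_act (prepr x).

Hypothesis opD : forall g, {morph op g : m m' / m + m'}.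
Hypothesis opZ : forall g a m, op g (a *: m) = a *: op g m.
Hypothesis scaleC : forall (a b : K) (m : M), a *: (b *: m) = b *: (a *: m).
Hypothesis op_rels : forall s t, rels s t -> term_act s =1 term_act t.

Lemma term_actD s : {morph term_act s : m m' / m + m'}.
Proof.
elim: s => [g|a|s IHs t IHt|s IHs t IHt] m m' /=; first exact: opD.
- exact: scalerDr.
- by rewrite IHs IHt addrACA.
- by rewrite IHt IHs.
Qed.

Lemma term_actZ s a m : term_act s (a *: m) = a *: term_act s m.
Proof.
elim: s m => [g|b|s IHs t IHt|s IHs t IHt] m /=; first exact: opZ.
- exact: scaleC.
- by rewrite IHs IHt scalerDr.
- by rewrite IHt IHs.
Qed.

(** The axioms of [cong] dictate the hypotheses: right distributivity asks for additive operators,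
    and [cong_scalC] for scalars commuting with the operators and with one another, K being an
    arbitrary ring. *)
Lemma term_act_cong s t : cong s t -> term_act s =1 term_act t.
Proof.
elim=> {s t} /=.
- exact: op_rels.
- by [].
- by move=> s t _ st m; rewrite st.
- by move=> s t u _ st _ tu m; rewrite st tu.
- by move=> s s' t t' _ st _ tu m; rewrite st tu.
- by move=> s s' t t' _ st _ tu m; rewrite st tu.
- by move=> s t u m; rewrite addrA.
- by move=> s t m; rewrite addrC.
- by move=> s m; rewrite scale0r add0r.
- by move=> s m; rewrite scaleN1r addNr scale0r.
- by [].
- by move=> s m; rewrite scale1r.
- by [].
- by move=> s t u m; rewrite term_actD.
- by move=> a b m; rewrite scalerDl.
- by move=> a b m; rewrite scalerA.
- by move=> a s m; rewrite term_actZ.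
Qed.

Lemma palg_act_cls s : palg_act (pcls s) =1 term_act s.
Proof. by apply: term_act_cong; exact: repr_pcls. Qed.

Lemma palg_act_gen g m : palg_act (pgen g) m = op g m.
Proof. exact: palg_act_cls. Qed.

Lemma palg_act1 m : palg_act 1 m = m.
Proof. by rewrite [LHS]palg_act_cls /= scale1r. Qed.

Lemma palg_actDl x y m : palg_act (x + y) m = palg_act x m + palg_act y m.
Proof.
elim/pcls_ind: x => s; elim/pcls_ind: y => t.
by rewrite palg_addE !palg_act_cls.
Qed.

Lemma palg_actM x y m : palg_act (x * y) m = palg_act x (palg_act y m).
Proof.
elim/pcls_ind: x => s; elim/pcls_ind: y => t.
by rewrite palg_mulE !palg_act_cls.
Qed.

Lemma palg_actZl a x m : palg_act (a *: x) m = a *: palg_act x m.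
Proof. by elim/pcls_ind: x => s; rewrite palg_scaleE !palg_act_cls. Qed.

Lemma palg_actDr x : {morph palg_act x : m m' / m + m'}.
Proof. exact: term_actD. Qed.

Lemma palg_actZr x a m : palg_act x (a *: m) = a *: palg_act x m.
Proof. exact: term_actZ. Qed.

End Action.

Section Substitution.
Variables (K : pzRingType) (P Q : presentation K).
Variable h : gens P -> term K (gens Q).

Fixpoint term_subst (s : term K (gens P)) : term K (gens Q) :=
  match s with
  | Gen g => h g
  | Scal a => Scal a
  | Add s t => Add (term_subst s) (term_subst t)
  | Mul s t => Mul (term_subst s) (term_subst t)
  end.

Definition palg_subst (x : palg P) : palg Q := pcls (term_subst (prepr x)).

Hypothesis h_rels :
  forall s t, rels s t -> cong (term_subst s) (term_subst t).

Lemma cong_subst s t : cong s t -> cong (term_subst s) (term_subst t).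
Proof.
elim=> {s t} /=; [exact: h_rels| | |
  by move=> s t u _ + _; exact: cong_trans | by constructor..].
- by move=> s; exact: cong_refl.
- by move=> s t _; exact: cong_sym.
Qed.

Lemma palg_subst_cls s : palg_subst (pcls s) = pcls (term_subst s).
Proof. by apply/pclsP/cong_subst; exact: repr_pcls. Qed.

Lemma palg_subst_gen g : palg_subst (pgen g) = pcls (h g).
Proof. exact: palg_subst_cls. Qed.

Lemma palg_subst1 : palg_subst 1 = 1.
Proof. exact: palg_subst_cls. Qed.

Lemma palg_substD : {morph palg_subst : x y / x + y}.
Proof.
elim/pcls_ind=> s; elim/pcls_ind=> t.
by rewrite palg_addE !palg_subst_cls palg_addE.
Qed.

Lemma palg_substM : {morph palg_subst : x y / x * y}.
Proof.
elim/pcls_ind=> s; elim/pcls_ind=> t.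
by rewrite palg_mulE !palg_subst_cls palg_mulE.
Qed.

Lemma palg_substZ a x : palg_subst (a *: x) = a *: palg_subst x.
Proof.
by elim/pcls_ind: x => s; rewrite palg_scaleE !palg_subst_cls palg_scaleE.
Qed.

End Substitution.

(** Coefficients stand on the left of the spanning words, so words must grow on the right. *)
Lemma palg_rclosed (K : pzRingType) (P : presentation K) (Q : palg P -> Prop) :
    Q 1 -> (forall x y, Q x -> Q y -> Q (x + y)) ->
    (forall a x, Q x -> Q (a *: x)) ->
    (forall x g, Q x -> Q (x * pgen g)) ->
  forall x, Q x.
Proof.
move=> Q1 Qa Qs Qg x; rewrite -[x]mul1r.
elim/palg_ind: x (1 : palg P) Q1 => [g|a|y z Qy Qz|y z Qy Qz] x Qx.
- exact: Qg.
- by rewrite -palg_scalerAr mulr1; exact: Qs.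
- by rewrite mulrDr; apply: Qa; [exact: Qy | exact: Qz].
- by rewrite mulrA; apply/Qz/Qy.
Qed.

Section LeftSpan.
Variables (B S : pzRingType) (f : B -> S).
Hypothesis fD : {morph f : a b / a + b}.
Hypothesis fM : {morph f : a b / a * b}.
Hypothesis f1 : f 1 = 1.

Definition left_span (s : seq S) (x : S) : Prop :=
  exists a : nat -> B, x = \sum_(i < size s) f (a i) * s`_i.

Lemma left_span_f0 : f 0 = 0.
Proof. by apply: (addIr (f 0)); rewrite -fD !add0r. Qed.

Lemma left_span_fN b : f (- b) = - f b.
Proof. by apply: (addIr (f b)); rewrite -fD !addNr left_span_f0. Qed.

Lemma left_span0 s : left_span s 0.
Proof.
by exists (fun=> 0); rewrite big1 // => i _; rewrite left_span_f0 mul0r.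
Qed.

Lemma left_spanD s x y : left_span s x -> left_span s y -> left_span s (x + y).
Proof.
move=> [a ->] [b ->]; exists (fun i => a i + b i).
by rewrite -big_split; apply: eq_bigr => i _; rewrite fD mulrDl.
Qed.

Lemma left_spanM s b x : left_span s x -> left_span s (f b * x).
Proof.
move=> [a ->]; exists (fun i => b * a i).
by rewrite mulr_sumr; apply: eq_bigr => i _; rewrite fM mulrA.
Qed.

Lemma left_spanN s x : left_span s x -> left_span s (- x).
Proof. by move/(left_spanM (-1)); rewrite left_span_fN f1 mulN1r. Qed.

Lemma left_span_sign s (e : bool) x :
  left_span s x -> left_span s ((-1) ^+ e * x).
Proof. by case: e => [/left_spanN|]; rewrite ?mulN1r ?mul1r. Qed.

Lemma left_span_sum s I (r : seq I) (F : I -> S) :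
  (forall i, left_span s (F i)) -> left_span s (\sum_(i <- r) F i).
Proof.
move=> sF; elim/big_ind: _ => //; [exact: left_span0|exact: left_spanD].
Qed.

Lemma left_span_mem s x : x \in s -> left_span s x.
Proof.
move=> /(nthP 0)[i ilt <-]; exists (fun j => (j == i)%:R).
rewrite (bigD1 (Ordinal ilt)) //= eqxx f1 mul1r big1 ?addr0 // => j.
by rewrite -val_eqE /= => /negbTE->; rewrite left_span_f0 mul0r.
Qed.

Lemma left_span_mulr s s' y : (forall x, x \in s -> left_span s' (x * y)) ->
  forall x, left_span s x -> left_span s' (x * y).
Proof.
move=> sy _ [a ->]; rewrite mulr_suml; apply: left_span_sum => i.
by rewrite -mulrA; apply/left_spanM/sy/mem_nth.
Qed.

Lemma left_span_sub s s' x : {subset s <= s'} -> left_span s x -> left_span s' x.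
Proof.
move=> ss' sx; rewrite -[x]mulr1; apply: left_span_mulr sx => y ys.
by rewrite mulr1; apply/left_span_mem/ss'.
Qed.

End LeftSpan.

(** * Spanning sets of the Clifford and Sergeev algebras *)

Section CliffordSpan.
Variables (K : pzRingType) (n : nat).
Local Notation A := (palg (cliff K n)).
Local Notation cg := (pgen (P := cliff K n)).

Lemma cliff_gen_sq (i : 'I_n) : cg i * cg i = -1.
Proof.
rewrite palg_mulE -scaleN1r -palg_scalE; apply/pclsP.
by apply: cong_rel; exact: cliff_sq.
Qed.

Lemma cliff_gen_anti (i j : 'I_n) :
  i != j -> cg i * cg j = - (cg j * cg i).
Proof.
move=> ij; rewrite -scaleN1r !palg_mulE palg_scaleE; apply/pclsP.
by apply: cong_rel; exact: cliff_anti.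
Qed.

Definition cliff_scalar (a : K) : A := a *: (1 : A).

Let fD : {morph cliff_scalar : a b / a + b}.
Proof. by move=> a b; exact: scalerDl. Qed.
Let fM : {morph cliff_scalar : a b / a * b}.
Proof.
by move=> a b; rewrite /cliff_scalar -palg_scalerAl mul1r scalerA.
Qed.
Let f1 : cliff_scalar 1 = 1.
Proof. exact: scale1r. Qed.

Definition cliff_gen (i : nat) : A :=
  if insub i is Some j then cg j else 0.

Fixpoint cliff_words (k : nat) : seq A :=
  if k is k'.+1 then
    cliff_words k' ++ [seq w * cliff_gen k' | w <- cliff_words k']
  else [:: 1].

Lemma mem1_cliff_words k : 1 \in cliff_words k.
Proof. by elim: k => [|k IHk] /=; rewrite ?mem_head ?mem_cat ?IHk. Qed.

Lemma cliff_words_span (k j : nat) x : (k <= n)%N -> (j < k)%N ->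
  left_span cliff_scalar (cliff_words k) x ->
  left_span cliff_scalar (cliff_words k) (x * cliff_gen j).
Proof.
move=> + + kx; elim: k j x kx => // k IHk j x kx klt jk.
have genE i (ilt : (i < n)%N) : cliff_gen i = cg (Ordinal ilt).
  by rewrite /cliff_gen insubT.
have jlt : (j < n)%N by lia.
apply: left_span_mulr kx => // {}x; rewrite /= mem_cat => /orP[xk|/mapP[w wk ->]].
  have [->|jk'] := eqVneq j k.
    apply: left_span_mem => //; rewrite mem_cat; apply/orP; right.
    by apply/mapP; exists x.
  apply: (left_span_sub fD fM f1 (s := cliff_words k)).
    by move=> y yk; rewrite mem_cat yk.
  by apply: IHk; [apply: left_span_mem|lia|lia].
have [->|jk'] := eqVneq j k.
  rewrite -mulrA (genE k klt) cliff_gen_sq mulrN1; apply: left_spanN => //.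
  by apply: left_span_mem; rewrite // mem_cat wk.
rewrite -mulrA (genE k klt) (genE j jlt) cliff_gen_anti; last first.
  by rewrite -val_eqE eq_sym.
rewrite mulrN mulrA -!genE; apply: left_spanN => //.
apply: (left_span_mulr fD fM (s := cliff_words k)).
  move=> y yk; apply: left_span_mem => //; rewrite mem_cat.
  by apply/orP; right; apply/mapP; exists y.
by apply: IHk; [apply: left_span_mem|lia|lia].
Qed.

Lemma clifford_fin_gen : exists (D : nat) (g : 'I_D -> A),
  forall v, exists a : 'I_D -> K, v = \sum_i a i *: g i.
Proof.
exists (size (cliff_words n)), (fun i => (cliff_words n)`_i) => v.
suff [a ->] : left_span cliff_scalar (cliff_words n) v.
  exists (fun i => a i); apply: eq_bigr => i _.
  by rewrite /cliff_scalar -palg_scalerAl mul1r.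
elim/palg_rclosed: v => [|x y|a x|x g].
- by apply: left_span_mem => //; exact: mem1_cliff_words.
- exact: left_spanD.
- by move=> /(left_spanM fM a); rewrite /cliff_scalar -palg_scalerAl mul1r.
- by move=> /(cliff_words_span (leqnn n) (ltn_ord g)); rewrite /cliff_gen valK.
Qed.

End CliffordSpan.

Section SergeevSpan.
Variables (R : realType) (n : nat).
Local Notation C := (R[i]).
Local Notation S := (sergeev R n).
Local Notation A := (palg (cliff C n)).
Local Notation GP := (gtensor (spin C n) (cliff C n)).
Local Notation f := (clifford_in (R := R) (n := n)).
Local Notation t := (tgen R n).
Local Notation c := (cgen R n).

Lemma clifford_inD : {morph f : x y / x + y}.
Proof. exact: gtensor_inrD. Qed.
Lemma clifford_inM : {morph f : x y / x * y}.
Proof. exact: gtensor_inrM. Qed.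
Lemma clifford_in1 : f 1 = 1.
Proof. exact: gtensor_inr1. Qed.
Lemma clifford_in0 : f 0 = 0.
Proof. exact: left_span_f0 clifford_inD. Qed.
Lemma clifford_inN x : f (- x) = - f x.
Proof. exact: left_span_fN clifford_inD _. Qed.

Lemma clifford_in_gen (j : 'I_n) : f (pgen (P := cliff C n) j) = c j.
Proof. by rewrite /cgen valK; exact: gtensor_inrE. Qed.

Lemma tgenE a (alt : (a < n.-1)%N) : t a = pgen (P := GP) (inl (Ordinal alt)).
Proof. by rewrite /tgen insubT. Qed.
Lemma cgenE a (alt : (a < n)%N) : c a = pgen (P := GP) (inr (Ordinal alt)).
Proof. by rewrite /cgen insubT. Qed.

Lemma tgen_sq a : (a < n.-1)%N -> t a * t a = 1.
Proof.
move=> alt; rewrite (tgenE alt) palg_mulE; apply/pclsP/cong_rel.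
exact: (@gtensor_left _ (spin C n) (cliff C n) _ _ (spin_sq C (Ordinal alt))).
Qed.

Lemma tgen_braid a : (a.+1 < n.-1)%N ->
  t a * t a.+1 * t a = t a.+1 * t a * t a.+1.
Proof.
move=> alt; rewrite (tgenE alt) (tgenE (ltnW alt)) /pgen.
rewrite !(palg_mulE (Gen _) (Gen _)) !(palg_mulE (Mul _ _) (Gen _)).
apply/pclsP/cong_rel.
exact: (@gtensor_left _ (spin C n) (cliff C n) _ _
  (@spin_braid C n (Ordinal (ltnW alt)) (Ordinal alt) (erefl _))).
Qed.

Lemma tgen_anti a b : (a.+1 < b)%N || (b.+1 < a)%N -> t a * t b = - (t b * t a).
Proof.
move=> ab; have [alt|age] := ltnP a n.-1; last first.
  by rewrite /tgen insubF ?mul0r ?mulr0 ?oppr0 //; lia.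
have [blt|bge] := ltnP b n.-1; last first.
  by rewrite /tgen (insubF _ (x := b)) ?mul0r ?mulr0 ?oppr0 //; lia.
rewrite (tgenE alt) (tgenE blt) -scaleN1r !palg_mulE palg_scaleE.
apply/pclsP/cong_rel.
exact: (@gtensor_left _ (spin C n) (cliff C n) _ _
  (@spin_anti C n (Ordinal alt) (Ordinal blt) ab)).
Qed.

Lemma tgen_cgen a b : t a * c b = - (c b * t a).
Proof.
have [alt|age] := ltnP a n.-1; last first.
  by rewrite /tgen insubF ?mul0r ?mulr0 ?oppr0 //; lia.
have [blt|bge] := ltnP b n; last first.
  by rewrite /cgen insubF ?mul0r ?mulr0 ?oppr0 //; lia.
rewrite (tgenE alt) (cgenE blt) -scaleN1r !palg_mulE palg_scaleE.
by apply/pclsP/cong_rel; exact: gtensor_anti.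
Qed.

Definition tdown (k j : nat) : S := \prod_(i <- rev (index_iota j k)) t i.

Lemma tdownk k : tdown k k = 1.
Proof. by rewrite /tdown /index_iota subnn big_nil. Qed.

Lemma tdown_cat k j l : (j <= l <= k)%N -> tdown k j = tdown k l * tdown l j.
Proof.
move=> jlk; rewrite /tdown -big_cat -rev_cat /index_iota.
have -> : (k - j = (l - j) + (k - l))%N by lia.
by rewrite iotaD subnKC //; lia.
Qed.

Lemma tdownS k : tdown k.+1 k = t k.
Proof. by rewrite /tdown /index_iota subSnn big_seq1. Qed.

(** The sign is left unspecified, since the Clifford coefficients absorb it. *)
Lemma tdown_comm k j a : (j <= k)%N -> (a.+1 < j)%N || (k < a)%N ->
  exists e : bool, tdown k j * t a = (-1) ^+ e * (t a * tdown k j).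
Proof.
elim: k => [|k IHk] jk ajk.
  have -> : j = 0%N by lia.
  by exists false; rewrite tdownk mulr1 !mul1r.
have [->|jk'] := eqVneq j k.+1.
  by exists false; rewrite tdownk mulr1 !mul1r.
rewrite (@tdown_cat _ _ k) ?tdownS; last by lia.
have [||e IH] := IHk; [by lia| by lia|].
have tka : t k * t a = - (t a * t k) by apply: tgen_anti; lia.
exists (~~ e); rewrite -mulrA IH; case: e {IH};
  by rewrite /= ?mul1r ?mulN1r ?mulrN !mulrA tka ?mulNr ?opprK.
Qed.

(* Spin words t_w, along the coset representatives t_(k-1) ... t_j. *)
Fixpoint spin_words (k : nat) : seq S :=
  if k is k'.+1 then
    [seq w * tdown k' j | w <- spin_words k', j <- iota 0 k'.+1]
  else [:: 1].

Lemma spin_wordsP k x : reflect (exists w j,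
  [/\ w \in spin_words k, (j <= k)%N & x = w * tdown k j])
  (x \in spin_words k.+1).
Proof.
rewrite -[spin_words k.+1]/[seq w * tdown k j | w <- spin_words k, j <- iota 0 k.+1].
apply: (iffP allpairsP) => [[[w j] [wk]]|[w [j [wk jk ->]]]].
  by rewrite mem_iota => /= jk ->; exists w, j.
by exists (w, j); split=> //; rewrite mem_iota.
Qed.

Lemma size_spin_words k : size (spin_words k) = k`!.
Proof.
elim: k => // k IHk.
rewrite -[spin_words k.+1]/[seq w * tdown k j | w <- spin_words k, j <- iota 0 k.+1].
by rewrite size_allpairs size_iota IHk factS mulnC.
Qed.

Lemma mem1_spin_words k : 1 \in spin_words k.
Proof.
elim: k => [|k IHk]; first exact: mem_head.
by apply/spin_wordsP; exists 1, k; rewrite tdownk mulr1.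
Qed.

Lemma mulr_tdown_span k j x : (j <= k)%N ->
  left_span f (spin_words k) x -> left_span f (spin_words k.+1) (x * tdown k j).
Proof.
move=> jk; apply: left_span_mulr; [exact: clifford_inD|exact: clifford_inM|].
move=> y yk.
apply: left_span_mem; [exact: clifford_inD|exact: clifford_in1|].
by apply/spin_wordsP; exists y, j.
Qed.

Let spanN := left_spanN clifford_inD clifford_inM clifford_in1.
Let span_sign := left_span_sign clifford_inD clifford_inM clifford_in1.
Let span_mem := left_span_mem clifford_inD clifford_in1.

(** Against the coset representative t_(k-1) ... t_j, the letter t_a commutes up to sign if a + 1 <
    j, lengthens it if j = a + 1, shortens it if j = a, and for j < a passes through by a braid
    relation, coming out on the left as t_(a-1) up to sign. *)
Lemma spin_words_span k a x : (k <= n)%N -> (a.+1 < k)%N ->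
  left_span f (spin_words k) x -> left_span f (spin_words k) (x * t a).
Proof.
move=> + + kx; elim: k a x kx => // k IHk a x kx klt ak.
apply: left_span_mulr kx; [exact: clifford_inD|exact: clifford_inM|].
move=> {}x /spin_wordsP[w [j [wk jk ->{x}]]]; rewrite -mulrA.
have wspan : left_span f (spin_words k) w by exact: span_mem.
have [aj|jle] := ltnP a.+1 j.
  have [||e ->] := @tdown_comm k j a; [exact: jk|by rewrite aj|].
  rewrite mulrA commr_sign -mulrA [w * _]mulrA; apply: span_sign.
  by apply: mulr_tdown_span => //; apply: IHk => //; lia.
have [->|ja] := eqVneq j a.+1.
  rewrite -tdownS -tdown_cat; last by lia.
  by apply: mulr_tdown_span => //; lia.
have [->|ja'] := eqVneq j a.
  rewrite (@tdown_cat _ _ a.+1) ?tdownS; last by lia.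
  by rewrite -mulrA tgen_sq ?mulr1; [apply: mulr_tdown_span => //|]; lia.
case: a => [|a] in ak jle ja ja' *; first by lia.
have aj : (j <= a)%N by lia.
have [||e eE] := @tdown_comm a j a.+1; [by []|by rewrite ltnSn orbT|].
have [||e' e'E] := @tdown_comm k a.+2 a; [by lia|by rewrite ltnSn|].
have D : tdown k j = tdown k a.+2 * (t a.+1 * t a) * tdown a j.
  rewrite (@tdown_cat k j a.+2); last by lia.
  rewrite (@tdown_cat a.+2 j a.+1); last by lia.
  by rewrite (@tdown_cat a.+1 j a) ?tdownS ?mulrA //; lia.
have -> : tdown k j * t a.+1 = (-1) ^+ (e (+) e') * (t a * tdown k j).
  rewrite {1}D -mulrA eE.
  have -> : tdown k a.+2 * (t a.+1 * t a) * ((-1) ^+ e * (t a.+1 * tdown a j)) =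
    (-1) ^+ e * (tdown k a.+2 * (t a.+1 * t a * t a.+1) * tdown a j).
    by rewrite !mulrA commr_sign !mulrA.
  rewrite -tgen_braid; last by lia.
  rewrite signr_addb -!mulrA; congr (_ * _); rewrite D !mulrA e'E.
  by rewrite !mulrA.
rewrite mulrA commr_sign -mulrA [w * _]mulrA; apply: span_sign.
by apply: mulr_tdown_span => //; apply: IHk => //; lia.
Qed.

Lemma spin_words_cgen k w b : w \in spin_words k ->
  exists e : bool, w * c b = (-1) ^+ e * (c b * w).
Proof.
have prod_cgen (x y : S) : (exists e : bool, x * c b = (-1) ^+ e * (c b * x)) ->
    (exists e : bool, y * c b = (-1) ^+ e * (c b * y)) ->
    exists e : bool, x * y * c b = (-1) ^+ e * (c b * (x * y)).
  move=> [e xe] [e' ye]; exists (e' (+) e).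
  by rewrite -mulrA ye !mulrA commr_sign -[_ * x * _]mulrA xe signr_addb !mulrA.
have one_cgen : exists e : bool, 1 * c b = (-1) ^+ e * (c b * 1).
  by exists false; rewrite !mul1r mulr1.
elim: k w => [|k IHk] w.
  by rewrite mem_seq1 => /eqP->.
move=> /spin_wordsP[{}w [j [wk _ ->]]]; apply: (prod_cgen); first exact: IHk.
rewrite /tdown; elim: (rev _) => [|a s IHs]; first by rewrite big_nil.
rewrite big_cons; apply: prod_cgen => //.
by exists true; rewrite tgen_cgen mulN1r.
Qed.

Lemma sergeev_span x : left_span f (spin_words n) x.
Proof.
elim/palg_rclosed: x => [|x y|a x|x [a|b]].
- exact/span_mem/mem1_spin_words.
- exact/left_spanD/clifford_inD.
- move=> /(left_spanM clifford_inM (a *: (1 : A))).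
  by rewrite [f _]gtensor_inrZ gtensor_inr1 -palg_scalerAl mul1r.
- have an : (a.+1 < n)%N by case: a => a /= alt; lia.
  by move=> /(spin_words_span (leqnn n) an); rewrite /tgen valK.
- have -> : pgen (P := GP) (inr b) = c b by rewrite /cgen valK.
  apply: left_span_mulr; [exact: clifford_inD|exact: clifford_inM|].
  move=> w wn; have [e ->] := spin_words_cgen b wn; apply: span_sign.
  rewrite -clifford_in_gen; apply: left_spanM; first exact: clifford_inM.
  exact: span_mem.
Qed.

End SergeevSpan.

(** * Clifford identities *)

Section Coefficients.
Variables (K : fieldType) (P : presentation K) (r : K).
Implicit Types c d e : palg P.

(** [tdiag] and [tswap] are the coefficients of v_F and v_(s_a F) in t_a v_F, with c, d for c_a,
    c_(a+1) and r for sqrt 2. The first is (d - c) / r times -((x + y) - (x - y) c d) / (x^2 - y^2),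
    the value that cancels v_F in phi_a v_F. *)
Definition tdiag c d (x y : K) : palg P :=
  (r / (x ^+ 2 - y ^+ 2)) *: (x *: c - y *: d).
Definition tswap c d (b : K) : palg P := (b / r) *: (d - c).

Hypotheses (r2 : r ^+ 2 = 2) (r_neq0 : r != 0).

Lemma tswap_sandwich c d b c' d' b' e :
  tswap c d b * e * tswap c' d' b' = (b * b' / 2) *: ((d - c) * e * (d' - c')).
Proof.
rewrite /tswap -!palg_scalerAl -!palg_scalerAr !scalerA -r2.
by congr (_ *: _); field.
Qed.

End Coefficients.

Section Clifford2.
Variables (K : fieldType) (P : presentation K).
Local Notation A := (palg P).
Variables c d : A.
Hypotheses (cc : c * c = -1) (dd : d * d = -1) (dc : d * c = - (c * d)).

(** Coordinates with respect to 1, c, d, c d: an identity follows from four scalar ones, left to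
    [field]. *)
Definition cl2 (a0 a1 a2 a3 : K) : A :=
  a0 *: (1 : A) + a1 *: c + a2 *: d + a3 *: (c * d).

Lemma cl2D a0 a1 a2 a3 b0 b1 b2 b3 :
  cl2 a0 a1 a2 a3 + cl2 b0 b1 b2 b3 = cl2 (a0 + b0) (a1 + b1) (a2 + b2) (a3 + b3).
Proof.
rewrite /cl2 !scalerDl !addrA.
by rewrite [LHS](ACl (1*5*2*6*3*7*4*8)).
Qed.

Lemma cl2Z k a0 a1 a2 a3 :
  k *: cl2 a0 a1 a2 a3 = cl2 (k * a0) (k * a1) (k * a2) (k * a3).
Proof. by rewrite /cl2 !scalerDr !scalerA. Qed.

Lemma cl2Mc a0 a1 a2 a3 : cl2 a0 a1 a2 a3 * c = cl2 (- a1) a0 a3 (- a2).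
Proof.
rewrite /cl2 !mulrDl -!palg_scalerAl mul1r cc dc -mulrA dc mulrN mulrA cc.
by rewrite mulN1r opprK !scalerN !scaleNr [LHS](ACl (2*1*4*3)).
Qed.

Lemma cl2Md a0 a1 a2 a3 : cl2 a0 a1 a2 a3 * d = cl2 (- a2) (- a3) a0 a1.
Proof.
rewrite /cl2 !mulrDl -!palg_scalerAl mul1r dd -mulrA dd mulrN1.
by rewrite !scalerN !scaleNr [LHS](ACl (3*4*1*2)).
Qed.

Definition cl2v a b : A := a *: c + b *: d.

Lemma cl2Mv a0 a1 a2 a3 a b : cl2 a0 a1 a2 a3 * cl2v a b =
  cl2 (- (a * a1) - b * a2) (a * a0 - b * a3) (a * a3 + b * a0) (b * a1 - a * a2).
Proof.
rewrite /cl2v mulrDr -!palg_scalerAr cl2Mc cl2Md !cl2Z cl2D.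
by rewrite !mulrN [- (a * a2) + _]addrC.
Qed.

Lemma cl2vE a b : cl2v a b = cl2 0 a b 0.
Proof. by rewrite /cl2 !scale0r add0r addr0. Qed.

Lemma cl21 : (1 : A) = cl2 1 0 0 0.
Proof. by rewrite /cl2 !scale0r !addr0 scale1r. Qed.

Lemma cl2vMv a b a' b' :
  cl2v a b * cl2v a' b' = cl2 (- (a' * a) - b' * b) 0 0 (b' * a - a' * b).
Proof.
by rewrite [in X in X * _]cl2vE cl2Mv !mulr0 !subr0 !add0r.
Qed.

Lemma cl2vMc a b : cl2v a b * c = cl2 (- a) 0 0 (- b).
Proof. by rewrite cl2vE cl2Mc. Qed.

Variable r : K.
Hypothesis r2 : r ^+ 2 = 2.
Hypothesis two_neq0 : (2 : K) != 0.

Variables x y b : K.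
Hypothesis xy : x ^+ 2 - y ^+ 2 != 0.
Hypothesis b2 : b * b = 1 - 2 * (x ^+ 2 + y ^+ 2) / (x ^+ 2 - y ^+ 2) ^+ 2.

Let r_neq0 : r != 0.
Proof. by apply: contraNneq two_neq0 => r0; rewrite -r2 r0 expr0n. Qed.

Let yx : y ^+ 2 - x ^+ 2 != 0.
Proof. by rewrite -opprB oppr_eq0. Qed.

Lemma cl2_diag u v : u *: c - v *: d = cl2v u (- v).
Proof. by rewrite /cl2v scaleNr. Qed.

Lemma cl2_swap : d - c = cl2v (-1) 1.
Proof. by rewrite /cl2v scaleN1r scale1r addrC. Qed.

Lemma d_cl2 : d = cl2 0 0 1 0.
Proof. by rewrite /cl2 !scale0r !add0r addr0 scale1r. Qed.

(** The coefficient of v_F in t_a^2 v_F = v_F. The sign on the right arises as the second t_a passes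
    an odd coefficient; this identity dictates the value of b^2. *)
Lemma tdiag_sq :
  tdiag r c d x y * tdiag r c d x y + tswap r c d b * tswap r c d b = -1.
Proof.
rewrite -[X in X * tswap _ _ _ _]mulr1 tswap_sandwich // mulr1 b2.
rewrite /tdiag -!palg_scalerAl -!palg_scalerAr !scalerA.
rewrite cl2_diag cl2_swap !cl2vMv !cl2Z cl2D cl21 -scaleN1r cl2Z.
congr cl2; (try field: r2); rewrite ?xy ?two_neq0 //.
Qed.

Lemma tdiag_tswap :
  tdiag r c d x y * tswap r c d b + tswap r c d b * tdiag r c d y x = 0.
Proof.
rewrite /tdiag /tswap -!palg_scalerAl -!palg_scalerAr !scalerA.
rewrite !cl2_diag cl2_swap !cl2vMv !cl2Z cl2D -(scale0r (1 : A)) cl21 cl2Z.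
congr cl2; field; rewrite ?xy ?yx ?r_neq0 //.
Qed.

(** With m_a v_F = (x / r) c v_F, this and [jm_step_swap] are the two coordinates of m_(a+1) v_F =
    (t_a - t_a m_a t_a) v_F. *)
Lemma jm_step_diag : tdiag r c d x y + (x / r) *: (tdiag r c d x y * c * tdiag r c d x y)
  + (y / r) *: (tswap r c d b * c * tswap r c d b) = (y / r) *: d.
Proof.
rewrite tswap_sandwich // b2.
rewrite /tdiag -!palg_scalerAl -!palg_scalerAr !scalerA.
rewrite cl2_diag cl2_swap !cl2vMc !cl2Mv !cl2vE !cl2Z !cl2D d_cl2 cl2Z.
congr cl2; field: r2; rewrite ?xy ?r_neq0 ?two_neq0 //.
Qed.

Lemma jm_step_swap : tswap r c d b
  + (x / r) *: (tdiag r c d x y * c * tswap r c d b)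
  + (y / r) *: (tswap r c d b * c * tdiag r c d y x) = 0.
Proof.
rewrite /tdiag /tswap -!palg_scalerAl -!palg_scalerAr !scalerA.
rewrite !cl2_diag !cl2_swap !cl2vMc !cl2Mv !cl2vE !cl2Z !cl2D.
rewrite -(scale0r (1 : A)) cl21 cl2Z.
congr cl2; field: r2; rewrite ?xy ?yx ?r_neq0 ?two_neq0 //.
Qed.

Lemma intertwiner_diag :
  (x ^+ 2 - y ^+ 2) *: (- r^-1 *: ((d - c) * tdiag r c d x y))
  + (x + y) *: (1 : A) - (x - y) *: (c * d) = 0.
Proof.
rewrite /tdiag -palg_scalerAr !scalerA cl2_diag cl2_swap cl2vMv.
have -> : c * d = cl2 0 0 0 1 by rewrite /cl2 !scale0r !add0r scale1r.
rewrite -scaleNr cl21 !cl2Z !cl2D -(scale0r (1 : A)) cl21 cl2Z.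
congr cl2; field; rewrite ?xy ?yx ?r_neq0 ?two_neq0 //.
Qed.

Lemma intertwiner_swap : - r^-1 *: ((d - c) * tswap r c d b) = b *: (1 : A).
Proof.
rewrite /tswap -palg_scalerAr !scalerA cl2_swap cl2vMv cl21 !cl2Z.
congr cl2; field: r2; rewrite ?xy ?yx ?r_neq0 ?two_neq0 //.
Qed.

End Clifford2.

Section Clifford3.
Variables (K : fieldType) (P : presentation K).
Local Notation A := (palg P).
Variables c d e : A.
Hypotheses (cc : c * c = -1) (dd : d * d = -1) (ee : e * e = -1).
Hypotheses (dc : d * c = - (c * d)) (ec : e * c = - (c * e)).
Hypothesis (ed : e * d = - (d * e)).

Definition cl3 (a0 a1 a2 a3 a12 a13 a23 a123 : K) : A :=
  a0 *: (1 : A) + a1 *: c + a2 *: d + a3 *: e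
  + a12 *: (c * d) + a13 *: (c * e) + a23 *: (d * e) + a123 *: (c * d * e).

Lemma cl3D a0 a1 a2 a3 a12 a13 a23 a123 b0 b1 b2 b3 b12 b13 b23 b123 :
  cl3 a0 a1 a2 a3 a12 a13 a23 a123 + cl3 b0 b1 b2 b3 b12 b13 b23 b123 =
  cl3 (a0 + b0) (a1 + b1) (a2 + b2) (a3 + b3)
      (a12 + b12) (a13 + b13) (a23 + b23) (a123 + b123).
Proof.
rewrite /cl3 !scalerDl !addrA.
by rewrite [LHS](ACl (1*9*2*10*3*11*4*12*5*13*6*14*7*15*8*16)).
Qed.

Lemma cl3Z k a0 a1 a2 a3 a12 a13 a23 a123 :
  k *: cl3 a0 a1 a2 a3 a12 a13 a23 a123 =
  cl3 (k * a0) (k * a1) (k * a2) (k * a3)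
      (k * a12) (k * a13) (k * a23) (k * a123).
Proof. by rewrite /cl3 !scalerDr !scalerA. Qed.

Lemma cl3Mc a0 a1 a2 a3 a12 a13 a23 a123 :
  cl3 a0 a1 a2 a3 a12 a13 a23 a123 * c =
  cl3 (- a1) a0 a12 a13 (- a2) (- a3) (- a123) a23.
Proof.
have cdc : c * d * c = d by rewrite -mulrA dc mulrN mulrA cc mulN1r opprK.
have cec : c * e * c = e by rewrite -mulrA ec mulrN mulrA cc mulN1r opprK.
have dec : d * e * c = c * d * e by rewrite -mulrA ec mulrN mulrA dc mulNr opprK.
have cdec : c * d * e * c = - (d * e).
  by rewrite -!mulrA [d * _]mulrA dec !mulrA cc !mulN1r mulNr.
rewrite /cl3 !mulrDl -!palg_scalerAl mul1r cc dc ec cdc cec dec cdec.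
by rewrite !scalerN !scaleNr [LHS](ACl (2*1*5*6*3*4*8*7)).
Qed.

Lemma cl3Md a0 a1 a2 a3 a12 a13 a23 a123 :
  cl3 a0 a1 a2 a3 a12 a13 a23 a123 * d =
  cl3 (- a2) (- a12) a0 a23 a1 a123 (- a3) (- a13).
Proof.
have cdd : c * d * d = - c by rewrite -mulrA dd mulrN1.
have ced : c * e * d = - (c * d * e) by rewrite -mulrA ed mulrN mulrA.
have ded : d * e * d = e by rewrite -mulrA ed mulrN mulrA dd mulN1r opprK.
have cded : c * d * e * d = c * e by rewrite -!mulrA [d * _]mulrA ded.
rewrite /cl3 !mulrDl -!palg_scalerAl mul1r dd ed cdd ced ded cded.
by rewrite !scalerN !scaleNr [LHS](ACl (3*5*1*7*2*8*4*6)).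
Qed.

Lemma cl3Me a0 a1 a2 a3 a12 a13 a23 a123 :
  cl3 a0 a1 a2 a3 a12 a13 a23 a123 * e =
  cl3 (- a3) (- a13) (- a23) a0 (- a123) a1 a2 a12.
Proof.
rewrite /cl3 !mulrDl -!palg_scalerAl mul1r ee -!(mulrA _ e e) ee !mulrN1.
by rewrite !scalerN !scaleNr [LHS](ACl (4*6*7*1*8*2*3*5)).
Qed.

Definition cl3v a1 a2 a3 : A := a1 *: c + a2 *: d + a3 *: e.

Lemma cl3Mv a0 a1 a2 a3 a12 a13 a23 a123 b1 b2 b3 :
  cl3 a0 a1 a2 a3 a12 a13 a23 a123 * cl3v b1 b2 b3 =
  b1 *: cl3 (- a1) a0 a12 a13 (- a2) (- a3) (- a123) a23
  + b2 *: cl3 (- a2) (- a12) a0 a23 a1 a123 (- a3) (- a13)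
  + b3 *: cl3 (- a3) (- a13) (- a23) a0 (- a123) a1 a2 a12.
Proof. by rewrite /cl3v !mulrDr -!palg_scalerAr cl3Mc cl3Md cl3Me. Qed.

Lemma cl3vE a b g : cl3v a b g = cl3 0 a b g 0 0 0 0.
Proof. by rewrite /cl3 !scale0r add0r !addr0. Qed.

(* The product of three vectors, from u v + v u = - 2 (u . v). *)
Lemma cl3v3 a1 a2 a3 b1 b2 b3 g1 g2 g3 :
  cl3v a1 a2 a3 * cl3v b1 b2 b3 * cl3v g1 g2 g3 =
  let ab := a1 * b1 + a2 * b2 + a3 * b3 in
  let ag := a1 * g1 + a2 * g2 + a3 * g3 in
  let bg := b1 * g1 + b2 * g2 + b3 * g3 in
  cl3 0 (ag * b1 - ab * g1 - bg * a1) (ag * b2 - ab * g2 - bg * a2)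
    (ag * b3 - ab * g3 - bg * a3) 0 0 0
    (a1 * (b2 * g3 - b3 * g2) - a2 * (b1 * g3 - b3 * g1)
     + a3 * (b1 * g2 - b2 * g1)).
Proof.
rewrite (cl3vE a1) cl3Mv !cl3Z !cl3D cl3Mv !cl3Z !cl3D /=.
by congr cl3; ring.
Qed.

Lemma cl3v_diag12 u v : u *: c - v *: d = cl3v u (- v) 0.
Proof. by rewrite /cl3v scale0r addr0 scaleNr. Qed.
Lemma cl3v_diag23 u v : u *: d - v *: e = cl3v 0 u (- v).
Proof. by rewrite /cl3v scale0r add0r scaleNr. Qed.
Lemma cl3v_swap12 : d - c = cl3v (-1) 1 0.
Proof. by rewrite /cl3v scale0r addr0 scaleN1r scale1r addrC. Qed.
Lemma cl3v_swap23 : e - d = cl3v 0 (-1) 1.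
Proof. by rewrite /cl3v scale0r add0r scaleN1r scale1r addrC. Qed.

Variable r : K.
Hypothesis r2 : r ^+ 2 = 2.
Hypothesis r_neq0 : r != 0.

Let two_neq0 : (2 : K) != 0.
Proof. by rewrite -r2 expf_neq0. Qed.

Let t12 := tdiag r c d.
Let t23 := tdiag r d e.
Let u12 := tswap r c d.
Let u23 := tswap r d e.

Let vE := (cl3v_diag12, cl3v_diag23, cl3v_swap12, cl3v_swap23).

Variables x y z a b g : K.
Hypotheses (xy : x ^+ 2 - y ^+ 2 != 0) (yz : y ^+ 2 - z ^+ 2 != 0).
Hypothesis a2 : a * a = 1 - 2 * (x ^+ 2 + y ^+ 2) / (x ^+ 2 - y ^+ 2) ^+ 2.
Hypothesis b2 : b * b = 1 - 2 * (y ^+ 2 + z ^+ 2) / (y ^+ 2 - z ^+ 2) ^+ 2.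

Let yx : y ^+ 2 - x ^+ 2 != 0.
Proof. by rewrite -opprB oppr_eq0. Qed.
Let zy : z ^+ 2 - y ^+ 2 != 0.
Proof. by rewrite -opprB oppr_eq0. Qed.

(** Let x, y, z be the contents of a, a + 1, a + 2 in F. Each of the six [braid_] lemmas compares
    the two sides of the braid relation on v_F at one permuted tableau; the suffix lists the
    contents there. Factors stand in the order of application, as coefficients accumulate on the
    right. *)
Lemma braid_zyx :
  u12 a * u23 g * u12 b = u23 b * u12 g * u23 a.
Proof.
rewrite /u12 /u23 /tswap -!palg_scalerAl -!palg_scalerAr -!palg_scalerAl !scalerA !vE.
by rewrite !cl3v3 !cl3Z; congr cl3; field.
Qed.

Section Generic.
Hypothesis xz : x ^+ 2 - z ^+ 2 != 0.

Let zx : z ^+ 2 - x ^+ 2 != 0.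
Proof. by rewrite -opprB oppr_eq0. Qed.

Let side := (xy, yz, xz, yx, zy, zx, r_neq0, two_neq0).

Lemma braid_xyz : t12 x y * t23 y z * t12 x y + u12 a * t23 x z * u12 a
  = t23 y z * t12 x y * t23 y z + u23 b * t12 x z * u23 b.
Proof.
rewrite (tswap_sandwich r2 r_neq0 c d a) (tswap_sandwich r2 r_neq0 d e b) a2 b2.
rewrite /t12 /t23 /tdiag -!palg_scalerAl -!palg_scalerAr -!palg_scalerAl !scalerA !vE.
rewrite !cl3v3 !cl3Z !cl3D; congr cl3; field: r2; rewrite ?side //.
Qed.

Lemma braid_yxz : t12 x y * t23 y z * u12 a + u12 a * t23 x z * t12 y x
  = t23 y z * u12 a * t23 x z.
Proof.
rewrite /u12 /t12 /t23 /tdiag /tswap.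
rewrite -!palg_scalerAl -!palg_scalerAr -!palg_scalerAl !scalerA !vE.
rewrite !cl3v3 !cl3Z !cl3D; congr cl3; field: r2; rewrite ?side //.
Qed.

Lemma braid_xzy : t12 x y * u23 b * t12 x z
  = t23 y z * t12 x y * u23 b + u23 b * t12 x z * t23 z y.
Proof.
rewrite /u23 /t12 /t23 /tdiag /tswap.
rewrite -!palg_scalerAl -!palg_scalerAr -!palg_scalerAl !scalerA !vE.
rewrite !cl3v3 !cl3Z !cl3D; congr cl3; field: r2; rewrite ?side //.
Qed.

Lemma braid_yzx : u12 a * u23 g * t12 y z = t23 y z * u12 a * u23 g.
Proof.
rewrite /u12 /u23 /t12 /t23 /tdiag /tswap.
rewrite -!palg_scalerAl -!palg_scalerAr -!palg_scalerAl !scalerA !vE.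
rewrite !cl3v3 !cl3Z; congr cl3; field: r2; rewrite ?side //.
Qed.

Lemma braid_zxy : t12 x y * u23 b * u12 g = u23 b * u12 g * t23 x y.
Proof.
rewrite /u12 /u23 /t12 /t23 /tdiag /tswap.
rewrite -!palg_scalerAl -!palg_scalerAr -!palg_scalerAl !scalerA !vE.
rewrite !cl3v3 !cl3Z; congr cl3; field: r2; rewrite ?side //.
Qed.

End Generic.
End Clifford3.

(** * Contents *)

Section Scalars.
Variable R : realType.
Local Notation C := (R[i]).

Lemma csqrt_sq k : csqrt R k ^+ 2 = k%:R.
Proof. by rewrite /csqrt -rmorphXn /= sqr_sqrtr ?ler0n // rmorph_nat. Qed.

Lemma csqrt2_neq0 : csqrt R 2 != 0.
Proof. by rewrite -sqrf_eq0 csqrt_sq pnatr_eq0. Qed.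

Lemma content_sq n (e : box n * bool) :
  content R e ^+ 2 = ((e.1.2 - e.1.1) * (e.1.2 - e.1.1).+1)%:R.
Proof. by rewrite /content exprMn sqrr_sign mul1r csqrt_sq. Qed.

(* The coefficient of v_(s_a T) in s_a v_T for the signed contents x, y of
   a, a + 1. *)
Definition swap_coef (x y : C) : C :=
  sqrtC (1 - 2 * (x ^+ 2 + y ^+ 2) / (x ^+ 2 - y ^+ 2) ^+ 2).

Lemma swap_coefC x y : swap_coef x y = swap_coef y x.
Proof.
by rewrite /swap_coef [y ^+ 2 + _]addrC -[y ^+ 2 - _]opprB sqrrN.
Qed.

Lemma swap_coef_sq x y : swap_coef x y * swap_coef x y =
  1 - 2 * (x ^+ 2 + y ^+ 2) / (x ^+ 2 - y ^+ 2) ^+ 2.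
Proof. by rewrite -expr2 sqrtCK. Qed.

(** Here x^2 - y^2 = -2(s + 1) and 2(x^2 + y^2) = 4(s + 1)^2, so the radicand is 1 - 1. *)
Lemma swap_coef_adj x y (s : nat) :
    x ^+ 2 = (s * s.+1)%:R -> y ^+ 2 = (s.+1 * s.+2)%:R ->
  swap_coef x y = 0.
Proof.
move=> x2 y2; apply/eqP; rewrite sqrtC_eq0 x2 y2 subr_eq0; apply/eqP.
have s1 : (s.+1%:R : C) != 0 by rewrite pnatr_eq0.
have -> : ((s * s.+1)%:R : C) - (s.+1 * s.+2)%:R = - 2 * s.+1%:R.
  by rewrite !natrM -natr1 -(natr1 s.+1) -natr1; ring.
have -> : 2 * ((s * s.+1)%:R + (s.+1 * s.+2)%:R : C) = (- 2 * s.+1%:R) ^+ 2.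
  by rewrite !natrM -natr1 -(natr1 s.+1) -natr1; ring.
by rewrite divff // expf_neq0 // mulf_neq0 // oppr_eq0 pnatr_eq0.
Qed.

(** For k = s + u the number (x^2 - y^2)^2 - 2(x^2 + y^2) is (u^2 - 1)((2s + u + 1)^2 - 1), positive
    for u >= 2. *)
Lemma swap_coef_far x y (s k : nat) : (s.+1 < k)%N ->
    x ^+ 2 = (s * s.+1)%:R -> y ^+ 2 = (k * k.+1)%:R ->
  swap_coef x y != 0.
Proof.
move=> sk x2 y2; rewrite sqrtC_eq0 x2 y2 subr_eq0.
have D : ((s * s.+1)%:R : C) - (k * k.+1)%:R = - ((k - s)%:R * (s + k).+1%:R).
  rewrite natrB; last by lia.
  by rewrite -(natr1 (s + k)) natrD !natrM -!natr1; ring.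
rewrite D sqrrN -natrM -natrX -natrD -natrM.
have d_neq0 : ((((k - s) * (s + k).+1) ^ 2)%:R : C) != 0 by rewrite pnatr_eq0 expn_eq0 muln_eq0; lia.
apply/eqP => /esym/(congr1 ( *%R^~ (((k - s) * (s + k).+1) ^ 2)%:R)).
rewrite divfK // mul1r => /eqP; rewrite eqr_nat => /eqP.
have [u u2 ->] : exists2 u, (1 < u)%N & k = (s + u)%N by exists (k - s)%N; lia.
have -> : (s + u - s = u)%N by lia.
nia.
Qed.

End Scalars.

Section Contents.
Variables (R : realType) (n : nat) (la : strict_part n) (beta : {set box n}).
Local Notation C := (R[i]).
Implicit Types (T F : filling la) (b : cell la) (a : 'I_n.-1).

Definition cell_content b : C := content R (val b, val b \in beta).

(* The signed content of the entry k of F, or 0 if there is no such entry. *)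
Definition entry_content F (k : nat) : C :=
  if [pick b | F b == k :> nat] is Some b then cell_content b else 0.

Lemma cell_content_sq b :
  cell_content b ^+ 2 = (diagidx b * (diagidx b).+1)%:R.
Proof. exact: content_sq. Qed.

Lemma entry_contentE T b k : injective T -> T b = k :> nat ->
  entry_content T k = cell_content b.
Proof.
move=> T_inj Tb; rewrite /entry_content; case: pickP => [b' /eqP Tb'|/(_ b)].
  by congr cell_content; apply/T_inj/ord_inj; rewrite Tb.
by rewrite Tb eqxx.
Qed.

Lemma entry_content_swL a F : entry_content (tab_swap a F) a = entry_content F a.+1.
Proof.
rewrite /entry_content; under eq_pick => b.
  rewrite tab_swapE (_ : (_ == _) = (F b == a.+1 :> nat)); first by over.
  by case: ifP; [|case: ifP]; lia.
by [].
Qed.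

Lemma entry_content_swR a F : entry_content (tab_swap a F) a.+1 = entry_content F a.
Proof. by rewrite -{2}[F](tab_swapK a) entry_content_swL. Qed.

Lemma entry_content_sw a F (k : nat) : k <> a -> k <> a.+1 ->
  entry_content (tab_swap a F) k = entry_content F k.
Proof.
move=> ka ka1; rewrite /entry_content; under eq_pick => b.
  rewrite tab_swapE (_ : (_ == _) = (F b == k :> nat)); first by over.
  by case: ifP; [|case: ifP]; lia.
by [].
Qed.

Lemma std_entry T k : is_standard T -> (k < n)%N -> exists b, T b = k :> nat.
Proof.
by move=> Tstd klt; have [b Tb] := std_surj Tstd (Ordinal klt); exists b; rewrite Tb.
Qed.

Lemma std_consecutive T a : is_standard T ->
  exists b b', [/\ T b = a :> nat, T b' = a.+1 :> nat,
    entry_content T a = cell_content b & entry_content T a.+1 = cell_content b'].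
Proof.
move=> Tstd; have alt : (a.+1 < n)%N by have := ltn_ord a; lia.
have [b Tb] := std_entry Tstd (ltnW alt); have [b' Tb'] := std_entry Tstd alt.
exists b, b'; split; rewrite // ?(entry_contentE _ Tb) ?(entry_contentE _ Tb') //;
  exact: std_inj.
Qed.

Lemma content_sq_eq (s k : nat) :
  (((s * s.+1)%:R : C) == (k * k.+1)%:R) = (s == k).
Proof. by rewrite eqr_nat; apply/eqP/eqP => [|->//]; nia. Qed.

Lemma std_content_neq T a : is_standard T ->
  entry_content T a ^+ 2 - entry_content T a.+1 ^+ 2 != 0.
Proof.
move=> Tstd; have [b [b' [Tb Tb' -> ->]]] := std_consecutive a Tstd.
rewrite !cell_content_sq subr_eq0 content_sq_eq.
by apply: (consecutive_diag_neq Tstd); rewrite Tb.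
Qed.

Definition entry_swap_coef a F : C :=
  swap_coef (entry_content F a) (entry_content F a.+1).

Lemma entry_swap_coef_sw a F :
  entry_swap_coef a (tab_swap a F) = entry_swap_coef a F.
Proof.
by rewrite /entry_swap_coef entry_content_swL entry_content_swR swap_coefC.
Qed.

(** For consecutive entries, neighbouring diagonals, comparable cells and nonstandard s_a T are
    equivalent. Hence setting v_F = 0 for nonstandard F is consistent. *)
Lemma entry_swap_coef_eq0 T a : is_standard T ->
  (entry_swap_coef a T == 0) = ~~ is_standard (tab_swap a T).
Proof.
move=> Tstd; rewrite /entry_swap_coef.
have [b [b' [Tb Tb' -> ->]]] := std_consecutive a Tstd.
have Tbb' : T b' = (T b).+1 :> nat by rewrite Tb.
have sq := cell_content_sq b; have sq' := cell_content_sq b'.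
rewrite (tab_swap_std Tstd Tbb' Tb) negbK.
apply/idP/idP => [/eqP coef0|/(consecutive_diag Tstd Tbb')]; last first.
  case=> e; rewrite e in sq sq'; first by rewrite (swap_coef_adj sq sq').
  by rewrite swap_coefC (swap_coef_adj sq' sq).
apply: contraT => /(consecutive_nle_diag Tstd Tbb')[] lt; move/eqP: coef0.
  by rewrite (negbTE (swap_coef_far lt sq sq')).
by rewrite swap_coefC (negbTE (swap_coef_far lt sq' sq)).
Qed.

Lemma std_three_content T a a' : a' = a.+1 :> nat -> is_standard T ->
    entry_content T a ^+ 2 - entry_content T a.+2 ^+ 2 = 0 ->
  [/\ entry_content T a = 0, entry_content T a.+1 ^+ 2 = 2 &
      entry_content T a.+2 = 0].
Proof.
move=> aa' Tstd.
have [b1 [b2 [T1 T2 -> ->]]] := std_consecutive a Tstd.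
have [b2' [b3 [_ T3 _]]] := std_consecutive a' Tstd.
rewrite aa' in T3 *; move=> ->.
have sq1 := cell_content_sq b1; have sq3 := cell_content_sq b3.
rewrite sq1 sq3 => /eqP; rewrite subr_eq0 content_sq_eq => /eqP e13.
have [||d1 d2] := three_on_diag Tstd (b1 := b1) (b2 := b2) (b3 := b3) _ _ e13.
- by rewrite T1 T2.
- by rewrite T2 T3.
rewrite -e13 d1 in sq3; rewrite d1 in sq1; rewrite cell_content_sq d2.
by split=> //; apply/eqP; rewrite -sqrf_eq0 ?sq1 ?sq3 mul0n.
Qed.

End Contents.

(** * The seminormal modules *)

Section Grading.
Variables (K : pzRingType) (n : nat).
Local Notation A := (palg (cliff K n)).

Definition parity_term (g : gens (cliff K n)) : term K (gens (cliff K n)) :=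
  Mul (Scal (-1)) (Gen g).

Definition parity : A -> A := palg_subst parity_term.

Lemma parity_genE g : pcls (P := cliff K n) (parity_term g) = - pgen g.
Proof. by rewrite -palg_scaleE scaleN1r. Qed.

Lemma parity_rels s t : rels (p := cliff K n) s t ->
  cong (P := cliff K n) (term_subst parity_term s) (term_subst parity_term t).
Proof.
case=> [i|i j ij]; apply/pclsP.
  rewrite -[LHS]/(pcls (Mul (parity_term i) (parity_term i))) -palg_mulE.
  rewrite parity_genE mulrNN cliff_gen_sq.
  by rewrite [RHS]palg_scalE scaleN1r.
rewrite -[LHS]/(pcls (Mul (parity_term i) (parity_term j))).
rewrite -(palg_mulE (parity_term i)).
rewrite -[RHS]/(pcls (Mul (Scal (-1)) (Mul (parity_term j) (parity_term i)))).
rewrite -[RHS]palg_scaleE -(palg_mulE (parity_term j)) !parity_genE.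
rewrite !mulrNN scaleN1r.
exact: cliff_gen_anti.
Qed.

Lemma parityD : {morph parity : x y / x + y}.
Proof. exact: palg_substD parity_rels. Qed.
Lemma parityM : {morph parity : x y / x * y}.
Proof. exact: palg_substM parity_rels. Qed.
Lemma parityZ a x : parity (a *: x) = a *: parity x.
Proof. exact: palg_substZ parity_rels _ _. Qed.
Lemma parity1 : parity 1 = 1.
Proof. exact: palg_subst1 parity_rels. Qed.
Lemma parity0 : parity 0 = 0.
Proof. by rewrite -(scale0r (1 : A)) parityZ !scale0r. Qed.
Lemma parityN x : parity (- x) = - parity x.
Proof. by rewrite -!scaleN1r parityZ. Qed.
Lemma parity_gen i : parity (cliff_gen K n i) = - cliff_gen K n i.
Proof.
rewrite /cliff_gen; case: insub => [j|]; last by rewrite parity0 oppr0.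
by rewrite [LHS](palg_subst_gen parity_rels) parity_genE.
Qed.

Lemma parityK : involutive parity.
Proof.
elim/palg_ind=> [g|a|x y IHx IHy|x y IHx IHy].
- have := parity_gen g; rewrite /cliff_gen valK => gE.
  by rewrite gE parityN gE opprK.
- by rewrite !parityZ !parity1.
- by rewrite !parityD IHx IHy.
- by rewrite !parityM IHx IHy.
Qed.

End Grading.

Section TermGradingField.
Variables (K : fieldType) (n : nat) (r : K).
Local Notation c := (cliff_gen K n).

Lemma cliff_gen_nat_sq i : (i < n)%N -> c i * c i = -1.
Proof. by move=> ilt; rewrite /cliff_gen insubT cliff_gen_sq. Qed.

Lemma cliff_gen_nat_anti i j : i <> j -> c i * c j = - (c j * c i).
Proof.
move=> /eqP ij; rewrite /cliff_gen.
case: insubP => [i' _ i'E|_]; last by rewrite mul0r mulr0 oppr0.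
case: insubP => [j' _ j'E|_]; last by rewrite mul0r mulr0 oppr0.
by apply: cliff_gen_anti; rewrite -val_eqE /= i'E j'E.
Qed.

Lemma parity_tdiag i j x y :
  parity (tdiag r (c i) (c j) x y) = - tdiag r (c i) (c j) x y.
Proof.
rewrite /tdiag parityZ parityD parityN !parityZ !parity_gen.
by rewrite !scalerN -opprD scalerN.
Qed.

Lemma parity_tswap i j b :
  parity (tswap r (c i) (c j) b) = - tswap r (c i) (c j) b.
Proof. by rewrite /tswap parityZ parityD parityN !parity_gen -opprD scalerN. Qed.

End TermGradingField.

(** The eight terms of each side grouped by six tableaux: two at F; two against one at s_a F; one
    against two at s_(a+1) F; one at each of the other three. *)
Lemma braid_sum (V : zmodType) (a1 a2 a3 a4 b1 b2 b3 b4 : V)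
    (c1 c2 c3 c4 d1 d2 d3 d4 : V) :
    a1 + b2 = c1 + d2 -> a2 + b1 = c3 -> a3 = c2 + d1 ->
    b3 = c4 -> a4 = d3 -> b4 = d4 ->
  a1 + a2 + (a3 + a4) + (b1 + b2 + (b3 + b4)) =
  c1 + c2 + (c3 + c4) + (d1 + d2 + (d3 + d4)).
Proof.
move=> E1 <- -> -> -> ->; rewrite !addrA.
rewrite [LHS](ACl ((1*7)*3*2*6*8*4*5*9)) /= E1.
by rewrite [RHS](ACl ((1*7)*2*3*4*5*6*8*9)).
Qed.

Section Module.
Variables (R : realType) (n : nat) (la : strict_part n) (beta : {set box n}).
Local Notation C := (R[i]).
Local Notation A := (palg (cliff C n)).
Local Notation c := (cliff_gen C n).
Local Notation r := (csqrt R 2).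
Local Notation x_ := (entry_content R beta).
Implicit Types (F : filling la) (a : 'I_n.-1).

Definition seminormal := {ffun stableau la -> A}.
HB.instance Definition _ := GRing.Lmodule.on seminormal.
Local Notation M := seminormal.

Definition lact (x : A) (m : M) : M := [ffun T => x * m T].

Lemma lactDr x : {morph lact x : m m' / m + m'}.
Proof. by move=> m m'; apply/ffunP => T; rewrite !ffunE mulrDr. Qed.
Lemma lactDl x y m : lact (x + y) m = lact x m + lact y m.
Proof. by apply/ffunP => T; rewrite !ffunE mulrDl. Qed.
Lemma lactA x y m : lact x (lact y m) = lact (x * y) m.
Proof. by apply/ffunP => T; rewrite !ffunE mulrA. Qed.
Lemma lact1 m : lact 1 m = m.
Proof. by apply/ffunP => T; rewrite !ffunE mul1r. Qed.
Lemma lact0 m : lact 0 m = 0.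
Proof. by apply/ffunP => T; rewrite !ffunE mul0r. Qed.
Lemma lactr0 x : lact x 0 = 0.
Proof. by apply/ffunP => T; rewrite !ffunE mulr0. Qed.
Lemma lactN x m : lact (- x) m = - lact x m.
Proof. by apply/ffunP => T; rewrite !ffunE mulNr. Qed.
Lemma lactrN x m : lact x (- m) = - lact x m.
Proof. by apply/ffunP => T; rewrite !ffunE mulrN. Qed.
Lemma lactZ k x m : lact (k *: x) m = k *: lact x m.
Proof. by apply/ffunP => T; rewrite !ffunE -palg_scalerAl. Qed.
Lemma lactZr k x m : lact x (k *: m) = k *: lact x m.
Proof. by apply/ffunP => T; rewrite !ffunE -palg_scalerAr. Qed.
Lemma lact_sum I (s : seq I) x (G : I -> M) :
  lact x (\sum_(i <- s) G i) = \sum_(i <- s) lact x (G i).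
Proof. by elim/big_rec2: _ => [|i m m' _ <-]; rewrite ?lactr0 ?lactDr. Qed.

(* The basis vector of the tableau F; it is 0 when F is not standard. *)
Definition bvec F : M := [ffun T => (val T == F)%:R].

Lemma bvec_nstd F : ~~ is_standard F -> bvec F = 0.
Proof.
move=> nstd; apply/ffunP => T; rewrite !ffunE; case: eqP => // TF.
by rewrite -TF (valP T) in nstd.
Qed.

Lemma seminormalE (m : M) : m = \sum_T lact (m T) (bvec (val T)).
Proof.
apply/ffunP => T; rewrite sum_ffunE (bigD1 T) //= !ffunE eqxx mulr1.
rewrite big1 ?addr0 // => T' T'T.
by rewrite !ffunE eq_sym (inj_eq val_inj) (negbTE T'T) mulr0.
Qed.

Definition diag_part a F : A := tdiag r (c a) (c a.+1) (x_ F a) (x_ F a.+1).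
Definition swap_part a F : A := tswap r (c a) (c a.+1) (entry_swap_coef R beta a F).

(* t_a v_F: the coefficients of s_a v_F are forced by phi_a v_F being a multiple
   of v_(s_a F), and t_a = 2^(-1/2) s_a (c_a - c_(a+1)). *)
Definition tvec a F : M :=
  lact (diag_part a F) (bvec F) + lact (swap_part a F) (bvec (tab_swap a F)).

(* As t_a anticommutes with all the c_b, it is semilinear for the parity. *)
Definition spin_op a (m : M) : M := \sum_T lact (parity (m T)) (tvec a (val T)).
Definition cliff_op (i : 'I_n) (m : M) : M := lact (pgen (P := cliff C n) i) m.

Lemma spin_opD a : {morph spin_op a : m m' / m + m'}.
Proof.
move=> m m'; rewrite /spin_op -big_split; apply: eq_bigr => T _ /=.
by rewrite ffunE parityD lactDl.
Qed.

Lemma spin_opZ a k m : spin_op a (k *: m) = k *: spin_op a m.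
Proof.
rewrite /spin_op scaler_sumr; apply: eq_bigr => T _.
by rewrite ffunE parityZ lactZ.
Qed.

Lemma spin_op0 a : spin_op a 0 = 0.
Proof. by rewrite -(scale0r (0 : M)) spin_opZ !scale0r. Qed.

Lemma spin_op_sum a I (s : seq I) (G : I -> M) :
  spin_op a (\sum_(i <- s) G i) = \sum_(i <- s) spin_op a (G i).
Proof.
by elim/big_rec2: _ => [|i m m' _ <-]; rewrite ?spin_op0 ?spin_opD.
Qed.

Lemma spin_op_lact a x m : spin_op a (lact x m) = lact (parity x) (spin_op a m).
Proof.
rewrite /spin_op lact_sum; apply: eq_bigr => T _.
by rewrite ffunE parityM lactA.
Qed.

Lemma swap_part0 a F : entry_swap_coef R beta a F = 0 -> swap_part a F = 0.
Proof. by rewrite /swap_part /tswap => ->; rewrite mul0r scale0r. Qed.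

(* Also for F not standard: both sides are then 0. *)
Lemma spin_op_bvec a F : spin_op a (bvec F) = tvec a F.
Proof.
have [Fstd|Fnstd] := boolP (is_standard F).
  rewrite /spin_op (bigD1 (Sub F Fstd)) //= big1 => [|T TF].
    by rewrite ffunE eqxx parity1 lact1 addr0.
  by rewrite ffunE -val_eqE /= in TF *; rewrite (negbTE TF) parity0 lact0.
rewrite /tvec bvec_nstd // lactr0 add0r spin_op0.
have [swstd|nstd] := boolP (is_standard (tab_swap a F)); last first.
  by rewrite bvec_nstd // lactr0.
rewrite swap_part0 ?lact0 //; apply/eqP; rewrite -entry_swap_coef_sw.
by rewrite entry_swap_coef_eq0 // tab_swapK.
Qed.

Lemma parity_diag_part a F : parity (diag_part a F) = - diag_part a F.
Proof. exact: parity_tdiag. Qed.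
Lemma parity_swap_part a F : parity (swap_part a F) = - swap_part a F.
Proof. exact: parity_tswap. Qed.

Lemma spin_op_lact_bvec a x F : spin_op a (lact x (bvec F)) =
  lact (parity x * diag_part a F) (bvec F)
  + lact (parity x * swap_part a F) (bvec (tab_swap a F)).
Proof. by rewrite spin_op_lact spin_op_bvec /tvec lactDr !lactA. Qed.

Lemma swap_part_sw a F : swap_part a (tab_swap a F) = swap_part a F.
Proof. by rewrite /swap_part entry_swap_coef_sw. Qed.

Lemma diag_part_sw a F :
  diag_part a (tab_swap a F) = tdiag r (c a) (c a.+1) (x_ F a.+1) (x_ F a).
Proof. by rewrite /diag_part entry_content_swL entry_content_swR. Qed.

Let r2 : r ^+ 2 = 2 := csqrt_sq R 2.
Let two_neq0 : (2 : C) != 0.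
Proof. by rewrite pnatr_eq0. Qed.

Section Rank2.
Variable a : 'I_n.-1.
Lemma adj_lt : (a.+1 < n)%N.
Proof. by have := ltn_ord a; lia. Qed.
Lemma cliff_lo_sq : c a * c a = -1.
Proof. exact/cliff_gen_nat_sq/ltnW/adj_lt. Qed.
Lemma cliff_hi_sq : c a.+1 * c a.+1 = -1.
Proof. exact/cliff_gen_nat_sq/adj_lt. Qed.
Lemma cliff_hi_lo : c a.+1 * c a = - (c a * c a.+1).
Proof. by apply: cliff_gen_nat_anti; lia. Qed.
End Rank2.

Lemma spin_op_sq a (m : M) : spin_op a (spin_op a m) = m.
Proof.
rewrite [m]seminormalE !spin_op_sum; apply: eq_bigr => T _.
rewrite !spin_op_lact parityK; congr lact; set F := val T.
have Fstd : is_standard F by exact: valP.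
rewrite spin_op_bvec /tvec spin_opD !spin_op_lact_bvec parity_diag_part parity_swap_part.
rewrite tab_swapK swap_part_sw diag_part_sw [X in _ + X = _]addrC addrACA -!lactDl.
rewrite !mulNr -!opprD.
have xy := std_content_neq R beta a Fstd.
have b2 := swap_coef_sq (x_ F a) (x_ F a.+1).
rewrite (tdiag_sq (cliff_lo_sq a) (cliff_hi_sq a) (cliff_hi_lo a) r2 two_neq0 xy b2).
rewrite (tdiag_tswap (cliff_lo_sq a) (cliff_hi_sq a) (cliff_hi_lo a) r2 two_neq0 _ xy).
by rewrite opprK lact1 oppr0 lact0 addr0.
Qed.

Lemma swap_part_far a a' F : (a.+1 < a')%N || (a'.+1 < a)%N ->
  swap_part a (tab_swap a' F) = swap_part a F.
Proof.
move=> far; rewrite /swap_part /entry_swap_coef.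
by rewrite !(entry_content_sw R beta (a := a')) //; lia.
Qed.

Lemma diag_part_far a a' F : (a.+1 < a')%N || (a'.+1 < a)%N ->
  diag_part a (tab_swap a' F) = diag_part a F.
Proof.
move=> far; rewrite /diag_part.
by rewrite !(entry_content_sw R beta (a := a')) //; lia.
Qed.

Lemma palg_anti_scaleD (u v w : A) k l : u * w = - (w * u) -> v * w = - (w * v) ->
  (k *: u + l *: v) * w = - (w * (k *: u + l *: v)).
Proof.
move=> uw vw; rewrite mulrDl mulrDr -!palg_scalerAl -!palg_scalerAr uw vw.
by rewrite !scalerN opprD.
Qed.

(** Combinations of disjoint pairs of Clifford generators anticommute, the source of the sign in t_a
    t_b = - t_b t_a. *)
Lemma far_anti a a' (u u' : A) : (a.+1 < a')%N || (a'.+1 < a)%N ->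
    (exists k l, u = k *: c a + l *: c a.+1) ->
    (exists k l, u' = k *: c a' + l *: c a'.+1) -> u * u' = - (u' * u).
Proof.
move=> far [k [l ->]] [k' [l' ->]].
apply: palg_anti_scaleD; apply: (canRL opprK); apply/esym;
  apply: palg_anti_scaleD; apply: cliff_gen_nat_anti; lia.
Qed.

Lemma diag_partE a F : exists k l, diag_part a F = k *: c a + l *: c a.+1.
Proof.
rewrite /diag_part /tdiag; eexists; eexists.
by rewrite scalerDr -scaleNr !scalerA.
Qed.

Lemma swap_partE a F : exists k l, swap_part a F = k *: c a + l *: c a.+1.
Proof.
rewrite /swap_part /tswap; eexists; eexists.
by rewrite scalerDr scalerN -scaleNr addrC.
Qed.

Lemma spin_op_anti a a' (m : M) : (a.+1 < a')%N || (a'.+1 < a)%N ->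
  spin_op a (spin_op a' m) = - spin_op a' (spin_op a m).
Proof.
move=> far; have far' : (a'.+1 < a)%N || (a.+1 < a')%N by rewrite orbC.
rewrite [m]seminormalE !spin_op_sum -sumrN; apply: eq_bigr => T _.
rewrite !spin_op_lact -lactN parityK; set F := val T.
rewrite !spin_op_bvec /tvec !spin_opD !spin_op_lact_bvec.
rewrite !parity_diag_part !parity_swap_part !mulNr.
rewrite (swap_part_far F far) (swap_part_far F far').
rewrite (diag_part_far F far) (diag_part_far F far') (tab_swap_comm F far).
rewrite (far_anti far' (diag_partE a' F) (diag_partE a F)).
rewrite (far_anti far' (diag_partE a' F) (swap_partE a F)).
rewrite (far_anti far' (swap_partE a' F) (diag_partE a F)).
rewrite (far_anti far' (swap_partE a' F) (swap_partE a F)).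
rewrite lactN -lactrN; congr lact; rewrite !lactN.
move: (lact (diag_part a F * diag_part a' F) _) => A1.
move: (lact (diag_part a F * swap_part a' F) _) => A2.
move: (lact (swap_part a F * diag_part a' F) _) => A3.
move: (lact (swap_part a F * swap_part a' F) _) => A4.
by rewrite !opprD !opprK addrACA.
Qed.

Lemma cliff_op_spin_op i a (m : M) : cliff_op i (spin_op a m) = - spin_op a (cliff_op i m).
Proof.
rewrite /cliff_op spin_op_lact; have := parity_gen C n i; rewrite /cliff_gen valK => ->.
by rewrite lactN opprK.
Qed.

(** With content 0 at both ends only the middle generator survives, so t_a and t_(a+1) have the same
    diagonal coefficient. *)
Lemma tdiag0 (u v w : A) y : tdiag r u v 0 y = tdiag r v w y 0.
Proof.
rewrite /tdiag !scale0r subr0 sub0r scalerN -scaleNr -mulrN -invrN.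
by rewrite expr0n opprB.
Qed.

Lemma spin_op_braid a a' (m : M) : a' = a.+1 :> nat ->
  spin_op a (spin_op a' (spin_op a m)) = spin_op a' (spin_op a (spin_op a' m)).
Proof.
move=> aa'; rewrite [m]seminormalE !spin_op_sum; apply: eq_bigr => T _.
rewrite !spin_op_lact; congr lact; set F := val T.
have Fstd : is_standard F by exact: valP.
pose x := x_ F a; pose y := x_ F a.+1; pose z := x_ F a.+2.
have na1 : a.+2 <> a by lia.
have na2 : a.+2 <> a.+1 by lia.
have na0 : (a : nat) <> a.+1 by lia.
have na3 : (a : nat) <> a.+2 by lia.
rewrite !spin_op_bvec /tvec !spin_opD !spin_op_lact_bvec !parity_diag_part !parity_swap_part.
rewrite !spin_opD !spin_op_lact_bvec !parityM !parityN !parity_diag_part.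
rewrite !parity_swap_part !opprK !mulrN !mulNr !tab_swapK (tab_swap_braid F aa').
have P2 : diag_part a' F = tdiag r (c a.+1) (c a.+2) y z.
  by rewrite /diag_part aa'.
have Q2 : swap_part a' F = tswap r (c a.+1) (c a.+2) (swap_coef y z).
  by rewrite /swap_part /entry_swap_coef aa'.
have x1 : x_ (tab_swap a F) a.+1 = x by exact: entry_content_swR.
have z1 : x_ (tab_swap a F) a.+2 = z by exact: entry_content_sw.
have x2 : x_ (tab_swap a' F) a = x by apply: entry_content_sw; rewrite aa'.
have z2 : x_ (tab_swap a' F) a.+1 = z by rewrite -aa' entry_content_swL aa'.
have y3 : x_ (tab_swap a' (tab_swap a F)) a = y.
  by rewrite entry_content_sw ?aa' // entry_content_swL.
have z3 : x_ (tab_swap a' (tab_swap a F)) a.+1 = z by rewrite -aa' entry_content_swL aa'.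
have x4 : x_ (tab_swap a (tab_swap a' F)) a.+1 = x by rewrite entry_content_swR x2.
have y4 : x_ (tab_swap a (tab_swap a' F)) a.+2 = y.
  by rewrite entry_content_sw // -aa' entry_content_swR aa'.
rewrite !swap_part_sw !diag_part_sw P2 Q2.
rewrite -[diag_part a F]/(tdiag r (c a) (c a.+1) x y).
rewrite -[swap_part a F]/(tswap r (c a) (c a.+1) (swap_coef x y)).
rewrite /diag_part /swap_part /entry_swap_coef aa' x1 z1 x2 z2 y3 z3 x4 y4 -/x -/y -/z.
have c11 := cliff_lo_sq a; have c22 := cliff_hi_sq a.
have c21 := cliff_hi_lo a.
have := cliff_hi_lo a'; have := cliff_hi_sq a'; rewrite aa' => c33 c32.
have c31 : c a.+2 * c a = - (c a * c a.+2) by exact: cliff_gen_nat_anti.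
have xy : x ^+ 2 - y ^+ 2 != 0 := std_content_neq R beta a Fstd.
have yz : y ^+ 2 - z ^+ 2 != 0.
  by have := std_content_neq R beta a' Fstd; rewrite aa'.
have bxy := swap_coef_sq x y; have byz := swap_coef_sq y z.
have lact_eq2 u1 u2 u3 u4 (v : M) : u1 + u2 = u3 + u4 ->
    lact (- u1) v + lact (- u2) v = lact (- u3) v + lact (- u4) v.
  by move=> e; rewrite -!lactDl -!opprD e.
have lact_eq1 u1 u2 u3 (v : M) : u1 + u2 = u3 ->
    lact (- u1) v + lact (- u2) v = lact (- u3) v.
  by move=> e; rewrite -lactDl -opprD e.
(* If a and a + 2 share a diagonal, the swap coefficients of both generators vanish on F, and by
   [tdiag0] both sides become the same cube. *)
have [xz0|xz] := eqVneq (x ^+ 2 - z ^+ 2) 0.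
  have [x0 y22 z0] := std_three_content aa' Fstd xz0.
  have xyz0 : swap_coef 0 y = 0.
    by apply: (@swap_coef_adj R _ _ 0); rewrite ?expr0n.
  have yx0 : swap_coef y 0 = 0 by rewrite swap_coefC.
  have ts0 u v : tswap r u v 0 = 0 by rewrite /tswap mul0r scale0r.
  rewrite /x /z x0 z0 xyz0 yx0 !ts0 !(mulr0, mul0r) !oppr0 !lact0 !(addr0, add0r).
  by rewrite (tdiag0 (c a) (c a.+1) (c a.+2)).
apply: braid_sum.
- apply: lact_eq2.
  exact: (braid_xyz c11 c22 c33 c21 c31 c32 r2 (csqrt2_neq0 R) xy yz bxy byz xz).
- apply: lact_eq1.
  exact: (braid_yxz c11 c22 c33 c21 c31 c32 r2 (csqrt2_neq0 R) _ xy yz xz).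
- apply/esym/lact_eq1/esym.
  exact: (braid_xzy c11 c22 c33 c21 c31 c32 r2 (csqrt2_neq0 R) _ xy yz xz).
- congr lact; congr (- _).
  exact: (braid_yzx c11 c22 c33 c21 c31 c32 r2 (csqrt2_neq0 R) _ _ yz).
- congr lact; congr (- _).
  exact: (braid_zxy c11 c22 c33 c21 c31 c32 r2 (csqrt2_neq0 R) _ _ xy).
- congr lact; congr (- _).
  exact: (braid_zyx c11 c22 c33 c21 c31 c32 (csqrt2_neq0 R)).
Qed.

End Module.

(** * The Sergeev superalgebra acting on the seminormal modules *)

Section SergeevAction.
Variables (R : realType) (n : nat) (la : strict_part n) (beta : {set box n}).
Local Notation C := (R[i]).
Local Notation A := (palg (cliff C n)).
Local Notation GP := (gtensor (spin C n) (cliff C n)).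
Local Notation S := (sergeev R n).
Local Notation M := (seminormal R la).
Local Notation c := (cliff_gen C n).
Local Notation r := (csqrt R 2).
Local Notation x_ := (entry_content R beta).
Local Notation V := (bvec R).
Implicit Types (F : filling la) (a : 'I_n.-1).

Definition sergeev_op (g : gens GP) : M -> M :=
  match g with inl a => spin_op beta a | inr i => cliff_op (la := la) i end.

Definition sact : S -> M -> M := palg_act sergeev_op.

Lemma sergeev_opD g : {morph sergeev_op g : m m' / m + m'}.
Proof. by case: g => [a|i]; [exact: spin_opD|exact: lactDr]. Qed.
Lemma sergeev_opZ g k m : sergeev_op g (k *: m) = k *: sergeev_op g m.
Proof. by case: g => [a|i]; [exact: spin_opZ|exact: lactZr]. Qed.

Lemma seminormal_scaleC (k l : C) (m : M) : k *: (l *: m) = l *: (k *: m).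
Proof. by rewrite !scalerA mulrC. Qed.

Lemma sergeev_op_rels s t : rels (p := GP) s t ->
  term_act sergeev_op s =1 term_act sergeev_op t.
Proof.
case=> [{}s {}t [a|a b ab|a b ab]|{}s {}t [i|i j ij]|a i] m /=.
- by rewrite spin_op_sq scale1r.
- exact: spin_op_braid.
- by rewrite (spin_op_anti _ _ ab) scaleN1r.
- by rewrite /cliff_op lactA cliff_gen_sq lactN lact1 scaleN1r.
- by rewrite /cliff_op !lactA (cliff_gen_anti _ ij) lactN scaleN1r.
- by rewrite cliff_op_spin_op scalerN scaleN1r opprK.
Qed.

Let opD := sergeev_opD.
Let opZ := sergeev_opZ.
Let scC := seminormal_scaleC.
Let orl := sergeev_op_rels.

Lemma sact1 m : sact 1 m = m.
Proof. exact: (palg_act1 opD opZ scC orl). Qed.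
Lemma sactDl (x y : S) m : sact (x + y) m = sact x m + sact y m.
Proof. exact: (palg_actDl opD opZ scC orl). Qed.
Lemma sactM (x y : S) m : sact (x * y) m = sact x (sact y m).
Proof. exact: (palg_actM opD opZ scC orl). Qed.
Lemma sactZl k (x : S) m : sact (k *: x) m = k *: sact x m.
Proof. exact: (palg_actZl opD opZ scC orl). Qed.
Lemma sactDr x : {morph sact x : m m' / m + m'}.
Proof. exact: (palg_actDr opD). Qed.
Lemma sactZr x k m : sact x (k *: m) = k *: sact x m.
Proof. exact: (palg_actZr opZ scC). Qed.
Lemma sact0 m : sact 0 m = 0.
Proof. by rewrite -(scale0r (1 : S)) sactZl scale0r. Qed.
Lemma sactr0 x : sact x 0 = 0.
Proof. by rewrite -(scale0r (0 : M)) sactZr !scale0r. Qed.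
Lemma sactN x m : sact (- x) m = - sact x m.
Proof. by rewrite -(scaleN1r x) sactZl scaleN1r. Qed.
Lemma sact_sum I (s : seq I) (P : pred I) (f : I -> S) m :
  sact (\sum_(i <- s | P i) f i) m = \sum_(i <- s | P i) sact (f i) m.
Proof. by elim/big_rec2: _ => [|i y x _ <-]; rewrite ?sact0 ?sactDl. Qed.

Lemma sact_clifford (x : A) m : sact (clifford_in (R := R) x) m = lact x m.
Proof.
elim/palg_ind: x m => [g|k|x y IHx IHy|x y IHx IHy] m.
- by rewrite [clifford_in _]gtensor_inrE; exact: (palg_act_gen opD opZ scC orl).
- rewrite [clifford_in _]gtensor_inrZ gtensor_inr1 sactZl sact1.
  by rewrite lactZ lact1.
- by rewrite clifford_inD sactDl IHx IHy lactDl.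
- by rewrite clifford_inM sactM IHx IHy lactA.
Qed.

Lemma sact_cgen i m : sact (cgen R n i) m = lact (c i) m.
Proof.
rewrite /cgen /cliff_gen; case: insubP => [j _ _|_]; last by rewrite sact0 lact0.
exact: (palg_act_gen opD opZ scC orl).
Qed.

Lemma sact_tgen a m : sact (tgen R n a) m = spin_op beta a m.
Proof. by rewrite /tgen valK; exact: (palg_act_gen opD opZ scC orl). Qed.

End SergeevAction.

(** * Action of the Jucys-Murphy elements and of the intertwiners *)

Section JucysMurphyRecursion.
Variables (R : realType) (n : nat).

Lemma ttransp_adj a : ttransp R n a a.+1 = tgen R n a.
Proof. by rewrite /ttransp subSnn subnn /index_iota subnn !big_nil !mul1r mulr1. Qed.

Lemma ttranspS b a : (b < a)%N ->
  ttransp R n b a.+1 = - (tgen R n a * ttransp R n b a * tgen R n a).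
Proof.
move=> ba; rewrite /ttransp.
have -> : index_iota b.+1 a.+1 = rcons (index_iota b.+1 a) a.
  rewrite /index_iota -cats1 (_ : a.+1 - b.+1 = (a - b.+1) + 1)%N; last by lia.
  by rewrite iotaD subnKC.
have -> : (a.+1 - b - 1 = (a - b - 1).+1)%N by lia.
rewrite rev_rcons big_cons big_rcons /= exprS mulN1r !mulrA !mulNr.
by rewrite commr_sign.
Qed.

(** Conjugation by t_a with a minus sign turns t_(b,a) into t_(b,a+1); the remaining summand of
    m_(a+1) is t_a itself. *)
Lemma meltS a : melt R n a.+1 =
  tgen R n a - tgen R n a * melt R n a * tgen R n a.
Proof.
rewrite /melt big_nat_recr //= ttransp_adj addrC; congr (_ + _).
rewrite mulr_sumr mulr_suml -sumrN; apply: eq_big_nat => b /andP[_ ba].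
exact: ttranspS.
Qed.

End JucysMurphyRecursion.

Lemma jm_sum (V : zmodType) (p q a b c d : V) :
  p + q - (- a - b + (- c - d)) = p + a + d + (q + b + c).
Proof.
by rewrite !opprD !opprK !addrA [LHS](ACl (1*3*6*2*4*5)).
Qed.

Section JucysMurphyAction.
Variables (R : realType) (n : nat) (la : strict_part n) (beta : {set box n}).
Local Notation C := (R[i]).
Local Notation A := (palg (cliff C n)).
Local Notation S := (sergeev R n).
Local Notation M := (seminormal R la).
Local Notation c := (cliff_gen C n).
Local Notation r := (csqrt R 2).
Local Notation x_ := (entry_content R beta).
Local Notation V := (bvec R).
Local Notation act := (sact (la := la) beta).
Implicit Types (F : filling la) (a : 'I_n.-1).

Let r2 : r ^+ 2 = 2 := csqrt_sq R 2.
Let r_neq0 := csqrt2_neq0 R.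
Let two_neq0 : (2 : C) != 0.
Proof. by rewrite pnatr_eq0. Qed.

Lemma sact_tgen_lact k (u : A) m :
  act (tgen R n k) (lact u m) = lact (parity u) (act (tgen R n k) m).
Proof.
have [klt|kge] := ltnP k n.-1; last by rewrite /tgen insubF ?sact0 ?lactr0 //; lia.
by rewrite -[k]/(val (Ordinal klt)) !sact_tgen spin_op_lact.
Qed.

Lemma sact_melt_lact k (u : A) m :
  act (melt R n k) (lact u m) = lact (parity u) (act (melt R n k) m).
Proof.
elim: k u m => [|k IHk] u m; first by rewrite /melt big_geq // !sact0 lactr0.
rewrite meltS !sactDl !sactN !sactM sact_tgen_lact IHk sact_tgen_lact.
by rewrite parityK lactDr lactrN.
Qed.

Lemma std_content0 F : (0 < n)%N -> is_standard F -> x_ F 0 = 0.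
Proof.
move=> n_gt0 Fstd; have [b Fb] := std_entry Fstd n_gt0.
rewrite (entry_contentE _ _ (std_inj Fstd) Fb).
apply/eqP; rewrite -sqrf_eq0 cell_content_sq.
suff -> : diagidx b = 0%N by [].
have [//|d_gt0] := posnP (diagidx b).
have [b' [row' col']] := cell_below (leqnn (cell_row b)) (leqnn _) (row_le_col b).
have neq : b' != b by apply/eqP => e; rewrite /diagidx -e row' col' subnn in d_gt0.
have le : cell_le b' b by rewrite /cell_le row' col' leqnn row_le_col.
by have := std_lt Fstd le neq; rewrite Fb.
Qed.

(** The induction runs on the odd m_k, which has a recursion; x_k = sqrt 2 m_k c_k and c_k^2 = -1
    translate the result into an eigenvalue of x_k. *)
Lemma sact_melt_bvec k F : (k < n)%N ->
  act (melt R n k) (V F) = (x_ F k / r) *: lact (c k) (V F).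
Proof.
elim: k F => [|k IHk] F klt.
  rewrite /melt big_geq // sact0.
  have [Fstd|nstd] := boolP (is_standard F); last by rewrite bvec_nstd // lactr0 scaler0.
  by rewrite std_content0 // mul0r scale0r.
have [Fstd|nstd] := boolP (is_standard F); last first.
  by rewrite bvec_nstd // lactr0 scaler0 sactr0.
have alt : (k < n.-1)%N by lia.
pose a := Ordinal alt; rewrite meltS sactDl sactN !sactM -[k]/(val a).
rewrite !sact_tgen spin_op_bvec /tvec sactDr !sact_melt_lact /= !IHk; [|lia..].
rewrite parity_diag_part parity_swap_part spin_opD.
rewrite !(lactZr, spin_opZ, lactA) -!lactZ !spin_op_lact_bvec.
rewrite -[k]/(val a) entry_content_swL !parityM !parityN parity_diag_part.
rewrite parity_swap_part parity_gen !opprK !mulrN !mulNr !lactN.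
rewrite tab_swapK swap_part_sw diag_part_sw !scalerDr !scalerN -!lactZ.
have xy := std_content_neq R beta a Fstd.
have b2 := swap_coef_sq (x_ F a) (x_ F a.+1).
have c11 := cliff_lo_sq R a; have c22 := cliff_hi_sq R a.
have c21 := cliff_hi_lo R a.
have jd := jm_step_diag c11 c22 c21 r2 two_neq0 xy b2.
have js := jm_step_swap c11 c22 c21 r2 two_neq0 (entry_swap_coef R beta a F) xy.
rewrite -[RHS]addr0 -(lact0 (V (tab_swap a F))) -js -jd !lactDl.
exact: jm_sum.
Qed.

Lemma sact_jm_bvec k F : (k < n)%N -> act (jm R n k) (V F) = x_ F k *: V F.
Proof.
move=> klt; rewrite /jm sactZl sactM sact_cgen sact_melt_lact parity_gen.
rewrite sact_melt_bvec // lactN lactZr lactA cliff_gen_nat_sq // lactN lact1.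
by rewrite !scalerN opprK scalerA mulrCA divff ?mulr1.
Qed.

Lemma sact_selt_bvec a F : act (selt R n a) (V F) =
  lact (- r^-1 *: ((c a.+1 - c a) * diag_part R beta a F)) (V F)
  + lact (- r^-1 *: ((c a.+1 - c a) * swap_part R beta a F)) (V (tab_swap a F)).
Proof.
rewrite /selt sactZl sactM sactDl sactN !sact_cgen sact_tgen.
rewrite -lactN -lactDl spin_op_lact_bvec parityD parityN !parity_gen -opprD.
by rewrite !mulNr !lactN !scaleNr !lactN !lactZ scalerDr !scalerN.
Qed.

Definition intertwiner_coef a F : C :=
  (x_ F a ^+ 2 - x_ F a.+1 ^+ 2) * entry_swap_coef R beta a F.

Lemma sact_intertwiner_bvec a F :
  act (intertwiner R n a) (V F) = intertwiner_coef a F *: V (tab_swap a F).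
Proof.
(* For nonstandard [F] the left side is 0; if s_a F is standard, the coefficient on the right
   vanishes by [entry_swap_coef_eq0]. *)
have [Fstd|nstd] := boolP (is_standard F); last first.
  rewrite bvec_nstd // sactr0.
  have [swstd|nstd'] := boolP (is_standard (tab_swap a F)); last first.
    by rewrite bvec_nstd // scaler0.
  rewrite /intertwiner_coef -entry_swap_coef_sw.
  by have := entry_swap_coef_eq0 R beta a swstd; rewrite tab_swapK nstd => /eqP->; rewrite mulr0 scale0r.
have alt : (a.+1 < n)%N by [have := ltn_ord a; lia]; have alt' := ltnW alt.
have xy := std_content_neq R beta a Fstd.
have c11 := cliff_lo_sq R a; have c22 := cliff_hi_sq R a.
have c21 := cliff_hi_lo R a.
have idiag := intertwiner_diag c11 c22 c21 r2 two_neq0 xy.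
have iswap := intertwiner_swap c11 c22 c21 r2 two_neq0 (entry_swap_coef R beta a F).
rewrite /intertwiner !sactDl sactN !sactM sactDl sactN !sactDl sactN.
rewrite !expr2 !sactM !(sactZr, sact_jm_bvec) //.
rewrite !scalerA -!scalerBl -!expr2 !sactZr !sact_cgen sact_selt_bvec iswap.
rewrite (lactZ (entry_swap_coef R beta a F)) lact1 lactA scalerDr scalerA -/(intertwiner_coef a F).
have := congr1 (fun u => lact u (V F)) idiag.
rewrite 2!lactDl lactN lact0 (lactZ (_ ^+ 2 - _)).
rewrite (lactZ (_ + _)) (lactZ (x_ F a - _)) lact1.
move: (lact (- r^-1 *: _) _) (lact (c a * _) _) => u v e.
rewrite -[RHS]add0r -e scalerDl !addrA.
by rewrite [LHS](ACl (1*3*4*5*2)).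
Qed.

Lemma intertwiner_coef_neq0 a F : is_standard F -> is_standard (tab_swap a F) ->
  intertwiner_coef a F != 0.
Proof.
move=> Fstd swstd; rewrite mulf_neq0 ?std_content_neq //.
by rewrite entry_swap_coef_eq0 // swstd.
Qed.

End JucysMurphyAction.

(** * Action of the idempotents *)

Section Addable.
Variables (R : realType) (n : nat).
Implicit Types (D : {set box n}) (b : box n) (e : box n * bool).

Lemma addable_diag D b : addable D b -> (b.1 <= b.2)%N.
Proof.
by rewrite /addable is_shiftedE => /andP[_ idD]; apply: ideal_diag idD (setU11 _ _).
Qed.

(** On a common diagonal, the upper box lies in the ideal got by adding the lower one; not being in
    D, it coincides with it. *)
Lemma addable_diag_inj D b b' : addable D b -> addable D b' ->
  (b.2 - b.1 = b'.2 - b'.1)%N -> b = b'.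
Proof.
move=> add add' e; have d := addable_diag add; have d' := addable_diag add'.
wlog le : b b' add add' e d d' / (b.1 <= b'.1)%N.
  move=> wl; have [le|/ltnW le] := leqP b.1 b'.1; first exact: wl.
  by apply/esym; apply: wl.
have := add'; rewrite /addable is_shiftedE => /andP[_ idD'].
have le2 : (b.2 <= b'.2)%N by lia.
have : b \in b' |: D.
  exact: ideal_closed idD' (setU11 _ _) d le le2.
rewrite in_setU1 => /orP[/eqP//|bD].
by have := add; rewrite /addable bD.
Qed.

(** The square of the content determines the diagonal, hence the addable box; the sign determines
    the bar. It is lost only for content 0, on the diagonal, where bars are excluded. *)
Lemma content_inj D e e' : possible_entry D e -> possible_entry D e' ->
  content R e = content R e' -> e = e'.
Proof.
case: e e' => [b s] [b' s'] /andP[/= add bar] /andP[/= add' bar'] E.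
have sqE : (b.2 - b.1 = b'.2 - b'.1)%N.
  have := congr1 (fun x => x ^+ 2) E; rewrite !content_sq /= => /eqP.
  by rewrite content_sq_eq => /eqP.
have eb := addable_diag_inj add add' sqE; subst b'.
congr pair; have d := addable_diag add.
have [diag|ndiag] := boolP (on_diagonal b).
  by rewrite diag /= in bar bar'; case: s s' bar bar' {E} => [] [].
have d_gt0 : (0 < b.2 - b.1)%N.
  rewrite subn_gt0 ltn_neqAle d andbT.
  by apply: contra ndiag => /eqP/val_inj diag; apply/eqP.
move: E; rewrite /content /=; set k := ((b.2 - b.1) * _)%N.
have k_neq0 : csqrt R k != 0.
  by rewrite -sqrf_eq0 csqrt_sq pnatr_eq0 /k; lia.
move/(mulIf k_neq0) => E; case: s s' {bar bar'} E => [] [] //=; rewrite expr0 expr1.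
  by move/eqP; rewrite eqNr oner_eq0.
by move/esym/eqP; rewrite eqNr oner_eq0.
Qed.

End Addable.

Section Idempotent.
Variables (R : realType) (n : nat).

Lemma mem_shape_below (la : strict_part n) (T : filling la) m b :
  (val b \in shape_below T m) = (T b < m)%N.
Proof.
apply/imsetP/idP => [[b' + /val_inj->]|Tb]; first by rewrite inE.
by exists b; rewrite ?inE.
Qed.

Lemma shape_below_ideal (la : strict_part n) (T : filling la) m :
  is_standard T -> ideal (shape_below T m).
Proof.
move=> Tstd; apply/idealP => _ /imsetP[b + ->]; rewrite inE => Tb.
split=> [|b' diag' /andP[le1 le2]]; first exact: (row_le_col b).
have [d [d1 d2]] := cell_below diag' le1 le2.
have -> : b' = val d by apply: box_eq.
rewrite mem_shape_below; have [->//|neq] := eqVneq d b.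
apply: ltn_trans Tb; apply: std_lt => //.
by rewrite /cell_le d1 d2 le1.
Qed.

Lemma shape_belowS (la : strict_part n) (T : filling la) m b :
  injective T -> T b = m :> nat ->
  shape_below T m.+1 = val b |: shape_below T m.
Proof.
move=> T_inj Tb; apply/setP => d; rewrite in_setU1.
apply/imsetP/orP => [[b' + ->]|[/eqP->|/imsetP[b' + ->]]].
- rewrite inE ltnS leq_eqVlt => /orP[/eqP Tb'|Tb'].
    by left; apply/eqP; congr val; apply/T_inj/ord_inj; rewrite Tb.
  by right; rewrite mem_shape_below.
- by exists b; rewrite // inE Tb.
- by rewrite inE => Tb'; exists b'; rewrite // inE ltnW.
Qed.

Lemma shape_below_addable (la : strict_part n) (T : filling la) m b :
  is_standard T -> T b = m :> nat -> addable (shape_below T m) (val b).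
Proof.
move=> Tstd Tb; rewrite /addable mem_shape_below Tb ltnn is_shiftedE.
by rewrite -(shape_belowS (std_inj Tstd) Tb) shape_below_ideal.
Qed.

Variables (la mu : strict_part n) (beta gamma : {set box n}).
Hypotheses (beta_off : forall b, b \in beta -> ~~ on_diagonal b)
  (gamma_off : forall b, b \in gamma -> ~~ on_diagonal b).
Variables (T : filling la) (U : filling mu).
Hypotheses (Tstd : is_standard T) (Ustd : is_standard U).
Local Notation act := (sact (la := mu) gamma).
Local Notation V := (bvec R).

(** The barred tableaux (T, beta) and (U, gamma) coincide below m. Their shapes may differ, so cells
    are compared as boxes. *)
Definition agree (m : nat) : Prop := forall b d,
  T b = U d :> nat -> (T b < m)%N ->
  val b = val d /\ (val b \in beta) = (val d \in gamma).

Lemma entry0_diag (nu : strict_part n) (F : filling nu) d : is_standard F ->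
  F d = 0 :> nat -> cell_row d = 0 /\ cell_col d = 0.
Proof.
move=> Fstd Fd; have [d0 [d1 d2]] := cell_below (leqnn 0) (leq0n (cell_row d)) (leq0n _).
have [<-//|neq] := eqVneq d0 d.
have le : cell_le d0 d by rewrite /cell_le d1 d2.
by have := std_lt Fstd le neq; rewrite Fd.
Qed.

Lemma agree1 : agree 1.
Proof.
move=> b d TU; rewrite ltnS leqn0 => /eqP Tb; rewrite Tb in TU.
have [b1 b2] := entry0_diag Tstd Tb; have [d1 d2] := entry0_diag Ustd (esym TU).
have e : val b = val d.
  by apply: box_eq; [exact: etrans b1 (esym d1)|exact: etrans b2 (esym d2)].
have diag : on_diagonal (val b).
  by apply/eqP/ord_inj; move: b1 b2; rewrite /cell_row /cell_col => -> ->.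
split=> //; rewrite -e.
have [/beta_off|_] := boolP (val b \in beta); first by rewrite diag.
by have [/gamma_off|//] := boolP (val b \in gamma); rewrite diag.
Qed.

Lemma agree_shape m : (m <= n)%N -> agree m -> shape_below T m = shape_below U m.
Proof.
move=> mn ag; apply/setP => b; apply/imsetP/imsetP => -[d]; rewrite inE => lt ->.
  have [d' Ud'] := std_entry Ustd (leq_trans lt mn).
  by exists d'; rewrite ?inE ?Ud' //; have [] := ag d d' (esym Ud') lt.
have [d' Td'] := std_entry Tstd (leq_trans lt mn).
by exists d'; rewrite ?inE ?Td' //; have [|<-] := ag d' d Td'; rewrite ?Td'.
Qed.

Lemma sact_prod_jm (I : finType) (P : pred I) (k : I -> R[i]) m : (m < n)%N ->
  act (\prod_(i | P i) (jm R n m - k i *: (1 : sergeev R n))) (V U) =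
  (\prod_(i | P i) (entry_content R gamma U m - k i)) *: V U.
Proof.
move=> mn; elim/big_rec2: _ => [|i y x _ IH]; first by rewrite sact1 scale1r.
rewrite sactM IH sactZr sactDl sactN (sactZl _ (k i)) sact1 sact_jm_bvec //.
by rewrite -scalerBl scalerA mulrC.
Qed.

(** By agreement below m, the entry m of U is a possible entry for T. Its content annuls the
    numerator unless it is the actual entry of T, and then numerator and denominator are equal. *)
Lemma sact_efactor m b : (m < n)%N -> T b = m :> nat -> agree m ->
  act (efactor R T beta m b) (V U) = V U /\ agree m.+1 \/
  act (efactor R T beta m b) (V U) = 0 /\ ~ agree m.+1.
Proof.
move=> mn Tb ag; have [d Ud] := std_entry Ustd mn.
rewrite /efactor sactZl sact_prod_jm // (entry_contentE _ _ (std_inj Ustd) Ud).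
rewrite -[cell_content _ _ _]/(content R (val d, val d \in gamma)).
set e := (val b, _); set e' := (val d, _).
have pe : possible_entry (shape_below T m) e.
  apply/andP; split; first exact: shape_below_addable.
  by apply/implyP => /beta_off.
have pe' : possible_entry (shape_below T m) e'.
  rewrite (agree_shape (ltnW mn) ag); apply/andP; split.
    exact: shape_below_addable.
  by apply/implyP => /gamma_off.
have [ee'|ee'] := eqVneq e' e.
  left; split.
    rewrite ee' scalerA mulVf ?scale1r //.
    apply/prodf_neq0 => f /andP[pf fe]; rewrite subr_eq0.
    by apply: contraNneq fe => E; rewrite (content_inj pf pe (esym E)).
  move=> b' d' TU; rewrite ltnS leq_eqVlt => /orP[/eqP Tb'|lt]; last exact: ag.
  have -> : b' = b by apply/(std_inj Tstd)/ord_inj; rewrite Tb.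
  have -> : d' = d by apply/(std_inj Ustd)/ord_inj; rewrite Ud -TU.
  by case: ee' => E1 E2; split; apply: esym.
right; split.
  by rewrite [X in _ *: (X *: _)](bigD1 e') ?pe' ?ee' //= subrr mul0r scale0r scaler0.
move=> /(_ b d); rewrite Tb Ud => /(_ erefl (ltnSn _)) [E1 E2].
by rewrite /e' /e -E2 E1 eqxx in ee'.
Qed.

Lemma sact_eupto m : (m <= n)%N ->
  act (eupto R T beta m) (V U) = V U /\ agree m \/
  act (eupto R T beta m) (V U) = 0 /\ ~ agree m.
Proof.
case: m => [|m]; first by move=> _; left; rewrite sact1; split.
elim: m => [|m IHm] mn; first by left; rewrite sact1; split => //; exact: agree1.
have [b Tb] := std_entry Tstd mn.
have -> : eupto R T beta m.+2 = eupto R T beta m.+1 * efactor R T beta m.+1 b.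
  rewrite [LHS]/=; case: pickP => [b' /eqP Tb'|/(_ b)]; last by rewrite Tb eqxx.
  by rewrite (_ : b' = b) //; apply/(std_inj Tstd)/ord_inj; rewrite Tb.
have [[_ ag]|[E nag]] := IHm (ltnW mn).
  rewrite sactM; have [[-> ag']|[-> nag']] := sact_efactor mn Tb ag.
    by have [[-> _]|[_ /(_ ag)//]] := IHm (ltnW mn); left.
  by right; rewrite sactr0.
(* Once killed, v_U stays killed, since the further factor acts on it by a scalar. *)
right; split; last by move=> ag; apply: nag => b' d TU lt; apply: ag => //; exact: ltnW.
rewrite sactM /efactor sactZl sact_prod_jm // scalerA sactZr E.
exact: scaler0.
Qed.

End Idempotent.

(** * Linear independence and the theorem *)

Section IntertwinerWords.
Variables (R : realType) (n : nat) (la : strict_part n) (beta : {set box n}).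
Local Notation act := (sact (la := la) beta).
Local Notation V := (bvec R).
Implicit Types (F : filling la) (w : 'S_n) (s : seq 'I_n.-1).

Lemma sact_word w s F : word_for w s -> exists k : R[i],
  act (\prod_(a <- s) intertwiner R n a) (V F) = k *: V (pact w F).
Proof.
elim: s w => [|a s IHs] w.
  by move/word_for_nil->; exists 1; rewrite big_nil sact1 scale1r pact1.
move/word_for_cons/IHs => [k E]; rewrite big_cons sactM E sactZr.
rewrite sact_intertwiner_bvec scalerA; eexists; congr (_ *: V _).
by rewrite -pact_adj -pactM adj_permK.
Qed.

Variable T : stableau la.
Local Notation R0 := (row_tableau la).

(** The first letter a is a descent: the row tableau has a smaller entry in the cell of a + 1 than
    in that of a. So the cell of a does not precede that of a + 1, and they can be exchanged. *)
Lemma descent_std w a s : reduced_for w (a :: s) -> is_standard (pact w R0) ->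
  is_standard (pact (w * adj_perm a)%g R0).
Proof.
move=> /reduced_descent[_ des] wstd; rewrite pactM pact_adj.
have [b [b' [Tb Tb' _ _]]] := std_consecutive R beta a wstd.
have Tbb' : pact w R0 b' = (pact w R0 b).+1 :> nat by rewrite Tb Tb'.
rewrite (tab_swap_std wstd Tbb' Tb).
have R0E d k : pact w R0 d = k -> R0 d = (w^-1)%g k.
  by rewrite ffunE => <-; rewrite permK.
have Rb : R0 b = (w^-1)%g (adj_lo a) by apply: R0E; exact: ord_inj.
have Rb' : R0 b' = (w^-1)%g (adj_hi a) by apply: R0E; exact: ord_inj.
apply/negP => le; have neq : b != b' by apply/eqP => e; rewrite e Tb' in Tb; lia.
by have := row_tableau_lt le neq; rewrite Rb Rb'; lia.
Qed.

(** By [descent_std] all tableaux between the row tableau and its image under w are standard, so no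
    intertwiner coefficient vanishes in either direction. *)
Lemma sact_reduced w s : reduced_for w s -> is_standard (pact w R0) ->
  exists k l : R[i], [/\ k != 0, l != 0,
    act (\prod_(a <- s) intertwiner R n a) (V R0) = k *: V (pact w R0) &
    act (\prod_(a <- rev s) intertwiner R n a) (V (pact w R0)) = l *: V R0].
Proof.
elim: s w => [|a s IHs] w.
  case=> /word_for_nil-> _ _; exists 1, 1.
  by rewrite !big_nil !sact1 !scale1r pact1 oner_eq0.
move=> wred wstd; have wstd' := descent_std wred wstd.
have [wred' _] := reduced_descent wred.
have [k [l [k0 l0 Ek El]]] := IHs _ wred' wstd'.
have tab_swapE : tab_swap a (pact (w * adj_perm a)%g R0) = pact w R0.
  by rewrite -pact_adj -pactM adj_permK.
have tab_swapE' : tab_swap a (pact w R0) = pact (w * adj_perm a)%g R0 by rewrite pactM pact_adj.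
exists (k * intertwiner_coef R beta a (pact (w * adj_perm a)%g R0)).
exists (intertwiner_coef R beta a (pact w R0) * l); split.
- by rewrite mulf_neq0 // intertwiner_coef_neq0 // tab_swapE.
- by rewrite mulf_neq0 // intertwiner_coef_neq0 // tab_swapE'.
- by rewrite big_cons sactM Ek sactZr sact_intertwiner_bvec scalerA tab_swapE.
by rewrite rev_cons big_rcons sactM /= sact_intertwiner_bvec sactZr tab_swapE' El scalerA.
Qed.

Lemma sact_phi : exists2 k : R[i], k != 0 &
  act (phi R (dperm T)) (V R0) = k *: V (val T).
Proof.
have std : is_standard (pact (dperm T) R0) by rewrite pact_dperm; exact: valP.
have [k [_ [k0 _ E _]]] := sact_reduced (reduced_wordP _) std.
by exists k; rewrite // -[in RHS]pact_dperm.
Qed.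

Lemma sact_phi_star : exists2 k : R[i], k != 0 &
  act (phi_star R (dperm T)) (V (val T)) = k *: V R0.
Proof.
have std : is_standard (pact (dperm T) R0) by rewrite pact_dperm; exact: valP.
(* [phi_star] uses the word chosen for the inverse; its reversal is a reduced word of [dperm T], to
   which the second half of [sact_reduced] applies. *)
have wred := reduced_for_rev (reduced_wordP (dperm T)^-1%g).
rewrite invgK in wred.
have [_ [k [_ k0 _ E]]] := sact_reduced wred std.
by exists k; rewrite // -pact_dperm -E revK.
Qed.

End IntertwinerWords.

Section ZetaAction.
Variables (R : realType) (n : nat).
Local Notation V := (bvec R).

Lemma bars_off (la : strict_part n) (beta : bars la) b :
  b \in val beta -> ~~ on_diagonal b.
Proof.
by move=> bB; have /fintype.subsetP/(_ _ bB) := valP beta; rewrite inE => /andP[].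
Qed.

Lemma agree_shape_eq (la mu : strict_part n) (beta gamma : {set box n})
    (T : filling la) (U : filling mu) :
  is_standard T -> is_standard U -> agree beta gamma T U n -> la = mu.
Proof.
move=> Tstd Ustd ag; apply: diagram_inj; apply/setP => b; apply/idP/idP => bD.
  pose c : cell la := exist (fun x : box n => x \in diagram n (part_rows la)) b bD.
  have [d Ud] := std_entry Ustd (ltn_ord (T c)).
  by have [] := ag c d (esym Ud) (ltn_ord _) => /= -> _; exact: valP.
pose d : cell mu := exist (fun x : box n => x \in diagram n (part_rows mu)) b bD.
have [c Tc] := std_entry Tstd (ltn_ord (U d)).
have [] := ag c d Tc; first by rewrite Tc.
by move=> /= <- _; exact: valP.
Qed.

Definition index_of (la : strict_part n) (T U : stableau la) (beta : bars la) :
  zeta_index n := existT _ la (T, U, beta).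

Lemma agree_eq (la : strict_part n) (beta gamma : bars la) (F : filling la) :
    is_standard F -> is_standard (row_tableau la) ->
    agree (val beta) (val gamma) (row_tableau la) F n ->
  F = row_tableau la /\ beta = gamma.
Proof.
move=> Fstd Rstd ag.
have eqF d : F d = row_tableau la d.
  have [b Rb] := std_entry Rstd (ltn_ord (F d)).
  have [|/val_inj e _] := ag b d Rb; first by rewrite Rb.
  by rewrite -e in Rb *; apply: ord_inj.
split; first exact/ffunP.
have memE (b : cell la) : (val b \in val beta) = (val b \in val gamma).
  by have [] := ag b b (congr1 val (esym (eqF b))) (ltn_ord _).
have sub (g : bars la) b : b \in val g -> b \in diagram n (part_rows la).
  by move=> bg; have /fintype.subsetP/(_ _ bg) := valP g; rewrite inE => /andP[].
apply/val_inj/setP => b; apply/idP/idP => bB.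
  by have := memE (exist (fun x : box n => x \in diagram n (part_rows la)) b (sub _ _ bB)); rewrite /= bB.
by have := memE (exist (fun x : box n => x \in diagram n (part_rows la)) b (sub _ _ bB)); rewrite /= bB => ->.
Qed.

Lemma sact_zeta_diag (la : strict_part n) (T U : stableau la) (beta : bars la) :
  exists2 k : R[i], k != 0 &
    sact (la := la) (val beta) (zeta R T U beta) (V (val U)) = k *: V (val T).
Proof.
have [k k0 Ek] := sact_phi_star R (val beta) U.
have [l l0 El] := sact_phi R (val beta) T.
have Rstd := row_tableau_std T.
exists (k * l); first exact: mulf_neq0.
rewrite /zeta !sactM Ek !sactZr -scalerA -El; congr (_ *: sact _ _ _).
have [[//]|[_ []]] := sact_eupto R (@bars_off la beta) (@bars_off la beta) Rstd Rstd (leqnn n).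
by move=> b d /ord_inj/(std_inj Rstd)->.
Qed.

(** [phi_star] sends v_U' to a multiple of v_F with F = d(U)^(-1) U'. The idempotent spares v_F only
    if F is the row tableau of the same shape and bars; then U' = U, and the result is a multiple of
    v_T with T different from T'. *)
Lemma sact_zeta_off (la mu : strict_part n) (T U : stableau la) (beta : bars la)
    (T' U' : stableau mu) (gamma : bars mu) :
  index_of T U beta <> index_of T' U' gamma ->
  sact (la := mu) (val gamma) (zeta R T U beta) (V (val U')) T' = 0.
Proof.
move=> neq; rewrite /zeta !sactM; set F := pact (dperm U)^-1%g (val U').
have [k ->] : exists k : R[i], sact (la := mu) (val gamma) (phi_star R (dperm U)) (V (val U')) = k *: V F.
  by have [ws _] := reduced_wordP (dperm U)^-1%g; exact: sact_word ws.
rewrite !sactZr.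
have [Fstd|Fnstd] := boolP (is_standard F); last first.
  by rewrite bvec_nstd // !sactr0 scaler0 ffunE.
have Rstd := row_tableau_std U.
have [[E ag]|[-> _]] := sact_eupto R (@bars_off la beta) (@bars_off mu gamma) Rstd Fstd (leqnn n);
  last by rewrite sactr0 scaler0 ffunE.
have e := agree_shape_eq Rstd Fstd ag; subst mu.
have [FE bg] := agree_eq Fstd Rstd ag; subst gamma.
have UU' : U = U'.
  apply: val_inj; rewrite -(pact_dperm U) -FE /F -pactM mulVg pact1 //.
subst U'.
have TT' : T <> T' by move=> e; rewrite e in neq.
have [l _ El] := sact_phi R (val beta) T.
rewrite /eelt E FE El !ffunE; suff /negbTE-> : val T' != val T by rewrite !scaler0.
by apply/eqP => /val_inj e; apply: TT'.
Qed.

(** Applied to v_U' in the module of (mu, gamma) and read at T', the relation isolates one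
    coefficient times a nonzero scalar. *)
Lemma zeta_indep (a : zeta_index n -> palg (cliff R[i] n)) :
  \sum_k clifford_in (a k) * zeta_family R k = 0 -> forall k, a k = 0.
Proof.
move=> a0 [mu [[T' U'] gamma]]; set k0 := existT _ _ _.
have := congr1 (fun z => sact (la := mu) (val gamma) z (V (val U')) T') a0.
rewrite sact0 sact_sum sum_ffunE (bigD1 k0) //= big1 ?addr0 => [|[la [[T U] beta]] neq].
  rewrite sactM sact_clifford.
  have [k k_neq0 ->] := sact_zeta_diag T' U' gamma.
  rewrite lactZr !ffunE eqxx mulr1 => E.
  by rewrite -[a _]scale1r -(mulVf k_neq0) -scalerA E scaler0.
rewrite sactM sact_clifford ffunE sact_zeta_off ?mulr0 //.
by move=> e; rewrite -[existT _ la _]/(index_of T U beta) e eqxx in neq.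
Qed.

End ZetaAction.

Lemma palg_fin_ffun_span (K : pzRingType) (P : presentation K) (I : finType) (D : nat)
    (g : 'I_D -> palg P) :
  (forall v, exists a : 'I_D -> K, v = \sum_i a i *: g i) ->
  exists (E : nat) (h : 'I_E -> {ffun I -> palg P}),
    forall v, exists a : 'I_E -> K, v = \sum_i a i *: h i.
Proof.
move=> g_span; pose h (p : I * 'I_D) : {ffun I -> palg P} :=
  [ffun j => if j == p.1 then g p.2 else 0].
exists #|{: I * 'I_D}|, (fun i => h (enum_val i)) => v.
have /fin_all_exists[a aE] i : exists a : 'I_D -> K, v i = \sum_j a j *: g j.
  exact: g_span.
exists (fun i => a (enum_val i).1 (enum_val i).2).
rewrite -(big_enum_val (A := {: I * 'I_D}) (fun p => a p.1 p.2 *: h p)) /=.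
apply/ffunP => j; rewrite sum_ffunE aE.
rewrite (eq_bigl xpredT) // -(pair_bigA _ (fun i l => (a i l *: h (i, l)) j)) /=.
rewrite (bigD1 j) //= [X in _ = _ + X]big1 ?addr0 => [|i ij].
  by apply: eq_bigr => l _; rewrite !ffunE eqxx.
by rewrite big1 // => l _; rewrite !ffunE eq_sym (negbTE ij) scaler0.
Qed.

Theorem theorem3p2 (R : realType) (n : nat) (n_gt0 : (0 < n)%N) :
  left_module_basis (clifford_in (R := R) (n := n)) (zeta_family (n := n) R).
Proof.
pose A := palg (cliff R[i] n); pose I : finType := zeta_index n.
pose W := {ffun I -> A}.
pose f : A -> sergeev R n := clifford_in (R := R) (n := n).
have fD : {morph f : x y / x + y} by exact: clifford_inD.
have fM : {morph f : x y / x * y} by exact: clifford_inM.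
(* The spin words are padded by zeros (the default of [nth]) to a family indexed by the zetas, so
   that the change of family is an endomorphism of one module. *)
pose g (i : I) : sergeev R n := (spin_words R n n)`_(enum_rank i).
have g_span x : exists a : I -> A, x = \sum_i f (a i) * g i.
  have [a ->] := sergeev_span x; exists (fun i => a (enum_rank i)).
  have le : (size (spin_words R n n) <= #|I|)%N.
    by rewrite size_spin_words fact_le_card_zeta_index.
  rewrite (big_ord_widen _ (fun i => f (a i) * (spin_words R n n)`_i) le).
  rewrite [RHS](reindex (@enum_val I I)) /=; last exact: onW_bij (@enum_val_bij I).
  rewrite big_mkcond; apply: eq_bigr => i _; rewrite /g enum_valK.
  by case: ltnP => // ge; rewrite nth_default ?mulr0.
have /fin_all_exists[B BE] k : exists b : I -> A, zeta_family R k = \sum_i f (b i) * g i.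
  exact: g_span.
have f0 : f 0 = 0 by exact: clifford_in0.
have f_sum (J : finType) (F : J -> A) : f (\sum_j F j) = \sum_j f (F j).
  by elim/big_rec2: _ => [|j x y _ <-]; rewrite ?f0 ?fD.
(* Coefficient rows are multiplied by [B] on the right, so [h] is linear over the complex numbers,
   as [inj_endo_surj] requires, although Cl_n is not commutative. *)
pose h (a : W) : W := [ffun i => \sum_k a k * B k i].
have h_lin : linear h.
  move=> k a b; apply/ffunP => i; rewrite !ffunE scaler_sumr -big_split.
  by apply: eq_bigr => j _; rewrite !ffunE mulrDl palg_scalerAl.
have hE (a : W) : \sum_k f (a k) * zeta_family R k = \sum_i f (h a i) * g i.
  under eq_bigr do rewrite BE mulr_sumr.
  rewrite exchange_big; apply: eq_bigr => i _ /=.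
  rewrite ffunE f_sum mulr_suml; apply: eq_bigr => k _.
  by rewrite fM mulrA.
have indep (a b : W) : \sum_k f (a k) * zeta_family R k =
    \sum_k f (b k) * zeta_family R k -> a = b.
  move=> ab; apply/ffunP => k; apply/eqP; rewrite -subr_eq0; apply/eqP.
  apply: (@zeta_indep R n (fun k => a k - b k)) k.
  have fB x y : f (x - y) = f x - f y by rewrite fD; congr (_ + _); exact: clifford_inN.
  under eq_bigr => j _ do rewrite -[clifford_in _]/(f _) fB mulrBl.
  by rewrite sumrB ab subrr.
pose hL := GRing.isLinear.Build _ _ _ _ h h_lin.
pose H : {linear W -> W} := HB.pack h hL.
have h_inj : injective H by move=> a b /= ab; apply: indep; rewrite !hE [h a]ab.
have [D [u u_span]] := clifford_fin_gen R[i] n.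
have [E [v v_span]] := palg_fin_ffun_span I u_span.
move=> x; have [b xE] := g_span x.
have [a aE] := inj_endo_surj v_span h_inj (finfun b).
have aZ : \sum_k f (a k) * zeta_family R k = x.
  rewrite hE xE; apply: eq_bigr => i _.
  by rewrite -[h a]/(H a) aE ffunE.
exists a; split=> [|a' xE']; first exact: esym aZ.
by apply: indep; rewrite aZ; exact: xE'.
Qed.
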